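(* Assume the random walk increment distribution satisfies the convexity assumption and the moment assumption. There exist $c,C>0$ such that, for all $x,y>0$ and $N\in\mathbb N$, $$c\cdot\min\Big(1,\frac{xy}{N}\Big)\le\mathbb P^{x,y}_{[0,N]}\big(X(k)\ge0,\ k=1,\dots,N-1\big)\le C\cdot\min\Big(1,\frac{xy}N\Big),$$ where $\mathbb P^{x,y}_{[0,N]}$ is the law of the random walk bridge $X$ on $\llbracket0,N\rrbracket$ from $x$ to $y$.
   Context: Random walk setup. Fix a function $H_{\mathrm{RW}}:\mathbb R\to\mathbb R\cup\{+\infty\}$ (in the lattice case only its values on $\mathbb Z$ matter). A random walk bridge on $\llbracket \ell,r\rrbracket$ from $u$ to $v$ is the random trajectory $X=(X(\ell),\dots,X(r))$ with $X(\ell)=u$, $X(r)=v$ and probability mass (lattice case: $X$ integer-valued, $u,v\in\mathbb Z$) or density (nonlattice case: real-valued, w.r.t. Lebesgue measure on the interior values) proportional to $\exp(-\sum_{j=\ell}^{r-1}H_{\mathrm{RW}}(X(j+1)-X(j)))$. The increment distribution has mass function (on $\mathbb{Z}$) or density (on $\mathbb{R}$) proportional to $e^{-H_{\mathrm{RW}}}$. Convexity assumption: $H_{\mathrm{RW}}$ is convex (lattice case: its linear interpolation between integers is convex). Moment assumption: $e^{-H_{\mathrm{RW}}}$ has finite positive total mass, and the increment distribution has mean zero, variance $\sigma^2\in(0,\infty)$, and a moment generating function finite in a neighborhood of $0$. Boundary values are always implicitly such that the bridge is well-defined (in particular integer-valued in the lattice case). $H_{\mathrm{RW}}$ is fixed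 and constants may depend on it.
   Formalization: In the nonlattice case the upper bound is proved for x,y ≥ δ with C depending on δ > 0, for every δ: for N = 1 the probability is 1 while min(1,xy) → 0 as x,y → 0, so no single C works for all x,y > 0. The lower bound and the lattice case are as stated. *)

(* Defs.v *)
From HB Require Import structures.
From mathcomp Require Export all_boot all_order all_algebra.
From mathcomp Require Export all_classical all_reals all_analysis.

Set Implicit Arguments.
Unset Strict Implicit.
Unset Printing Implicit Defensive.
Import Order.TTheory GRing.Theory Num.Theory.
Import numFieldNormedType.Exports.

Local Open Scope classical_set_scope.
Local Open Scope ring_scope.

HB.instance Definition _ := isPointed.Build int 0%R.
HB.instance Definition _ := @isMeasurable.Build default_measure_display
  int discrete_measurable discrete_measurable0
  discrete_measurableC discrete_measurableU.

Section RandomWalkBridge.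
Local Open Scope ereal_scope.

(* [T] is the state space, with reference measure [nu] and inclusion [emb] in
   the reals: the integers with the counting measure in the lattice case, the
   reals with the Lebesgue measure in the nonlattice case. *)
Context d (T : measurableType d) (R : realType).
Variables (nu : {measure set T -> \bar R}) (emb : T -> R) (H : R -> \bar R).

Definition rw_mass : \bar R := \int[nu]_z expeR (- H (emb z)).

(* Expectation of [f xi], where the increment [xi] has mass function (or
   density) [expeR (- H)] divided by [rw_mass]. *)
Definition rw_expectation (f : R -> R) : \bar R :=
  \int[nu]_z ((f (emb z))%:E *
              (expeR (- H (emb z)) * ((fine rw_mass)^-1)%:E)).

Definition rw_mean : \bar R := rw_expectation id.

Definition rw_variance : \bar R :=
  rw_expectation (fun z => (z - fine rw_mean) ^+ 2)%R.

Definition moment_assumption : Prop :=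
  [/\ 0 < rw_mass < +oo,
      rw_mean = 0,
      0 < rw_variance < +oo &
      exists2 t0 : R, (0 < t0)%R & forall t : R, (`|t| < t0)%R ->
        rw_expectation (fun z => expR (t * z)) < +oo].

(* Integral over [n] coordinates with respect to the [n]-fold product of [nu],
   as an iterated integral (it is used for nonnegative integrands). *)
Fixpoint iter_integral (n : nat) (F : seq T -> \bar R) : \bar R :=
  if n is m.+1 then \int[nu]_t iter_integral m (fun s => F (t :: s))
  else F [::].

(* The trajectory with X(0) = x, X(i) = s_(i-1) and X((size s) + 1) = y. *)
Definition trajectory (x y : T) (s : seq T) : nat -> T :=
  nth y (x :: rcons s y).

Definition bridge_weight (N : nat) (X : nat -> T) : \bar R :=
  expeR (- \sum_(j < N) H (emb (X j.+1) - emb (X j))).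

Definition bridge_integral (N : nat) (x y : T) (A : set (nat -> T)) : \bar R :=
  iter_integral N.-1 (fun s => bridge_weight N (trajectory x y s) *
                               (\1_A (trajectory x y s))%:E).

Definition bridge_defined (N : nat) (x y : T) : Prop :=
  0 < bridge_integral N x y setT < +oo.

(* Probability that the bridge on [0, N] from [x] to [y] lies in [A]; it is
   meaningful when [0 < N] and [bridge_defined N x y]. *)
Definition bridge_prob (N : nat) (x y : T) (A : set (nat -> T)) : R :=
  (fine (bridge_integral N x y A) / fine (bridge_integral N x y setT))%R.

Definition stays_nonneg (N : nat) : set (nat -> T) :=
  [set X | forall k, (1 <= k <= N.-1)%N -> (0 <= emb (X k))%R].

End RandomWalkBridge.

Section Convexity.
Context (R : realType).
Local Open Scope ereal_scope.

(* Meant for functions that avoid [-oo]; recall that [0 * +oo = 0]. *)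
Definition convex_ereal (f : R -> \bar R) : Prop :=
  forall a b t : R, (0 <= t <= 1)%R ->
    f (t * a + (1 - t) * b)%R <= t%:E * f a + (1 - t)%:E * f b.

Definition lattice_interpolation (H : R -> \bar R) (x : R) : \bar R :=
  let k : int := Num.floor x in let t : R := (x - k%:~R)%R in
  (1 - t)%:E * H k%:~R + t%:E * H (k + 1)%:~R.

End Convexity.

Definition lattice_measure (R : realType) : {measure set int -> \bar R} :=
  @counting int R.

Definition lattice_emb (R : realType) : int -> R := fun k => k%:~R.

Definition nonlattice_measure (R : realType) :
  {measure set (measurableTypeR R) -> \bar R} := @lebesgue_measure R.

Definition nonlattice_emb (R : realType) : measurableTypeR R -> R := fun z => z.

Section Cases.
Context (R : realType) (H : R -> \bar R).

Definition lattice_moment : Prop :=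
  moment_assumption (lattice_measure R) (@lattice_emb R) H.
Definition lattice_convex : Prop := convex_ereal (lattice_interpolation H).
Definition lattice_bridge_defined : nat -> int -> int -> Prop :=
  bridge_defined (lattice_measure R) (@lattice_emb R) H.
Definition lattice_bridge_prob (N : nat) (x y : int) : set (nat -> int) -> R :=
  bridge_prob (lattice_measure R) (@lattice_emb R) H N x y.

Definition nonlattice_moment : Prop :=
  moment_assumption (nonlattice_measure R) (@nonlattice_emb R) H.
Definition nonlattice_bridge_defined : nat -> R -> R -> Prop :=
  bridge_defined (nonlattice_measure R) (@nonlattice_emb R) H.
Definition nonlattice_bridge_prob (N : nat) (x y : R) : set (nat -> R) -> R :=
  bridge_prob (nonlattice_measure R) (@nonlattice_emb R) H N x y.

End Cases.

(* Main.v *)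
From HB Require Import structures.
Require Import Defs.
From mathcomp Require Import measurable_realfun ring lra zify.

(** Both cases are treated at once, on a state space [T] (the integers or the
    reals) on which the increment density gives a transition kernel [p]. The
    kernel of n + 1 steps is [kern nu p (fun=> 1) n], written p_n below;
    [kern nu p (chi e) n], written q_n, is its restriction to the paths whose
    intermediate points are nonnegative. The probability in the theorem is
    q_n(x, y) / p_n(x, y) with n = N - 1, so that it has to be shown that
      c min(1, x y / N) p_n(x, y) <= q_n(x, y) <= C ((x + 1)(y + 1) / N) p_n(x, y);
    for x and y bounded below, x + 1 and y + 1 are comparable to x and y, and the
    minimum with 1 in the upper bound comes from q_n <= p_n.

    Convexity is used through one inequality. It makes p totally positive
    ([tp2_weight]), and the four functions theorem of Ahlswede and Daykin
    ([four_functions]) propagates total positivity along the path ([kern_holley]):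
      q_n(x, y) p_n(x', y') <= q_n(max(x, x'), max(y, y')) p_n(min(x, x'), min(y, y')).
    Hence q_n / p_n increases with the end points, staying nonnegative is
    positively associated with being large, and p_n(x, .) is log-concave. The
    last fact replaces a local limit theorem: a log-concave density with variance
    of order n is at most C / sqrt n ([kern_sup]), and at least c / sqrt n within
    a sqrt n of its mean ([center_bound]). These bounds are uniform over the
    exponential tilts of the walk by small parameters ([family_exists]). A tilt
    changes the drift but leaves the bridges unchanged ([kern_tilt]), so the drift
    can be chosen to suit the end points.

    Upper bound. Let u_n(x) be the probability that the walk from x stays
    nonnegative. Association gives u_n(x) E[X_n^+] <= E[X_n; stay], where E[X_n^+]
    has order sqrt n, while E[X_n; stay] <= x + C for a centred walk because
    overshoots below 0 have bounded mean. Hence u_n(x) <= C (x + 1) / sqrt n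
    ([stay_upper]). Let x <= y, the other case being its time reversal. For y of
    order sqrt n, cut the path into thirds and bound the outer ones by u and the
    middle one by C / sqrt n ([kern_upper_central]). For larger y, tilt so that the
    walk typically ends beyond y at time n, compare with the central end point
    by monotonicity of q_n / p_n, and use u only up to the time when the
    drift wins over the fluctuations ([kern_upper_steep]). If y is at least a fixed
    multiple of n, the bound follows from q_n <= p_n.

    Lower bound. Under a tilt by lam the function exp(-lam x) is a martingale up to
    a factor at most 1, so the tilted walk stays nonnegative with probability at
    least 1 - exp(-lam x) ([stay_exp]). If y >= K sqrt n, take lam of order y / n;
    the upper bound shows that the end points above y contribute little, and
    monotonicity moves all others to y ([lower_steep]). For smaller end points, cut
    at the middle: the bridge from x to y is above K sqrt n there with a probability
    bounded below, by comparison with the bridge from 0 to 0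
    ([midpoint_lower]), and each half falls under the previous case
    ([kern_lower]). Starting points below 1 and small n are handled by the
    positivity of p near the diagonal ([small_times]). *)

Set Implicit Arguments.
Unset Strict Implicit.
Unset Printing Implicit Defensive.
Import Order.TTheory GRing.Theory Num.Theory.
Import numFieldNormedType.Exports.

Local Open Scope classical_set_scope.
Local Open Scope ring_scope.

(** * Integrals and the four functions theorem *)

Section Sections.
Context d (T : measurableType d) (R : realType).
Implicit Types (f : T -> R) (k : T -> T -> R).

Definition measurable2 k := measurable_fun setT (fun z : T * T => k z.1 z.2).

Lemma measurable2_row k x : measurable2 k -> measurable_fun setT (k x).
Proof. by move=> mk; exact: (@measurable_fun_pair2 _ _ _ _ _ _ (fun z => k z.1 z.2)). Qed.

Lemma measurable2_col k y : measurable2 k -> measurable_fun setT (k^~ y).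
Proof. by move=> mk; exact: (@measurable_fun_pair1 _ _ _ _ _ _ (fun z => k z.1 z.2)). Qed.

Lemma measurable2_fst f : measurable_fun setT f -> measurable2 (fun x y => f x).
Proof. by move=> mf; apply: measurableT_comp. Qed.

Lemma measurable2_snd f : measurable_fun setT f -> measurable2 (fun x y => f y).
Proof. by move=> mf; apply: measurableT_comp. Qed.

Lemma measurable2M k k' : measurable2 k -> measurable2 k' ->
  measurable2 (fun x y => k x y * k' x y).
Proof. exact: measurable_funM. Qed.

Lemma measurable2_swap k : measurable2 k -> measurable2 (fun x y => k y x).
Proof.
move=> mk; apply: (@measurableT_comp _ _ _ _ _ _ (fun z => k z.1 z.2) _ (fun z => (z.2, z.1))) => //.
exact: measurable_swap.
Qed.
End Sections.

Ltac mfun := repeat match goal with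
  | |- _ -> _ => move=> ?
  | |- measurable2 _ => first
     [ assumption | apply: measurable2M | apply: measurable2_fst | apply: measurable2_snd ]
  | |- measurable_fun _ (fun x => GRing.mul (@?a x) (@?b x)) => apply: measurable_funM
  | |- measurable_fun _ (fun x => GRing.add (@?a x) (GRing.opp (@?b x))) => apply: measurable_funB
  | |- measurable_fun _ (fun x => GRing.add (@?a x) (@?b x)) => apply: measurable_funD
  | |- measurable_fun _ (fun x => GRing.exp (@?a x) _) => apply: measurable_funX
  | |- measurable_fun _ _ => first
     [ assumption | apply: measurable_cst | apply: measurable_id
     | apply: measurable2_row; assumption | apply: measurable2_col; assumption ]
  end.

Ltac pos := repeat first
  [ done | apply: divr_gt0 | apply: mulr_gt0 | apply: exprn_gt0 | apply: addr_gt0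
  | exact: ltr0Sn | exact: expR_gt0 | rewrite invr_gt0 | rewrite sqrtr_gt0 ].

Ltac nn := repeat first
  [ done | move=> ? | apply: sqr_ge0 | apply: addr_ge0 | apply: mulr_ge0 | apply: divr_ge0
  | apply: exprn_ge0 | exact: ler0n | exact: expR_ge0 | exact: sqrtr_ge0
  | rewrite invr_ge0 | exact: ltW ].

Section Integral.
Context d (T : measurableType d) (R : realType).
Variable nu : {sigma_finite_measure set T -> \bar R}.

(** Integrands are real and nonnegative throughout, so that Tonelli's theorem and
    monotonicity apply without integrability conditions. *)
Definition itg (f : T -> R) : \bar R := (\int[nu]_t (f t)%:E)%E.
Definition ritg (f : T -> R) : R := fine (itg f).

Implicit Types f g : T -> R.

Lemma itg_ge0 f : (forall t, 0 <= f t) -> (0 <= itg f)%E.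
Proof. by move=> f0; apply: integral_ge0 => t _; rewrite lee_fin. Qed.

Lemma ritg_ge0 f : (forall t, 0 <= f t) -> 0 <= ritg f.
Proof. by move=> f0; apply: fine_ge0; exact: itg_ge0. Qed.

Lemma le_itg f g : measurable_fun setT f -> measurable_fun setT g ->
  (forall t, 0 <= f t) -> (forall t, f t <= g t) -> (itg f <= itg g)%E.
Proof.
move=> mf mg f0 fg; apply: ge0_le_integral => //.
- by move=> t _; rewrite lee_fin.
- exact/measurable_EFinP.
- exact/measurable_EFinP.
- by move=> t _; rewrite lee_fin.
Qed.

Lemma eq_itg f g : f =1 g -> itg f = itg g.
Proof. by move=> fg; congr itg; apply/funext. Qed.

Lemma itgD f g : measurable_fun setT f -> measurable_fun setT g ->
  (forall t, 0 <= f t) -> (forall t, 0 <= g t) ->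
  itg (fun t => f t + g t) = (itg f + itg g)%E.
Proof.
move=> mf mg f0 g0; rewrite /itg; under eq_integral do rewrite EFinD.
by rewrite ge0_integralD//; try (by move=> t _; rewrite lee_fin);
  apply/measurable_EFinP.
Qed.

Lemma itgZ c f : measurable_fun setT f -> (forall t, 0 <= f t) -> 0 <= c ->
  itg (fun t => c * f t) = (c%:E * itg f)%E.
Proof.
move=> mf f0 c0; rewrite /itg; under eq_integral do rewrite EFinM.
by rewrite ge0_integralZl_EFin//; [move=> t _; rewrite lee_fin | apply/measurable_EFinP].
Qed.

Lemma itg0 : itg (fun=> 0) = 0%E.
Proof. by rewrite /itg integral0. Qed.

Lemma itg_fin f : (forall t, 0 <= f t) -> (itg f < +oo)%E -> itg f = (ritg f)%:E.
Proof.
by move=> f0 fi; rewrite fineK// ge0_fin_numE//; exact: itg_ge0.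
Qed.

Lemma itg_le_fin f (c : R) : (forall t, 0 <= f t) -> (itg f <= c%:E)%E ->
  itg f = (ritg f)%:E /\ ritg f <= c.
Proof.
move=> f0 fc; have E : itg f = (ritg f)%:E.
  by apply: itg_fin => //; rewrite (le_lt_trans fc)// ltry.
by split=> //; rewrite -lee_fin -E.
Qed.

Lemma itg_eq0_support (f g : T -> R) : measurable_fun setT f -> measurable_fun setT g ->
  (forall t, 0 <= f t) -> (forall t, 0 <= g t) -> (forall t, f t = 0 -> g t = 0) ->
  itg f = 0%E -> itg g = 0%E.
Proof.
move=> mf mg f0 g0 fg If.
have abs0 : (\int[nu]_t `|(f t)%:E| = 0)%E.
  by rewrite -If; apply: eq_integral => t _; rewrite abse_EFin ger0_norm.
have mfE : measurable_fun setT (EFin \o f) by exact/measurable_EFinP.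
have ae := (ae_eq_integral_abs nu measurableT mfE).1 abs0.
rewrite /itg (_ : (\int[nu]_t _)%E = (\int[nu]_t cst 0 t)%E); first by rewrite integral0.
apply: ge0_ae_eq_integral => //.
- exact/measurable_EFinP.
- by move=> t _; rewrite lee_fin.
by apply: filterS ae => t /= H tT; have := H tT => -[E]; congr EFin; exact: fg.
Qed.

Lemma measurable_itg (F : T -> T -> R) :
  measurable2 F -> (forall s t, 0 <= F s t) ->
  measurable_fun setT (fun s => itg (F s)).
Proof.
move=> mF F0.
have := @measurable_fun_fubini_tonelli_F _ _ T T R nu (fun z => (F z.1 z.2)%:E).
by apply; [apply/measurable_EFinP | move=> z; rewrite lee_fin].
Qed.

Lemma itg_tonelli (F : T -> T -> R) :
  measurable2 F -> (forall s t, 0 <= F s t) ->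
  (\int[nu]_s itg (F s) = \int[nu]_t itg (F^~ t))%E.
Proof.
move=> mF F0.
have := @fubini_tonelli _ _ T T R nu nu (fun z => (F z.1 z.2)%:E).
by apply; [apply/measurable_EFinP | move=> z; rewrite lee_fin].
Qed.

Lemma measurable_tensor (f g : T -> R) : measurable_fun setT f -> measurable_fun setT g ->
  measurable2 (fun s t => f s * g t).
Proof. by move=> mf mg; mfun. Qed.

Lemma itg_tensor f g : measurable_fun setT f -> measurable_fun setT g ->
  (forall t, 0 <= f t) -> (forall t, 0 <= g t) ->
  (\int[nu]_s itg (fun t => (f s * g t)%R) = itg f * itg g)%E.
Proof.
move=> mf mg f0 g0.
rewrite -(ge0_integralZr _ measurableT)//; last 3 first.
- exact/measurable_EFinP.
- by move=> s _; rewrite lee_fin.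
- exact: itg_ge0.
by apply: eq_integral => s _; rewrite itgZ.
Qed.

Variable e : T -> R.
Definition mx s t := if e s <= e t then t else s.
Definition mn s t := if e s <= e t then s else t.

(** The product of two integrals, symmetrised in the two variables; this is what
    allows the pointwise comparison in [four_functions] to treat the pairs (s, t)
    and (t, s) together. *)
Lemma itg_tensor_sym f g : measurable_fun setT f -> measurable_fun setT g ->
  (forall t, 0 <= f t) -> (forall t, 0 <= g t) ->
  (\int[nu]_s itg (fun t => (f s * g t + g s * f t)%R) = itg f * itg g + itg f * itg g)%E.
Proof.
move=> mf mg f0 g0.
transitivity (\int[nu]_s (itg (fun t => (f s * g t)%R) + itg (fun t => (g s * f t)%R)))%E.
  apply: eq_integral => s _; rewrite itgD//; try (by move=> t; rewrite mulr_ge0);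
    by apply: measurable_funM.
rewrite ge0_integralD//; last 4 first.
- by move=> s _; apply: itg_ge0 => t; rewrite mulr_ge0.
- by apply: measurable_itg => [|s t]; [exact: measurable_tensor | rewrite mulr_ge0].
- by move=> s _; apply: itg_ge0 => t; rewrite mulr_ge0.
- by apply: measurable_itg => [|s t]; [exact: measurable_tensor | rewrite mulr_ge0].
by rewrite !itg_tensor// [X in (_ + X)%E]muleC.
Qed.

(** From (A - a)(A - b) >= 0: A (a + b) <= A^2 + a b <= A (A + B). *)
Lemma four_point (a b A B : R) : 0 <= a -> 0 <= b -> 0 <= B -> a <= A -> b <= A ->
  a * b <= A * B -> a + b <= A + B.
Proof.
move=> a0 b0 B0 aA bA ab; have [A0|A0] := eqVneq A 0; first by lra.
have Ap : 0 < A by rewrite lt_def A0 (le_trans a0 aA).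
have : A * (a + b) <= A * (A + B) by nra.
by rewrite ler_pM2l.
Qed.

(** The theorem of Ahlswede and Daykin on a chain. After symmetrisation, it
    reduces to [four_point] for the pair (s, t), with a and b the products of
    f1 and f2 at (s, t) and (t, s). *)
Theorem four_functions f1 f2 f3 f4 :
  measurable_fun setT f1 -> measurable_fun setT f2 ->
  measurable_fun setT f3 -> measurable_fun setT f4 ->
  (forall t, 0 <= f1 t) -> (forall t, 0 <= f2 t) ->
  (forall t, 0 <= f3 t) -> (forall t, 0 <= f4 t) ->
  (forall s t, f1 s * f2 t <= f3 (mx s t) * f4 (mn s t)) ->
  (itg f1 * itg f2 <= itg f3 * itg f4)%E.
Proof.
move=> m1 m2 m3 m4 p1 p2 p3 p4 H.
suff : ((2%:R : R)%:E * (itg f1 * itg f2) <= (2%:R : R)%:E * (itg f3 * itg f4))%E.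
  by rewrite lee_pmul2l// lte_fin; exact: ltr0n.
have two (x : \bar R) : ((2%:R : R)%:E * x = x + x)%E by rewrite mule_natl mule2n.
rewrite !two -!itg_tensor_sym//.
apply: ge0_le_integral => //.
- by move=> s _; apply: itg_ge0 => t; rewrite addr_ge0// mulr_ge0.
- apply: measurable_itg => [|s t]; last by rewrite addr_ge0// mulr_ge0.
  by apply: measurable_funD; exact: measurable_tensor.
- apply: measurable_itg => [|s t]; last by rewrite addr_ge0// mulr_ge0.
  by apply: measurable_funD; exact: measurable_tensor.
move=> s _; apply: le_itg => [||t|t].
- by apply: measurable_funD; apply: measurable_funM.
- by apply: measurable_funD; apply: measurable_funM.
- by rewrite addr_ge0// mulr_ge0.
have Hs := H s s; have Ht := H t t; move: (H s t) (H t s) Hs Ht.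
rewrite /mx /mn !lexx.
have P (s' t' : T) : f1 s' * f2 t' * (f2 s' * f1 t') = (f1 s' * f2 s') * (f1 t' * f2 t') by ring.
have K (s' t' : T) : f1 s' * f2 s' <= f3 s' * f4 s' -> f1 t' * f2 t' <= f3 t' * f4 t' ->
    f1 s' * f2 t' <= f3 t' * f4 s' -> f1 t' * f2 s' <= f3 t' * f4 s' ->
    f1 s' * f2 t' + f2 s' * f1 t' <= f3 t' * f4 s' + f4 t' * f3 s'.
  move=> L1 L2 L3 L4; apply: four_point; rewrite ?mulr_ge0 ?[f2 s' * _]mulrC//.
  have := ler_pM (mulr_ge0 (p1 s') (p2 s')) (mulr_ge0 (p1 t') (p2 t')) L1 L2; nra.
have [st|st] := leP (e s) (e t); have [ts|ts] := leP (e t) (e s) => L1 L2 L3 L4.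
- by rewrite [f4 s * _]mulrC [f2 s * _]mulrC; lra.
- by have := K s t L3 L4 L1 L2; lra.
- by have := K t s L4 L3 L2 L1; lra.
- lra.
Qed.

End Integral.

(** * Killed kernels *)

Section Kernel.
Context d (T : measurableType d) (R : realType).
Variable nu : {sigma_finite_measure set T -> \bar R}.

(** Mass one in both variables makes the reversed kernel of the same kind. The
    bound keeps all iterated kernels finite at every point. *)
Record doubly_stochastic (p : T -> T -> R) : Prop := DoublyStochastic {
  ds_ge0 : forall x y, 0 <= p x y;
  ds_meas : measurable2 p;
  ds_bound : exists B, forall x y, p x y <= B;
  ds_row : forall x, itg nu (p x) = 1%E;
  ds_col : forall y, itg nu (p^~ y) = 1%E }.

Record killing (chi : T -> R) : Prop := Killing {
  kill_meas : measurable_fun setT chi;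
  kill_ge0 : forall t, 0 <= chi t;
  kill_le1 : forall t, chi t <= 1 }.

Lemma no_killing : killing (fun=> 1).
Proof. by split. Qed.

(** The index counts the intermediate points, so [kern p chi n] makes n + 1 steps.
    The weight is applied at intermediate points and not at the two ends, as in the
    event of the theorem. *)
Fixpoint kern (p : T -> T -> R) (chi : T -> R) n x y : R :=
  if n is m.+1 then ritg nu (fun t => p x t * chi t * kern p chi m t y) else p x y.

Section Basics.
Variables (p : T -> T -> R) (chi : T -> R).
Hypotheses (P : doubly_stochastic p) (K : killing chi).
Let p0 := ds_ge0 P.
Let pm := ds_meas P.
Let c0 := kill_ge0 K.
Let c1 := kill_le1 K.
Let cm := kill_meas K.
Local Notation k := (kern p chi).

Lemma kern_ge0 n x y : 0 <= k n x y.
Proof.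
by elim: n x y => //= n IH x y; apply: ritg_ge0 => t; rewrite !mulr_ge0.
Qed.

Lemma itg_p x (f : T -> R) B : (forall t, 0 <= f t) -> (forall t, f t <= B) ->
  measurable_fun setT f -> (itg nu (fun t => p x t * f t)%R <= B%:E)%E.
Proof.
move=> f0 fB mf; have mpx := measurable2_row x pm.
have B0 : 0 <= B by rewrite (le_trans (f0 x)).
apply: (@le_trans _ _ (itg nu (fun t => B * p x t))); last first.
  by rewrite itgZ// ds_row// mule1.
apply: le_itg; [mfun|mfun| |] => t; first by rewrite mulr_ge0.
by rewrite mulrC ler_wpM2r.
Qed.

(** Measurability and boundedness are proved together: the induction step uses
    both for the previous kernel. *)
Lemma kern_facts n : measurable2 (k n) /\ exists B, forall x y, k n x y <= B.
Proof.
elim: n => [|n [mn [B hB]]]; first by split=> //; exact: ds_bound.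
have int x y : (itg nu (fun t => (p x t * chi t * k n t y))%R <= B%:E)%E.
  under eq_itg do rewrite -mulrA.
  have mny := measurable2_col y mn.
  apply: itg_p; [by move=> t; rewrite mulr_ge0// kern_ge0| |mfun] => t.
  by rewrite (le_trans _ (hB t y))// ler_piMl// kern_ge0.
split; last first.
  exists B => x y; apply: (itg_le_fin _ (int x y)).2 => t.
  by rewrite !mulr_ge0// kern_ge0.
apply: (@measurableT_comp _ _ _ _ _ _ fine) => //.
have := @measurable_fun_fubini_tonelli_F _ _ (T * T)%type T R nu
  (fun z => (p z.1.1 z.2 * chi z.2 * k n z.2 z.1.2)%:E).
apply; last by move=> z; rewrite lee_fin !mulr_ge0// kern_ge0.
apply/measurable_EFinP; apply: measurable_funM; first apply: measurable_funM.
- apply: (@measurableT_comp _ _ _ _ _ _ (fun z => p z.1 z.2) _ (fun z : T * T * T => (z.1.1, z.2))) => //.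
  by apply: measurable_fun_pair => //; apply: measurableT_comp.
- exact: measurableT_comp.
apply: (@measurableT_comp _ _ _ _ _ _ (fun z => k n z.1 z.2) _ (fun z : T * T * T => (z.2, z.1.2))) => //.
by apply: measurable_fun_pair => //; apply: measurableT_comp.
Qed.

Lemma measurable_kern n : measurable2 (k n).
Proof. exact: (kern_facts n).1. Qed.
Let mkern := measurable_kern.

Lemma kern_row n x : measurable_fun setT (k n x).
Proof. exact: measurable2_row. Qed.

Lemma kern_col n y : measurable_fun setT (fun x => k n x y).
Proof. exact: measurable2_col. Qed.

Lemma kernSE n x y :
  (k n.+1 x y)%:E = itg nu (fun t => p x t * chi t * k n t y).
Proof.
have [_ [B hB]] := kern_facts n.
rewrite -itg_fin//; first by move=> t; rewrite !mulr_ge0// kern_ge0.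
apply: (@le_lt_trans _ _ B%:E); last exact: ltry.
under eq_itg do rewrite -mulrA.
have mny := measurable2_col y (mkern n).
apply: itg_p; [by move=> t; rewrite mulr_ge0// kern_ge0| |mfun] => t.
by rewrite (le_trans _ (hB t y))// ler_piMl// kern_ge0.
Qed.

(** The Chapman-Kolmogorov equation, with the weight at the time of the cut. *)
Lemma kern_CK m n x y :
  (k (m + n).+1 x y)%:E = itg nu (fun z => k m x z * chi z * k n z y).
Proof.
elim: m x y => [|m IH] x y; first by rewrite add0n kernSE.
rewrite addSn kernSE.
have mny := measurable2_col y (mkern n).
have mx := measurable2_row x pm.
transitivity (\int[nu]_t itg nu (fun z => (p x t * chi t * k m t z) * chi z * k n z y)%R)%E.
  apply: eq_integral => t _; rewrite EFinM IH -itgZ; last by rewrite mulr_ge0.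
  - by apply: eq_itg => z; rewrite !mulrA.
  - by have := kern_row m t; mfun.
  - by move=> z; rewrite !mulr_ge0// kern_ge0.
rewrite itg_tonelli; last by move=> s t; rewrite !mulr_ge0// kern_ge0.
  apply: eq_integral => z _; rewrite -mulrA [RHS]EFinM kernSE [in RHS]muleC -itgZ.
  - by apply: eq_itg => t; ring.
  - by have := kern_col m z; mfun.
  - by move=> t; rewrite !mulr_ge0// kern_ge0.
  - by rewrite mulr_ge0// kern_ge0.
have mkm := mkern m.
by mfun.
Qed.

Lemma kern_CK_itg m n x (g : T -> R) : measurable_fun setT g -> (forall t, 0 <= g t) ->
  (itg nu (fun z => k (m + n).+1 x z * g z)%R =
   \int[nu]_t ((k m x t * chi t)%:E * itg nu (fun z => (k n t z * g z)%R)%R))%E.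
Proof.
move=> mg g0.
transitivity (\int[nu]_z itg nu (fun t => k m x t * chi t * k n t z * g z)%R)%E.
  apply: eq_integral => z _; rewrite EFinM kern_CK muleC -itgZ//.
  - by apply: eq_itg => t; ring.
  - by have := kern_col n z; have := kern_row m x; mfun.
  - by move=> t; rewrite !mulr_ge0// kern_ge0.
rewrite -[LHS](@itg_tonelli _ _ _ nu (fun t z => k m x t * chi t * k n t z * g z)).
- apply: eq_integral => t _; rewrite -itgZ//.
  + by apply: eq_itg => z; ring.
  + by have := kern_row n t; mfun.
  + by move=> z; rewrite mulr_ge0// kern_ge0.
  + by rewrite mulr_ge0// kern_ge0.
- have mkn := mkern n; have := kern_row m x.
  by mfun.
- by move=> s t; rewrite !mulr_ge0// kern_ge0.
Qed.

Lemma kern_mass_le n x : (itg nu (k n x) <= 1)%E.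
Proof.
elim: n x => [|n IH] x; first by rewrite ds_row.
have := @kern_CK_itg 0 n x (fun=> 1) (measurable_cst _) (fun=> ler01).
rewrite add0n; under eq_itg do rewrite mulr1. move=> ->.
rewrite -(ds_row P x); apply: ge0_le_integral => //.
- by move=> t _; rewrite mule_ge0// ?lee_fin ?mulr_ge0//; apply: itg_ge0 => z;
    rewrite mulr_ge0// kern_ge0.
- apply: emeasurable_funM.
    by apply/measurable_EFinP; have := measurable2_row x pm; rewrite /=; mfun.
  have mkn := mkern n.
  by apply: measurable_itg; [mfun | move=> s t; rewrite mulr_ge0// kern_ge0].
- by apply/measurable_EFinP; exact: measurable2_row.
move=> t _; under eq_itg do rewrite mulr1.
rewrite -[leRHS]mule1; apply: lee_pmul => //=.
- by rewrite lee_fin mulr_ge0.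
- by apply: itg_ge0 => z; exact: kern_ge0.
- by rewrite lee_fin ler_piMr.
Qed.

End Basics.
End Kernel.

(** * State spaces, correlation inequality and tilting *)

(** What the integers with the counting measure and the reals with the Lebesgue
    measure have in common. The error 1 in [window_le] is the one made when the
    integers of an interval are counted, and [emb_floor] makes rounding to a state
    cost at most 1. *)
Record state_space d (T : measurableType d) (R : realType)
    (nu : {sigma_finite_measure set T -> \bar R}) (e : T -> R)
    (add : T -> T -> T) (opp : T -> T) : Prop := StateSpace {
  emb_meas : measurable_fun setT e;
  emb_inj : injective e;
  embD : forall s t, e (add s t) = e s + e t;
  embN : forall s, e (opp s) = - e s;
  add_meas : forall h, measurable_fun setT (add^~ h);
  itg_shift : forall h (f : T -> R), measurable_fun setT f -> (forall t, 0 <= f t) ->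
    itg nu (fun t => f (add t h)) = itg nu f;
  itg_opp : forall f : T -> R, measurable_fun setT f -> (forall t, 0 <= f t) ->
    itg nu (fun t => f (opp t)) = itg nu f;
  window_ge : forall s L, 0 <= L -> (L%:E <= nu [set t | (e s <= e t <= e s + L)%R])%E;
  window_ge' : forall s L, 0 <= L -> (L%:E <= nu [set t | (e s - L <= e t <= e s)%R])%E;
  window_le : forall a L, 0 <= L -> (nu [set t | (a <= e t <= a + L)%R] <= (L + 1)%:E)%E;
  emb_floor : forall r, exists t, r - 1 <= e t <= r }.

Section Walk.
Context d (T : measurableType d) (R : realType).
Variable nu : {sigma_finite_measure set T -> \bar R}.
Variables (e : T -> R) (add : T -> T -> T) (opp : T -> T).
Hypothesis S : state_space nu e add opp.
Let em := emb_meas S.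
Lemma emb_mx s t : e (mx e s t) = Num.max (e s) (e t).
Proof. by rewrite /mx; have [] := leP (e s) (e t). Qed.

Lemma emb_mn s t : e (mn e s t) = Num.min (e s) (e t).
Proof. by rewrite /mn; have [] := leP (e s) (e t). Qed.

Local Notation mx := (mx e).
Local Notation mn := (mn e).

(** Total positivity of order 2, written with maxima and minima so that it has the
    shape of the hypothesis of [four_functions]. *)
Definition tp2 (p : T -> T -> R) := forall x x' y y',
  p x y * p x' y' <= p (mx x x') (mx y y') * p (mn x x') (mn y y').

Definition rev (p : T -> T -> R) x y := p y x.

Lemma ds_rev p : doubly_stochastic nu p -> doubly_stochastic nu (rev p).
Proof.
move=> P; split.
- by move=> x y; exact: (ds_ge0 P y x).
- exact: (measurable2_swap (ds_meas P)).
- by have [B hB] := ds_bound P; exists B => x y; exact: hB.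
- exact: ds_col P.
- exact: ds_row P.
Qed.

Lemma kern_rev p chi n x y : doubly_stochastic nu p -> killing chi ->
  kern nu (rev p) chi n y x = kern nu p chi n x y.
Proof.
move=> P K; have P' := ds_rev P; elim: n x y => // n IH x y.
apply: EFin_inj; rewrite (kernSE P K) -{1}[n]addn0 (kern_CK P' K).
by apply: eq_itg => t; rewrite IH /= /rev; ring.
Qed.

(** Holley's inequality between the killed and the free path measures, by induction
    on the number of steps: the integration over each intermediate point is an
    application of [four_functions]. *)
Lemma kern_holley p chi : doubly_stochastic nu p -> tp2 p -> killing chi ->
  (forall s t, e s <= e t -> chi s <= chi t) -> forall n x x' y y',
  kern nu p chi n x y * kern nu p (fun=> 1) n x' y' <=
  kern nu p chi n (mx x x') (mx y y') * kern nu p (fun=> 1) n (mn x x') (mn y y').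
Proof.
move=> P TP K Kinc; have K1 := no_killing T R; elim=> [|n IH] x x' y y'; first exact: TP.
rewrite -lee_fin !EFinM !kernSE//.
have q0 m s t : 0 <= kern nu p chi m s t by exact: kern_ge0.
have p0 m s t : 0 <= kern nu p (fun=> 1) m s t by exact: kern_ge0.
have c0 := kill_ge0 K; have pp := ds_ge0 P; have pm := ds_meas P.
have mq m t : measurable_fun setT (fun s => kern nu p chi m s t) by exact: kern_col.
have mp m t : measurable_fun setT (fun s => kern nu p (fun=> 1) m s t) by exact: kern_col.
have cm := kill_meas K.
apply: (@four_functions _ _ _ nu e) => [||||t|t|t|t|s t]; try (by rewrite !mulr_ge0).
- by have := mq n y; mfun.
- by have := mp n y'; mfun.
- by have := mq n (mx y y'); mfun.
- by have := mp n (mn y y'); mfun.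
rewrite !mulr1.
have -> : p x s * chi s * kern nu p chi n s y * (p x' t * kern nu p (fun=> 1) n t y') =
  chi s * ((p x s * p x' t) * (kern nu p chi n s y * kern nu p (fun=> 1) n t y')) by ring.
set a := kern nu p chi n (mx s t) _; set b := kern nu p (fun=> 1) n (mn s t) _.
have -> : p (mx x x') (mx s t) * chi (mx s t) * a * (p (mn x x') (mn s t) * b) =
  chi (mx s t) * ((p (mx x x') (mx s t) * p (mn x x') (mn s t)) * (a * b)) by ring.
apply: ler_pM => //; first by rewrite !mulr_ge0.
  by apply: Kinc; rewrite emb_mx le_max lexx.
by apply: ler_pM; rewrite ?mulr_ge0//; exact: IH.
Qed.

Lemma kern_shift p : doubly_stochastic nu p ->
  (forall h x y, p (add x h) (add y h) = p x y) -> forall n h x y,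
  kern nu p (fun=> 1) n (add x h) (add y h) = kern nu p (fun=> 1) n x y.
Proof.
move=> P sh; have K1 := no_killing T R; elim=> [|n IH] h x y; first exact: sh.
apply: EFin_inj; rewrite !kernSE// -(itg_shift S h).
- by apply: eq_itg => t; rewrite sh IH.
- by have := kern_col P K1 n (add y h); have := ds_meas P; mfun.
- by move=> t; rewrite !mulr_ge0//; [exact: ds_ge0 P _ _|exact: kern_ge0].
Qed.

(** The Esscher transform. The factors at the intermediate points cancel along a
    path, so that tilted and untilted bridges agree. *)
Definition tilt lam (M : R) (p : T -> T -> R) x y := p x y * (expR (lam * (e y - e x)) / M).

Lemma kern_tilt p chi lam M : doubly_stochastic nu p -> killing chi -> 0 < M ->
  doubly_stochastic nu (tilt lam M p) -> forall n x y,
  kern nu (tilt lam M p) chi n x y = kern nu p chi n x y * (expR (lam * (e y - e x)) / M ^+ n.+1).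
Proof.
move=> P K M0 P'; elim=> [|n IH] x y; first by rewrite expr1.
apply: EFin_inj; rewrite kernSE// mulrC EFinM kernSE// -itgZ.
- apply: eq_itg => t; rewrite IH /tilt.
  have -> : lam * (e y - e x) = lam * (e t - e x) + lam * (e y - e t) by ring.
  by rewrite expRD (exprS M n.+1) invfM; ring.
- by have := kern_col P K n y; have := ds_meas P; have := kill_meas K; mfun.
- by move=> t; rewrite !mulr_ge0//; [exact: ds_ge0 P _ _|exact: kill_ge0 K _|exact: kern_ge0].
- by rewrite divr_ge0 ?expR_ge0 ?exprn_ge0 ?ltW.
Qed.

Lemma kern_le_free p chi : doubly_stochastic nu p -> killing chi -> forall n x y,
  kern nu p chi n x y <= kern nu p (fun=> 1) n x y.
Proof.
move=> P K; have K1 := no_killing T R; elim=> // n IH x y.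
have p0 := ds_ge0 P; have pm := ds_meas P; have cm := kill_meas K; have c0 := kill_ge0 K.
have q0 m s t : 0 <= kern nu p chi m s t by exact: kern_ge0.
rewrite -lee_fin !kernSE//; apply: le_itg => [||t|t].
- by have := kern_col P K n y; mfun.
- by have := kern_col P K1 n y; mfun.
- by rewrite !mulr_ge0.
by rewrite !ler_pM ?mulr_ge0 ?ler_wpM2l// kill_le1.
Qed.

Lemma kern_mass p : doubly_stochastic nu p -> forall n x, itg nu (kern nu p (fun=> 1) n x) = 1%E.
Proof.
move=> P; have K1 := no_killing T R; elim=> [|n IH] x; first exact: ds_row.
have := @kern_CK_itg _ _ _ nu p _ P K1 0 n x (fun=> 1) (measurable_cst _) (fun=> ler01).
rewrite add0n; under eq_itg do rewrite mulr1. move=> ->.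
rewrite -[RHS](ds_row P x); apply: eq_integral => t _.
by under eq_itg do rewrite mulr1; rewrite IH mule1 mulr1.
Qed.

(** The mean of [u] under the density [f] is [m], stated with the positive and the
    negative part; it is read off from the second moments about the two points
    0 and -1, since (u + 1)^2 - u^2 = 2 u + 1. *)
Lemma pos_neg_part (f u : T -> R) m V :
  measurable_fun setT f -> (forall t, 0 <= f t) -> itg nu f = 1%E -> measurable_fun setT u ->
  (forall c, itg nu (fun t => f t * (u t - m + c) ^+ 2) = (V + c ^+ 2)%:E) ->
  exists r1 r2, [/\ itg nu (fun t => f t * Num.max (u t) 0) = r1%:E,
    itg nu (fun t => f t * Num.max (- u t) 0) = r2%:E & r1 = m + r2].
Proof.
move=> mf f0 f1 mu f2.
have mpos : measurable_fun setT (fun z => Num.max (u z) 0) by exact: measurable_maxr.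
have mneg : measurable_fun setT (fun z => Num.max (- u z) 0).
  by apply: measurable_maxr => //; exact: measurableT_comp.
have pos0 z : 0 <= Num.max (u z) 0 by rewrite le_max lexx orbT.
have neg0 z : 0 <= Num.max (- u z) 0 by rewrite le_max lexx orbT.
have maxE (r : R) : Num.max r 0 = r + Num.max (- r) 0.
  by have [h|h] := leP r 0; [rewrite max_l ?oppr_ge0//|rewrite max_r ?oppr_le0 1?ltW//]; lra.
have sqE c : itg nu (fun t => f t * (u t + c) ^+ 2) = (V + (m + c) ^+ 2)%:E.
  by rewrite -f2; apply: eq_itg => t; congr (_ * _ ^+ 2); ring.
have E : itg nu (fun z => f z * (u z + 1) ^+ 2 + (2 : R) * (f z * Num.max (- u z) 0)) =
  itg nu (fun z => (f z * (u z + 0) ^+ 2 + f z) + (2 : R) * (f z * Num.max (u z) 0)).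
  by apply: eq_itg => z; rewrite (maxE (u z)); ring.
move: E; rewrite !itgD//; try (by mfun); try (by nn).
rewrite !itgZ//; try (by mfun); try (by nn).
rewrite !sqE f1.
have fin (h : T -> R) : measurable_fun setT h -> (forall z, 0 <= h z) ->
    (forall z, h z <= 1 + (u z + 0) ^+ 2) -> exists r, itg nu (fun z => f z * h z) = r%:E.
  move=> mh h0 h1; exists (ritg nu (fun z => f z * h z)).
  apply: (itg_le_fin (c := 1 + (V + (m + 0) ^+ 2)) _ _).1; first by nn.
  rewrite EFinD -f1 -sqE -itgD//; try (by mfun); try (by nn).
  apply: le_itg => [||z|z]; [by mfun|by mfun|by nn|].
  by rewrite -[X in X + _]mulr1 -mulrDr ler_wpM2l.
have [r1 ->] : exists r, itg nu (fun z => f z * Num.max (u z) 0) = r%:E.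
  by apply: fin => // z; rewrite ge_max; apply/andP; split; nra.
have [r2 ->] : exists r, itg nu (fun z => f z * Num.max (- u z) 0) = r%:E.
  by apply: fin => // z; rewrite ge_max; apply/andP; split; nra.
rewrite -!EFinM -!EFinD => -[E]; exists r1, r2; split=> //.
by move: E; rewrite !expr2; lra.
Qed.

(** A translation invariant kernel with drift [b] and variance [v]. The two moments
    are encoded in the second moment about every point, which involves only
    nonnegative integrands and determines the mean as well. *)
Record walk (p : T -> T -> R) (b v : R) : Prop := Walk {
  walk_ds : doubly_stochastic nu p;
  walk_shift : forall h x y, p (add x h) (add y h) = p x y;
  walk_tp2 : tp2 p;
  walk_sq : forall x c, itg nu (fun y => p x y * (e y - e x - b + c) ^+ 2) = (v + c ^+ 2)%:E }.

Section Moments.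
Variables (p : T -> T -> R) (b v : R).
Hypotheses (W : walk p b v) (v0 : 0 <= v).
Let P := walk_ds W.
Let K1 := no_killing T R.
Local Notation k := (kern nu p (fun=> 1)).

Lemma walk_sqn n x c :
  itg nu (fun y => k n x y * (e y - e x - n.+1%:R * b + c) ^+ 2) = (n.+1%:R * v + c ^+ 2)%:E.
Proof.
have p0 := ds_ge0 P; have pm := ds_meas P.
elim: n x c => [|n IH] x c; first by rewrite !mul1r; exact: (walk_sq W).
rewrite -{1}[n]add0n (kern_CK_itg P K1 0 n x).
- transitivity (\int[nu]_t (p x t * ((n.+1%:R * v + 0 ^+ 2) + (e t - e x - b + c) ^+ 2))%:E)%E.
    apply: eq_integral => t _; rewrite /= mulr1 [RHS]EFinM; congr (_ * _)%E.
    rewrite expr0n addr0 -(IH t (e t - e x - b + c)); apply: eq_itg => z.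
    by rewrite -[n.+2]addn1 natrD; congr (_ * _ ^+ 2); ring.
  rewrite -/(itg nu _) (eq_itg _ (g := fun t => n.+1%:R * v * p x t + p x t * (e t - e x - b + c) ^+ 2)).
    rewrite itgD; first last.
    + by move=> t; rewrite mulr_ge0 ?sqr_ge0.
    + by move=> t; rewrite !mulr_ge0.
    + by mfun.
    + by mfun.
    rewrite itgZ ?mulr_ge0//; last by mfun.
    by rewrite (ds_row P) mule1 (walk_sq W)// -EFinD -[n.+2]addn1 natrD; congr EFin; ring.
  by move=> t; ring.
- by mfun.
- by move=> t; exact: sqr_ge0.
Qed.

Definition dev n x z := e z - e x - n.+1%:R * b.

Lemma measurable_dev n x : measurable_fun setT (dev n x).
Proof. by rewrite /dev; mfun. Qed.

Lemma itg_dev2 n x : itg nu (fun z => k n x z * dev n x z ^+ 2) = (n.+1%:R * v)%:E.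
Proof.
rewrite -[RHS](_ : (n.+1%:R * v + 0 ^+ 2)%:E = _); last by rewrite expr0n addr0.
by rewrite -(walk_sqn n x); apply: eq_itg => z; rewrite addr0.
Qed.

Lemma itg_dev_pos_neg n x :
  itg nu (fun z => k n x z * Num.max (dev n x z) 0) =
  itg nu (fun z => k n x z * Num.max (- dev n x z) 0).
Proof.
have [||||c|r1 [r2 [-> -> ->]]] := @pos_neg_part (k n x) (dev n x) 0 (n.+1%:R * v).
- exact: kern_row.
- by move=> z; exact: kern_ge0.
- exact: kern_mass.
- exact: measurable_dev.
- by rewrite -(walk_sqn n x c); apply: eq_itg => z; rewrite subr0.
by rewrite add0r.
Qed.
End Moments.
End Walk.

(** * Log-concave densities with given variance are bounded *)

Section Indicator.
Context d (T : measurableType d) (R : realType).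
Variable nu : {sigma_finite_measure set T -> \bar R}.

Definition ind (P : T -> bool) (t : T) : R := (P t)%:R.

Lemma ind_ge0 P t : 0 <= ind P t. Proof. exact: ler0n. Qed.
Lemma ind_le1 P t : ind P t <= 1. Proof. by rewrite /ind; case: (P t). Qed.

Lemma indE (P : T -> bool) : ind P = \1_[set t | P t].
Proof.
apply/funext => t; rewrite /ind indicE; congr (nat_of_bool _)%:R.
by apply/idP/idP; rewrite in_setE.
Qed.

Lemma measurable_set_ind (P : T -> bool) :
  measurable_fun setT P -> measurable [set t | P t].
Proof.
move=> mP; have := mP measurableT [set true] Logic.I.
by rewrite setTI; congr measurable; apply/seteqP; split=> t /=.
Qed.

Lemma measurable_ind (P : T -> bool) :
  measurable_fun setT P -> measurable_fun setT (ind P).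
Proof. by move=> mP; rewrite indE; apply: measurable_indic; exact: measurable_set_ind. Qed.

Lemma itg_ind P : measurable_fun setT P -> itg nu (ind P) = nu [set t | P t].
Proof.
move=> mP; rewrite indE /itg integral_indic ?setIT//; exact: measurable_set_ind.
Qed.
End Indicator.

Ltac mbool := repeat match goal with
  | |- measurable_fun _ (fun x => andb (@?a x) (@?b x)) => apply: measurable_and
  | |- measurable_fun _ (fun x => Order.le (@?a x) (@?b x)) => apply: measurable_fun_ler
  | |- measurable_fun _ (fun x => Order.lt (@?a x) (@?b x)) => apply: measurable_fun_ltr
  | |- measurable_fun _ (fun x => Num.norm (@?a x)) =>
      apply: measurableT_comp; [exact: normr_measurable|]
  | |- _ => progress mfun
  end.

Section Local.
Context d (T : measurableType d) (R : realType).
Variable nu : {sigma_finite_measure set T -> \bar R}.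
Variables (e : T -> R) (add : T -> T -> T) (opp : T -> T).
Hypothesis S : state_space nu e add opp.
Let em := emb_meas S.

Lemma mx_r s t : e s <= e t -> mx e s t = t.
Proof. by rewrite /mx => ->. Qed.
Lemma mx_l s t : e t <= e s -> mx e s t = s.
Proof. by rewrite /mx; move=> ts; have [st|] := leP (e s) (e t) => //; apply: (emb_inj S); lra. Qed.
Lemma mn_l s t : e s <= e t -> mn e s t = s.
Proof. by rewrite /mn => ->. Qed.
Lemma mn_r s t : e t <= e s -> mn e s t = t.
Proof. by rewrite /mn; move=> ts; have [st|] := leP (e s) (e t) => //; apply: (emb_inj S); lra. Qed.

(** The quotient f(s + h) / f(s) decreases with s for h >= 0. The condition is written
    without quotient and covers both signs of h. *)
Definition log_concave (f : T -> R) := forall s0 s h, 0 <= (e s - e s0) * e h ->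
  f (add s h) * f s0 <= f (add s0 h) * f s.

Section SupBound.
Variables (f : T -> R) (m V : R).
Hypotheses (mf : measurable_fun setT f) (f0 : forall t, 0 <= f t)
  (f1 : itg nu f = 1%E)
  (f2 : forall c, itg nu (fun s => f s * (e s - m + c) ^+ 2) = (V + c ^+ 2)%:E)
  (lc : log_concave f).

(** The density has mass 1, so it cannot exceed f(s0) / 2 on a whole window of
    length 4 / f(s0). *)
Lemma half_point s0 (sg : R) : sg = 1 \/ sg = -1 -> 0 < f s0 ->
  exists2 s1, 0 <= sg * (e s1 - e s0) <= 4 / f s0 & f s1 <= f s0 / 2.
Proof.
move=> sgE F0; set L := 4 / f s0; have L0 : 0 <= L by rewrite divr_ge0// ltW.
pose W t := (0 <= sg * (e t - e s0) <= L).
have mW : measurable_fun setT W by rewrite /W; mbool.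
have nuW : (L%:E <= nu [set t | W t])%E.
  rewrite /W; case: sgE => ->; [have := window_ge S s0 L0|have := window_ge' S s0 L0]; congr (_ <= nu _)%E;
    apply/seteqP; split=> t /=; lra.
apply: contrapT => H.
have fW t : f s0 / 2 * ind R W t <= f t.
  rewrite /ind; case Wt : (W t); rewrite ?mulr1 ?mulr0//.
  by rewrite leNgt; apply/negP => ft; apply: H; exists t => //; exact: ltW.
have : (itg nu (fun t => f s0 / 2 * ind R W t)%R <= itg nu f)%E.
  apply: le_itg => //; first by have := measurable_ind (R := R) mW; mfun.
  by move=> t; rewrite mulr_ge0 ?ind_ge0 ?divr_ge0.
rewrite itgZ; [|exact: measurable_ind|exact: ind_ge0|by rewrite divr_ge0].
rewrite itg_ind// f1; apply/negP; rewrite -ltNge.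
apply: (@lt_le_trans _ _ ((f s0 / 2)%:E * L%:E)%E).
  rewrite -EFinM lte_fin (_ : _ * _ = 2) ?ltr1n//.
  by rewrite /L; field; rewrite gt_eqF.
by apply: lee_wpmul2l; rewrite // lee_fin divr_ge0.
Qed.

(** Beyond the point s1 of [half_point], log-concavity makes the density decay
    geometrically: it loses a factor 2 over each step of length h = s1 - s0. The
    second moment I about s0 on one side then satisfies I <= L^2 + 3/4 I + 3/2 L^2. *)
Lemma one_side s0 (sg : R) : sg = 1 \/ sg = -1 -> 0 < f s0 ->
  (itg nu (fun s => ind R (fun s => 0 <= sg * (e s - e s0))%R s * (f s * (e s - e s0) ^+ 2))%R
   <= (10 * (4 / f s0) ^+ 2)%:E)%E.
Proof.
move=> sgE F0; have [s1 s1L fs1] := half_point sgE F0.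
set L := 4 / f s0 in s1L *; pose h := add s1 (opp s0).
have eh : e h = e s1 - e s0 by rewrite /h (embD S) (embN S).
have s0h : add s0 h = s1 by apply: (emb_inj S); rewrite (embD S) eh; ring.
pose A := fun s => 0 <= sg * (e s - e s0); pose u s := e s - e s0.
pose G s := ind R (fun s => 0 <= sg * (e s - e s1))%R s * (f s * u s ^+ 2).
have mA : measurable_fun setT (ind R A) by apply: measurable_ind; rewrite /A; mbool.
have mB : measurable_fun setT (ind R (fun s => 0 <= sg * (e s - e s1))).
  by apply: measurable_ind; mbool.
have mu : measurable_fun setT u by rewrite /u; mfun.
have i0 P t : 0 <= @ind _ _ R P t by exact: ind_ge0.
pose F s := ind R A s * (f s * u s ^+ 2).
have mF : measurable_fun setT F by rewrite /F; mfun.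
have F00 t : 0 <= F t by rewrite /F; nn.
have mG : measurable_fun setT G by rewrite /G; mfun.
have G0 t : 0 <= G t by rewrite /G; nn.
have L0 : 0 <= L by rewrite divr_ge0// ltW.
have sg2 : sg * sg = 1 by case: sgE => ->; lra.
have J1 : (itg nu F <= (L ^+ 2)%:E + itg nu G)%E.
  rewrite -[X in (X + _)%E]mule1 -f1 -itgZ ?sqr_ge0// -itgD//; try (by mfun); try (by nn).
  apply: le_itg => //; first by mfun.
  move=> t; rewrite /F /G /ind /A -/(u t).
  case: (leP 0 (sg * u t)) => [ut|_]; last by rewrite mul0r; nn; exact: ler0n.
  case: (leP 0 (sg * (e t - e s1))) => [_|ut1]; first by rewrite !mul1r lerDr; nn.
  rewrite mul1r mul0r addr0 mulrC ler_wpM2r//.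
  have : sg * u t <= L by move: ut1; rewrite /u; lra.
  have -> : u t ^+ 2 = (sg * u t) ^+ 2 by rewrite exprMn [sg ^+ 2]sg2 mul1r.
  by move=> uL; rewrite ler_pXn2r// ?nnegrE.
(* (w + q)^2 <= 3/2 w^2 + 3 q^2 with |q| <= L; the decay brings a factor 1/2. *)
have J2 : (itg nu G <= (3 / 4)%:E * itg nu F + (3 / 2 * L ^+ 2)%:E)%E.
  rewrite -(itg_shift S h)// -[X in (_ + X)%E]mule1 -f1 -!itgZ//; try (by nn).
  rewrite -itgD//; try (by mfun); try (by nn).
  apply: le_itg => //.
  - by apply: (measurableT_comp mG); exact: (add_meas S).
  - by mfun.
  move=> t; rewrite /G /F /ind /A /u (embD S) eh.
  have -> : e t + (e s1 - e s0) - e s1 = e t - e s0 by ring.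
  have L20 : 0 <= 3 / 2 * L ^+ 2 * f t by nn.
  case: (leP 0 (sg * (e t - e s0))) => [ut|_]; last by rewrite !mul0r mulr0 add0r.
  rewrite !mul1r.
  have fth : f (add t h) <= f t / 2.
    have := @lc s0 t h; rewrite s0h eh => /(_ _).
    have -> : (e t - e s0) * (e s1 - e s0) = (sg * (e t - e s0)) * (sg * (e s1 - e s0)).
      by rewrite mulrACA sg2 mul1r.
    case/andP: s1L => s10 _; rewrite mulr_ge0// => /(_ isT) H.
    have : f (add t h) * f s0 <= (f t / 2) * f s0.
      by rewrite (le_trans H)// mulrAC mulrC -mulrA ler_wpM2l// .
    by rewrite ler_pM2r.
  have eh2 : (e s1 - e s0) ^+ 2 <= L ^+ 2.
    have -> : (e s1 - e s0) ^+ 2 = (sg * (e s1 - e s0)) ^+ 2 by rewrite exprMn [sg ^+ 2]sg2 mul1r.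
    by case/andP: s1L => a0 aL; rewrite ler_pXn2r// ?nnegrE.
  set w := e t - e s0 in ut *; set q := e s1 - e s0 in eh2 *.
  have -> : e t + q - e s0 = w + q by rewrite /w; ring.
  have sq : (w + q) ^+ 2 <= 3 / 2 * w ^+ 2 + 3 * L ^+ 2.
    have := sqr_ge0 (w - 2 * q); have : (w - 2 * q) ^+ 2 = w ^+ 2 - 4 * w * q + 4 * q ^+ 2 by ring.
    have : (w + q) ^+ 2 = w ^+ 2 + 2 * w * q + q ^+ 2 by ring.
    lra.
  apply: (@le_trans _ _ ((f t / 2) * (3 / 2 * w ^+ 2 + 3 * L ^+ 2))).
    by apply: ler_pM => //; exact: sqr_ge0.
  by rewrite le_eqVlt; apply/orP; left; apply/eqP; field.
have [FE _] : itg nu F = (ritg nu F)%:E /\ ritg nu F <= V + (m - e s0) ^+ 2.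
  apply: itg_le_fin => //; rewrite -f2; apply: le_itg => //; first by mfun.
  move=> t; rewrite /F /u.
  have -> : e t - m + (m - e s0) = e t - e s0 by ring.
  by rewrite ler_piMl ?ind_le1//; nn.
have [GE _] : itg nu G = (ritg nu G)%:E /\ ritg nu G <= 3 / 4 * ritg nu F + 3 / 2 * L ^+ 2.
  by apply: itg_le_fin => //; rewrite (le_trans J2)// FE -EFinM -EFinD.
change (itg nu F <= (10 * L ^+ 2)%:E)%E.
by move: J1 J2; rewrite FE GE -EFinM -!EFinD !lee_fin; lra.
Qed.

(** A large value of the density forces it to decay fast on both sides, hence a
    small variance; 320 = 2 * 10 * 4^2 collects the constants of [one_side]. *)
Lemma sup_bound s0 : f s0 ^+ 2 * V <= 320.
Proof.
have [F0|F0] := leP (f s0) 0.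
  have -> : f s0 = 0 by apply/eqP; rewrite eq_le F0 f0.
  by rewrite expr0n mul0r ler0n.
pose A sg s := ind R (fun s => 0 <= sg * (e s - e s0)) s * (f s * (e s - e s0) ^+ 2).
have i0 P t : 0 <= @ind _ _ R P t by exact: ind_ge0.
have mA sg : measurable_fun setT (A sg).
  have : measurable_fun setT (ind R (fun s => 0 <= sg * (e s - e s0))).
    by apply: measurable_ind; mbool.
  by rewrite /A; mfun.
have A0 sg t : 0 <= A sg t by rewrite /A; nn.
have : ((V + (m - e s0) ^+ 2)%:E <= itg nu (A 1%R) + itg nu (A (-1)%R))%E.
  rewrite -f2 -itgD//; apply: le_itg => [| |t|t]; [by mfun|by mfun|by nn|].
  rewrite /A /ind; have -> : e t - m + (m - e s0) = e t - e s0 by ring.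
  rewrite !mul1r mulN1r oppr_ge0 -mulrDl ler_peMl//; first by nn.
  by have [_|/ltW ->] := leP 0 (e t - e s0); rewrite ?lerDl ?add0r ?ler0n.
have H1 := @one_side s0 1 (or_introl erefl) F0.
have H2 := @one_side s0 (-1) (or_intror erefl) F0.
move/le_trans => /(_ _ (leeD H1 H2)); rewrite -EFinD lee_fin => H.
have : V <= 320 / f s0 ^+ 2.
  have := sqr_ge0 (m - e s0).
  have -> : 320 / f s0 ^+ 2 = 10 * (4 / f s0) ^+ 2 + 10 * (4 / f s0) ^+ 2 by field; rewrite gt_eqF.
  by lra.
by rewrite ler_pdivlMr ?exprn_gt0// mulrC.
Qed.
End SupBound.
End Local.

(** * Local bounds on the kernel of a walk *)

Section LocalWalk.
Context d (T : measurableType d) (R : realType).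
Variable nu : {sigma_finite_measure set T -> \bar R}.
Variables (e : T -> R) (add : T -> T -> T) (opp : T -> T).
Hypothesis S : state_space nu e add opp.
Let em := emb_meas S.
Let K1 := no_killing T R.
Local Notation walk := (walk nu e add).
Local Notation k p := (kern nu p (fun=> 1)).

(** The number of steps is n + 1 at index n. *)
Definition sq (n : nat) : R := Num.sqrt n.+1%:R.
Lemma sq_gt0 n : 0 < sq n. Proof. by rewrite /sq sqrtr_gt0 ltr0Sn. Qed.
Lemma sq_ge0 n : 0 <= sq n. Proof. exact: ltW (sq_gt0 n). Qed.
Lemma sqr_sq n : sq n ^+ 2 = n.+1%:R. Proof. by rewrite /sq sqr_sqrtr. Qed.
Lemma sq_ge1 n : 1 <= sq n.
Proof. by rewrite -ler_sqr ?nnegrE ?ler01 ?sq_ge0// sqr_sq expr1n ler1n. Qed.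

Lemma sq_large (A : R) : exists N, forall n, (N <= n)%N -> A <= sq n.
Proof.
exists (Num.truncn (A ^+ 2)) => n Nn.
have [A0|A0] := leP A 0; first by rewrite (le_trans A0)// ltW ?sq_gt0.
rewrite -ler_sqr ?nnegrE ?sq_ge0 ?(ltW A0)// sqr_sq.
rewrite ltW// (lt_le_trans (truncnS_gt _))// ler_nat ltnS//.
Qed.

(** Total positivity at (x, x + h) and (s + h, s0 + h) is log-concavity of K(x, .),
    since K(x + h, s + h) = K(x, s). *)
Lemma tp2_log_concave (K : T -> T -> R) x : tp2 e K ->
  (forall h x y, K (add x h) (add y h) = K x y) -> log_concave e add (K x).
Proof.
move=> TP sh s0 s h; have eD := embD S.
rewrite -(sh h x s0) -[K x s](sh h x s) => hs.
have [[h0 ss]|[h0 ss]] : (0 <= e h /\ e s0 <= e s) \/ (e h <= 0 /\ e s <= e s0).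
- have [h0|h0] := leP 0 (e h); have [h1|h1] := leP (e s0) (e s); try by [left|right].
  + by right; split; [nra|exact: ltW].
  + by right; split; [exact: ltW|nra].
  + by right; split; exact: ltW.
- have := TP x (add x h) (add s h) (add s0 h).
  rewrite (mx_r (e := e)) ?eD; last by lra.
  rewrite (mx_l S) ?eD; last by lra.
  rewrite (mn_l (e := e)) ?eD; last by lra.
  by rewrite (mn_r S) ?eD 1?mulrC//; lra.
- have := TP x (add x h) (add s h) (add s0 h).
  rewrite (mx_l S) ?eD; last by lra.
  rewrite (mx_r (e := e)) ?eD; last by lra.
  rewrite (mn_r S) ?eD; last by lra.
  by rewrite (mn_l (e := e)) ?eD//; lra.
Qed.

Lemma walk_log_concave p b v n x : walk p b v -> log_concave e add (k p n x).
Proof.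
move=> W; have P := walk_ds W; apply: (tp2_log_concave (K := k p n)).
  exact: (kern_holley P (walk_tp2 W) K1 (fun _ _ _ => lexx _) n).
by move=> h; exact: (kern_shift S P (walk_shift W) n h).
Qed.

Lemma walk_sup p b v n x y : walk p b v -> 0 <= v -> k p n x y ^+ 2 * (n.+1%:R * v) <= 320.
Proof.
move=> W v0; have P := walk_ds W.
apply: (sup_bound S (m := e x + n.+1%:R * b) (f := k p n x)).
- exact: kern_row.
- by move=> t; exact: kern_ge0.
- exact: kern_mass.
- move=> c; rewrite -(walk_sqn S W v0 n x); apply: eq_itg => z.
  by congr (_ * (_ + _) ^+ 2); ring.
- exact: walk_log_concave W.
Qed.

Section Uniform.
Variables v0 v1 : R.
Hypotheses (v0_gt0 : 0 < v0).

(** 18^2 >= 320, the constant of [sup_bound]. *)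
Definition supc := 18 / Num.sqrt v0.
Lemma supc_gt0 : 0 < supc.
Proof. by rewrite /supc divr_gt0// sqrtr_gt0. Qed.

Lemma kern_sup p b v n x y : walk p b v -> v0 <= v -> k p n x y <= supc / sq n.
Proof.
move=> W v0v; have s0 := sq_gt0 n; have r0 : 0 < Num.sqrt v0 by rewrite sqrtr_gt0.
have vv : 0 <= v := le_trans (ltW v0_gt0) v0v.
have k0 : 0 <= k p n x y by apply: kern_ge0 => //; exact: walk_ds W.
rewrite /supc -mulrA -invfM ler_pdivlMr ?mulr_gt0//.
rewrite -ler_sqr ?nnegrE ?mulr_ge0 ?sq_ge0 ?sqrtr_ge0// !exprMn sqr_sq sqr_sqrtr ?(ltW v0_gt0)//.
have H := walk_sup n x y W vv.
have : k p n x y ^+ 2 * (v0 * n.+1%:R) <= k p n x y ^+ 2 * (n.+1%:R * v).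
  by rewrite ler_wpM2l ?sqr_ge0// mulrC ler_wpM2l.
by move=> H'; rewrite (le_trans H')// (le_trans H)//; lra.
Qed.

(** The kernel is at most [supc] / sqrt n, so at most half of the mass is within
    L = sqrt n / (8 supc) of the mean; the rest is at distance more than L, and the
    positive and negative parts of the deviation have equal means. *)
Lemma spread : exists kap : R, exists N, 0 < kap /\
  forall p b v n x, walk p b v -> v0 <= v -> (N <= n)%N ->
  ((kap * sq n)%:E <= itg nu (fun z => k p n x z * Num.max (dev e b n x z) 0)%R)%E.
Proof.
have F0 := supc_gt0.
have [N hN] := sq_large (4 * supc).
exists (32 * supc)^-1, N; split=> [|p b v n x W v0v Nn].
  by pos.
have P := walk_ds W; have vv : 0 <= v := le_trans (ltW v0_gt0) v0v.
have s0 := sq_gt0 n; have sN := hN n Nn.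
pose L := sq n / (8 * supc); have L0 : 0 < L by rewrite /L; pos.
pose D := dev e b n x.
have mD : measurable_fun setT D by exact: (measurable_dev S).
pose A z := - L <= D z <= L.
have mA : measurable_fun setT A by rewrite /A; mbool.
have mi := measurable_ind (R := R) mA.
have mk : measurable_fun setT (k p n x) by exact: kern_row.
have k0 z : 0 <= k p n x z by exact: kern_ge0.
have mpos : measurable_fun setT (fun z => Num.max (D z) 0) by exact: measurable_maxr.
have mneg : measurable_fun setT (fun z => Num.max (- D z) 0).
  by apply: measurable_maxr => //; exact: measurableT_comp.
have pos0 z : 0 <= Num.max (D z) 0 by rewrite le_max lexx orbT.
have neg0 z : 0 <= Num.max (- D z) 0 by rewrite le_max lexx orbT.
have m1 : measurable_fun setT (fun z => k p n x z * Num.max (D z) 0) by mfun.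
have m2 : measurable_fun setT (fun z => k p n x z * Num.max (- D z) 0) by mfun.
set E := itg nu _.
have nuA : (nu [set z | A z] <= (2 * L + 1)%:E)%E.
  have L2 : 0 <= 2 * L by lra.
  apply: le_trans (window_le S (e x + n.+1%:R * b - L) L2).
  apply: (eq_ind _ (fun X => (nu X <= _)%E) (lexx _)).
  by apply/seteqP; split=> z; rewrite /= /A /D /dev; lra.
have i1 : (itg nu (fun z => k p n x z * ind R A z)%R <= (supc / sq n * (2 * L + 1))%:E)%E.
  apply: (@le_trans _ _ (itg nu (fun z => supc / sq n * ind R A z))).
    apply: le_itg => [||z|z]; [by mfun|by mfun|by nn|].
    by rewrite ler_wpM2r ?ind_ge0// (kern_sup _ _ _ W).
  rewrite itgZ//; try exact: ind_ge0; try by nn.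
  rewrite itg_ind// (EFinM (supc / sq n)); apply: lee_wpmul2l => //.
  by rewrite lee_fin; nn.
have half : supc / sq n * (2 * L + 1) <= 1 / 2.
  have -> : supc / sq n * (2 * L + 1) = 1 / 4 + supc / sq n.
    by rewrite /L; field; rewrite !gt_eqF; pos.
  suff : supc / sq n <= 1 / 4 by lra.
  by rewrite ler_pdivrMr//; lra.
have : (L%:E <= E + E + (L / 2)%:E)%E.
  apply: (@le_trans _ _ (itg nu (fun z => k p n x z * Num.max (D z) 0 + k p n x z * Num.max (- D z) 0)%R
    + L%:E * itg nu (fun z => k p n x z * ind R A z)%R)%E); last first.
    rewrite itgD//; [|by nn|by nn]; rewrite -(itg_dev_pos_neg S W vv) leeD//.
    rewrite [X in (_ <= X%:E)%E](_ : _ = L * (1 / 2)); last by field.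
    rewrite (EFinM L); apply: lee_wpmul2l; first by rewrite lee_fin ltW.
    by rewrite (le_trans i1)// lee_fin.
  rewrite -itgZ; [|by mfun|by nn|exact: ltW].
  rewrite -[X in (X <= _)%E]mule1 -(kern_mass P n x) -itgZ//; last exact: ltW.
  rewrite -itgD//; try (by mfun); try (by nn).
  apply: le_itg => [||z|z]; [by mfun|by mfun|by nn|].
  rewrite -mulrDr [L * (_ * _)]mulrCA -mulrDr mulrC ler_wpM2l//.
  rewrite /ind; case Az : (A z); first by rewrite mulr1 lerDr addr_ge0.
  rewrite mulr0 addr0; move/negbT: Az; rewrite /A negb_and -!ltNge.
  case/orP => h.
    by rewrite [X in X + _]max_r ?[X in _ + X]max_l; lra.
  by rewrite [X in X + _]max_l ?[X in _ + X]max_r; lra.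
have : E = +oo%E \/ exists r, E = r%:E.
  have : (0 <= E)%E by apply: itg_ge0; nn.
  by case: (E) => [r _|_|//]; [right; exists r|left].
case=> [->|[r ->]]; first by move=> _; rewrite leey.
rewrite -!EFinD !lee_fin => h.
have -> : (32 * supc)^-1 * sq n = L / 4 by rewrite /L; field; rewrite gt_eqF.
lra.
Qed.

Hypothesis v1_ge : v0 <= v1.

(** On each side of the mean, some point at distance at least a sqrt n has
    density at least c1 / sqrt n: otherwise the mean of the one-sided deviation
    would be less than [spread] allows. Log-concavity extends the bound to the
    interval between the two points, at the price of one factor [supc] / sqrt n. *)
Lemma center_bound : exists a c : R, exists N, [/\ 0 < a, 0 < c &
  forall p b v n x z, walk p b v -> v0 <= v <= v1 -> (N <= n)%N ->
  `|dev e b n x z| <= a * sq n -> c / sq n <= k p n x z].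
Proof.
have F0 := supc_gt0.
have [kap [N [kap0 sp]]] := spread.
pose a := kap / 4; pose A := 4 * v1 / kap.
have v1_0 : 0 < v1 := lt_le_trans v0_gt0 v1_ge.
have a0 : 0 < a by rewrite /a; pos.
have A0 : 0 < A by rewrite /A; pos.
pose c1 := kap / (4 * A * (A + 1)).
have A10 : 0 < A + 1 by lra.
have c10 : 0 < c1 by rewrite /c1; pos.
exists a, (c1 ^+ 2 / supc), N; split=> //.
  by pos.
move=> p b v n x z W /andP[v0v vv1] Nn Dz.
have P := walk_ds W; have vv : 0 <= v := le_trans (ltW v0_gt0) v0v.
have s0 := sq_gt0 n; have s1 := sq_ge1 n.
have k0 t : 0 <= k p n x t by exact: kern_ge0.
have mk : measurable_fun setT (k p n x) by exact: kern_row.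
pose D := dev e b n x.
have mD : measurable_fun setT D by exact: (measurable_dev S).
have key (sg : R) : sg = 1 \/ sg = -1 ->
    exists2 t, a * sq n <= sg * D t & c1 / sq n <= k p n x t.
  move=> sgE; apply: contrapT => H.
  pose B t := a * sq n <= sg * D t <= A * sq n.
  have mB : measurable_fun setT B by rewrite /B; mbool.
  have mi := measurable_ind (R := R) mB.
  have msD : measurable_fun setT (fun t => Num.max (sg * D t) 0).
    by apply: measurable_maxr => //; mfun.
  have small t : k p n x t * ind R B t <= c1 / sq n * ind R B t.
    rewrite /ind; case Bt : (B t); rewrite ?mulr0// !mulr1 leNgt; apply/negP => kt.
    by apply: H; exists t; [case/andP: Bt|exact: ltW].
  have nuB : (nu [set t | B t] <= (A * sq n + 1)%:E)%E.
    have AL : 0 <= A * sq n by nn.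
    case: sgE => sgE.
      apply: le_trans (window_le S (e x + n.+1%:R * b) AL).
      apply: le_measure; rewrite ?inE; [exact: measurable_set_ind| |].
        by apply: measurable_set_ind; mbool.
      move=> t; rewrite /= /B /D sgE /dev => h.
      have := mulr_ge0 (ltW a0) (ltW s0); lra.
    apply: le_trans (window_le S (e x + n.+1%:R * b - A * sq n) AL).
    apply: le_measure; rewrite ?inE; [exact: measurable_set_ind| |].
      by apply: measurable_set_ind; mbool.
    move=> t; rewrite /= /B /D sgE /dev => h.
    have := mulr_ge0 (ltW a0) (ltW s0); lra.
  have iB : (itg nu (fun t => k p n x t * ind R B t)%R <= (kap / (4 * A))%:E)%E.
    apply: (@le_trans _ _ (itg nu (fun t => c1 / sq n * ind R B t))).
      by apply: le_itg => [||t|//]; [by mfun|by mfun|by nn].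
    rewrite itgZ//; try exact: ind_ge0; try by nn.
    rewrite itg_ind//.
    apply: (@le_trans _ _ ((c1 / sq n)%:E * (A * sq n + 1)%:E)%E).
      by apply: lee_wpmul2l => //; rewrite lee_fin; nn.
    rewrite -EFinM lee_fin.
    have -> : kap / (4 * A) = c1 / sq n * ((A + 1) * sq n).
      by rewrite /c1; field; rewrite !gt_eqF.
    apply: ler_wpM2l; first by nn.
    by rewrite mulrDl mul1r lerD2l.
  have lo : ((kap * sq n)%:E <= itg nu (fun t => k p n x t * Num.max (sg * D t) 0)%R)%E.
    case: sgE => ->.
      have := sp p b v n x W v0v Nn; congr (_ <= _)%E.
      by apply: eq_itg => t; rewrite mul1r.
    have := sp p b v n x W v0v Nn; rewrite (itg_dev_pos_neg S W vv) //; congr (_ <= _)%E.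
    by apply: eq_itg => t; rewrite mulN1r.
  have up : (itg nu (fun t => k p n x t * Num.max (sg * D t) 0)%R <=
      (a * sq n + A * sq n * (kap / (4 * A)) + (A * sq n)^-1 * (n.+1%:R * v))%:E)%E.
    have As0 : 0 < A * sq n by rewrite mulr_gt0.
    have E1 : (a * sq n)%:E = itg nu (fun t => a * sq n * k p n x t).
      by rewrite itgZ// ?kern_mass ?mule1//; nn.
    have E3 : ((A * sq n)^-1 * (n.+1%:R * v))%:E =
        itg nu (fun t => (A * sq n)^-1 * (k p n x t * D t ^+ 2)).
      rewrite itgZ; try (by mfun); try (by nn).
      by rewrite (itg_dev2 S W vv) EFinM.
    rewrite 2!EFinD E1 E3.
    apply: (@le_trans _ _ (itg nu (fun t => a * sq n * k p n x t)%R +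
      (A * sq n)%:E * itg nu (fun t => k p n x t * ind R B t)%R +
      itg nu (fun t => (A * sq n)^-1 * (k p n x t * D t ^+ 2))%R)%E); last first.
      rewrite leeD// leeD// (EFinM (A * sq n)); apply: lee_wpmul2l => //.
      by rewrite lee_fin ltW.
    have B0 t : 0 <= ind R B t by exact: ind_ge0.
    have asn : 0 <= a * sq n by nn.
    have Asn : 0 <= A * sq n by rewrite ltW.
    have Asi : 0 <= (A * sq n)^-1 by rewrite invr_ge0.
    have ms0 t : 0 <= Num.max (sg * D t) 0 by rewrite le_max lexx orbT.
    rewrite -itgZ//; try (by mfun); try (by nn).
    rewrite -itgD//; try (by mfun); try (by nn).
    rewrite -itgD//; try (by mfun); try (by nn).
    apply: le_itg => [||t|t]; [by mfun|by mfun|by nn|].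
    have -> : a * sq n * k p n x t + A * sq n * (k p n x t * ind R B t) +
      (A * sq n)^-1 * (k p n x t * D t ^+ 2) =
      k p n x t * (a * sq n + A * sq n * ind R B t + (A * sq n)^-1 * D t ^+ 2) by ring.
    rewrite ler_wpM2l//.
    have X0 : 0 <= (A * sq n)^-1 * D t ^+ 2 by nn.
    have Y0 : 0 <= A * sq n * ind R B t by nn.
    rewrite ge_max; apply/andP; split; last by lra.
    have [h1|h1] := leP (sg * D t) (a * sq n); first by lra.
    have [h2|h2] := leP (sg * D t) (A * sq n).
      by rewrite /ind /B (ltW h1) h2 mulr1; lra.
    have DD : D t ^+ 2 = (sg * D t) ^+ 2.
      by rewrite exprMn; case: sgE => ->; rewrite ?sqrrN expr1n mul1r.
    suff : sg * D t <= (A * sq n)^-1 * D t ^+ 2 by lra.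
    rewrite [leRHS]mulrC ler_pdivlMr// DD expr2 ler_wpM2l// ltW//; lra.
  have := le_trans lo up; rewrite lee_fin.
  have -> : A * sq n * (kap / (4 * A)) = kap / 4 * sq n by field; rewrite gt_eqF.
  have -> : (A * sq n)^-1 * (n.+1%:R * v) = v / v1 * (kap / 4 * sq n).
    by rewrite -sqr_sq /A; field; rewrite !gt_eqF.
  have vle1 : v / v1 <= 1 by rewrite ler_pdivrMr// mul1r.
  have ks : 0 < kap * sq n by rewrite mulr_gt0.
  have : v / v1 * (kap / 4 * sq n) <= kap / 4 * sq n.
    by apply: ler_piMl => //; nn.
  rewrite /a; lra.
have [tp tpD tpk] := key 1 (or_introl erefl).
have [tm tmD tmk] := key (-1) (or_intror erefl).
rewrite mul1r in tpD; rewrite mulN1r in tmD.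
have [Dz1 Dz2] : - (a * sq n) <= D z /\ D z <= a * sq n by move: Dz; rewrite ler_norml => /andP.
pose h := add z (opp tm); pose z' := add tp (opp h).
have eh : e h = e z - e tm by rewrite /h (embD S) (embN S).
have tmh : add tm h = z by apply: (emb_inj S); rewrite (embD S) eh; ring.
have ez' : e z' = e tp - e h by rewrite /z' (embD S) (embN S).
have z'h : add z' h = tp by apply: (emb_inj S); rewrite (embD S) ez'; ring.
have := walk_log_concave n x W (s0 := tm) (s := z') (h := h).
rewrite z'h tmh => /(_ _) H.
have {}H : k p n x tp * k p n x tm <= k p n x z * k p n x z'.
  apply: H; rewrite ez' eh; apply: mulr_ge0; move: tpD tmD Dz1 Dz2; rewrite /D /dev; lra.
have z'F := kern_sup n x z' W v0v.
have c1s : 0 < c1 / sq n by pos.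
have : (c1 / sq n) ^+ 2 <= k p n x z * (supc / sq n).
  rewrite (le_trans _ (ler_wpM2l (k0 z) z'F))// (le_trans _ H)// expr2.
  by rewrite ler_pM// ltW.
have Fs : 0 < supc / sq n := divr_gt0 F0 s0.
rewrite -(ler_pdivrMr _ _ Fs) => Hk; apply: le_trans Hk.
rewrite le_eqVlt; apply/orP; left; apply/eqP; rewrite /supc; field.
have r0 : 0 < Num.sqrt v0 by rewrite sqrtr_gt0.
by rewrite !gt_eqF.
Qed.
End Uniform.
End LocalWalk.

(** * Probability of staying nonnegative *)

Section Free.
Context d (T : measurableType d) (R : realType).
Variable nu : {sigma_finite_measure set T -> \bar R}.
Variables (e : T -> R) (add : T -> T -> T) (opp : T -> T).
Hypothesis S : state_space nu e add opp.
Let em := emb_meas S.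
Let K1 := no_killing T R.
Local Notation walk := (walk nu e add).
Local Notation k p := (kern nu p (fun=> 1)).
Local Notation sq := (sq R).

Definition chi := ind R (fun t => 0 <= e t).
Local Notation q p := (kern nu p chi).

Lemma measurable_chi : measurable_fun setT chi.
Proof. by apply: measurable_ind; mbool. Qed.
Lemma chi_ge0 t : 0 <= chi t. Proof. exact: ind_ge0. Qed.
Lemma chi_killing : killing chi.
Proof. by split; [exact: measurable_chi|exact: chi_ge0|exact: ind_le1]. Qed.
Lemma chi_mono s t : e s <= e t -> chi s <= chi t.
Proof.
move=> st; rewrite /chi /ind; have [s0|s0] := leP 0 (e s); last exact: ler0n.
by rewrite (le_trans s0 st).
Qed.
Lemma chi1 t : 0 <= e t -> chi t = 1. Proof. by rewrite /chi /ind => ->. Qed.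
Lemma chi0 t : e t < 0 -> chi t = 0. Proof. by rewrite /chi /ind leNgt => ->. Qed.
Lemma chi_pos t : chi t * e t = Num.max (e t) 0.
Proof.
by rewrite /chi /ind; have [h|h] := leP 0 (e t); rewrite ?mul1r ?mul0r.
Qed.
Let mc := measurable_chi.
Let Kc := chi_killing.

(** The indicator at the end point is included: n + 1 steps, all nonnegative. *)
Definition stay p n x := ritg nu (fun z => q p n x z * chi z).

Lemma stayE p n x : doubly_stochastic nu p ->
  itg nu (fun z => q p n x z * chi z) = (stay p n x)%:E.
Proof.
move=> P; apply: (itg_le_fin (c := 1) _ _).1.
  by move=> t; rewrite mulr_ge0 ?chi_ge0 ?(kern_ge0 P Kc).
apply: le_trans (kern_mass_le P Kc n x); have mk := kern_row P Kc n x.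
have k0 := kern_ge0 P Kc n x.
apply: le_itg => [||t|t]; [by mfun|by mfun|by rewrite mulr_ge0 ?chi_ge0|].
by rewrite ler_piMr// ind_le1.
Qed.

Lemma stay_ge0 p n x : doubly_stochastic nu p -> 0 <= stay p n x.
Proof.
by move=> P; apply: ritg_ge0 => t; rewrite mulr_ge0 ?chi_ge0 ?(kern_ge0 P Kc).
Qed.

Lemma stay_le1 p n x : doubly_stochastic nu p -> stay p n x <= 1.
Proof.
move=> P; rewrite -lee_fin -stayE//.
apply: le_trans (kern_mass_le P Kc n x); have mk := kern_row P Kc n x.
have k0 := kern_ge0 P Kc n x.
apply: le_itg => [||t|t]; [by mfun|by mfun|by rewrite mulr_ge0 ?chi_ge0|].
by rewrite ler_piMr// ind_le1.
Qed.

(** A jump below 0 from a nonnegative state lands at mean depth at most [C0]. *)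
Definition overshoot (C0 : R) (p : T -> T -> R) := forall x, 0 <= e x ->
  (itg nu (fun w => p x w * Num.max (- e w) 0)%R <=
   C0%:E * itg nu (fun w => p x w * (1 - chi w)%R)%R)%E.

(** The process X + C0, killed when X becomes negative, gains at most the drift: the
    negative values that are discarded are compensated by the constant [C0]. *)
Lemma one_step p b v C0 x : walk p b v -> 0 <= v -> 0 <= C0 -> overshoot C0 p -> 0 <= e x ->
  (itg nu (fun w => p x w * (chi w * (e w + C0)))%R <= (e x + b + C0)%:E)%E.
Proof.
move=> W v0 C00 O x0; have P := walk_ds W; have p0 := ds_ge0 P; have pm := ds_meas P.
have [||||c|r1 [r2 [E1 E2 E3]]] := @pos_neg_part _ _ _ nu (p x) e (e x + b) v.
- by mfun.
- by move=> t; exact: p0.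
- exact: ds_row.
- exact: em.
- by rewrite -(walk_sq W x c); apply: eq_itg => t; congr (_ * _ ^+ 2); ring.
have C1 : 0 <= 1 - chi x by rewrite subr_ge0 ind_le1.
have c1' t : 0 <= 1 - chi t by rewrite subr_ge0 ind_le1.
have c0 := chi_ge0.
have mpos : measurable_fun setT (fun z => Num.max (e z) 0) by exact: measurable_maxr.
have pos0 z : 0 <= Num.max (e z) 0 by rewrite le_max lexx orbT.
have [a1 A1] : exists r, itg nu (fun w => p x w * chi w) = r%:E.
  by exists (stay p 0 x); rewrite -stayE.
have [a2 A2] : exists r, itg nu (fun w => p x w * (1 - chi w)) = r%:E.
  exists (ritg nu (fun w => p x w * (1 - chi w))); apply: (itg_le_fin (c := 1) _ _).1; first by nn.
  rewrite -[1%:E](ds_row P x); apply: le_itg => [||t|t]; [by mfun|by mfun|by nn|].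
  by rewrite ler_piMr// gerBl.
have a12 : a1 + a2 = 1.
  apply: EFin_inj; rewrite EFinD -A1 -A2 -itgD//; try (by mfun); try (by nn).
  by rewrite -[RHS](ds_row P x); apply: eq_itg => t; ring.
have := O x x0; rewrite E2 A2 -EFinM lee_fin => r2a2.
rewrite (eq_itg _ (g := fun w => p x w * Num.max (e w) 0 + C0 * (p x w * chi w))); last first.
  by move=> t; rewrite -chi_pos; ring.
rewrite itgD//; try (by mfun); try (by nn).
rewrite itgZ//; try (by mfun); try (by nn).
by rewrite E1 A1 -EFinM -EFinD lee_fin; nra.
Qed.

(** The optional stopping bound on E[X_n + C0; stay], by iterating [one_step]. *)
Lemma stay_moment p b v C0 x n : walk p b v -> 0 <= v -> 0 <= b -> 0 <= C0 ->
  overshoot C0 p -> 0 <= e x ->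
  (itg nu (fun z => q p n x z * (chi z * (e z + C0)))%R <=
   (e x + b + C0 + b * \sum_(i < n) stay p i x)%:E)%E.
Proof.
move=> W v0 b0 C00 O x0; have P := walk_ds W; have p0 := ds_ge0 P; have pm := ds_meas P.
have c0 := chi_ge0.
have g0 t : 0 <= chi t * (e t + C0).
  by rewrite mulrDr chi_pos addr_ge0 ?mulr_ge0// le_max lexx orbT.
have mg : measurable_fun setT (fun t => chi t * (e t + C0)) by mfun.
elim: n => [|n IH]; first by rewrite big_ord0 mulr0 addr0 (one_step W).
rewrite -{1}[n]addn0 (kern_CK_itg P Kc n 0)// big_ord_recr/= mulrDr addrA EFinD.
have k0 t := kern_ge0 P Kc n x t; have mk := kern_row P Kc n x.
apply: (@le_trans _ _ (itg nu (fun z => q p n x z * (chi z * (e z + C0)) +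
    b * (q p n x z * chi z)))); last first.
  rewrite itgD//; try (by mfun); try (by nn).
  rewrite itgZ//; try (by mfun); try (by nn).
  by rewrite stayE// -EFinM leeD.
apply: ge0_le_integral => //.
- by move=> t _; rewrite mule_ge0// ?lee_fin ?mulr_ge0//; apply: itg_ge0; nn.
- apply: emeasurable_funM; first by apply/measurable_EFinP; mfun.
  by apply: measurable_itg; [mfun|nn].
- by apply/measurable_EFinP; mfun.
move=> t _; have [t0|t0] := leP 0 (e t); last first.
  by rewrite chi0// !(mulr0, mul0r, mul0e, addr0).
have -> : q p n x t * (chi t * (e t + C0)) + b * (q p n x t * chi t) =
  q p n x t * chi t * (e t + b + C0) by ring.
rewrite (EFinM (q p n x t * chi t)); apply: lee_wpmul2l; first by rewrite lee_fin mulr_ge0.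
exact: (one_step W).
Qed.

(** Both staying nonnegative and the positive part of the end point increase with
    the path, hence they are positively correlated. *)
Lemma stay_association p b v n x : walk p b v ->
  ((stay p n x)%:E * itg nu (fun z => k p n x z * Num.max (e z) 0)%R <=
   itg nu (fun z => q p n x z * (chi z * e z))%R)%E.
Proof.
move=> W; have P := walk_ds W; have c0 := chi_ge0.
have k0 t := kern_ge0 P K1 n x t; have mk := kern_row P K1 n x.
have q0 t := kern_ge0 P Kc n x t; have mq := kern_row P Kc n x.
have mpos : measurable_fun setT (fun z => Num.max (e z) 0) by exact: measurable_maxr.
have pos0 z : 0 <= Num.max (e z) 0 by rewrite le_max lexx orbT.
rewrite -stayE// -[leRHS]mule1 -(kern_mass P n x).
under [itg nu (fun z => q p n x z * (chi z * e z))]eq_itg do rewrite chi_pos.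
apply: (@four_functions _ _ _ nu e); try (by mfun); try (by nn).
move=> s t; have H := kern_holley P (walk_tp2 W) Kc chi_mono n x x s t.
have xx : mx e x x = x by rewrite /mx lexx.
have xx' : mn e x x = x by rewrite /mn lexx.
rewrite xx xx' in H.
have [s0|s0] := leP 0 (e s); last first.
  by rewrite (chi0 s0) mulr0 mul0r mulr_ge0// mulr_ge0.
rewrite (chi1 s0) mulr1.
have -> : q p n x s * (k p n x t * Num.max (e t) 0) = q p n x s * k p n x t * Num.max (e t) 0 by ring.
have -> : q p n x (mx e s t) * Num.max (e (mx e s t)) 0 * k p n x (mn e s t) =
  q p n x (mx e s t) * k p n x (mn e s t) * Num.max (e (mx e s t)) 0 by ring.
apply: ler_pM => //; first by rewrite mulr_ge0.
by rewrite emb_mx ge_max; apply/andP; split; rewrite !le_max lexx !orbT.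
Qed.

Section Uniform.
Variables v0 C0 : R.
Hypotheses (v0_gt0 : 0 < v0) (C0_ge0 : 0 <= C0).

Lemma sum_inv_sq n : \sum_(i < n) (sq i)^-1 <= 2 * sq n.
Proof.
suff : \sum_(i < n) (sq i)^-1 <= 2 * Num.sqrt n%:R.
  by move/le_trans; apply; rewrite ler_wpM2l// ler_sqrt ?ltr0n// ler_nat.
elim: n => [|n IH]; first by rewrite big_ord0 mulr_ge0// sqrtr_ge0.
rewrite big_ord_recr/= -/(sq n).
set r := Num.sqrt n%:R in IH *.
have s0 := sq_gt0 R n; have r0 : 0 <= r by exact: sqrtr_ge0.
have E : sq n ^+ 2 = r ^+ 2 + 1 by rewrite sqr_sq sqr_sqrtr ?ler0n// natr1.
suff : (sq n)^-1 <= 2 * (sq n - r) by lra.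
rewrite -[(sq n)^-1]mul1r ler_pdivrMr//; have := sqr_ge0 (sq n - r); nra.
Qed.

(** Compare [stay_association], where the mean of the positive part is at least
    kap sqrt n by [spread], with [stay_moment]. The drift contributes b times the sum
    of the earlier probabilities, which by induction has order b (x + 1) sqrt n; it is
    absorbed as long as b sqrt n <= eps. *)
Lemma stay_upper : exists A eps : R, [/\ 0 < A, 0 < eps & forall p b v,
  walk p b v -> v0 <= v -> 0 <= b <= 1 -> overshoot C0 p -> forall n x, 0 <= e x ->
  b * sq n <= eps -> stay p n x <= A * (e x + 1) / sq n].
Proof.
have [kap [N [kap0 sp]]] := spread S v0_gt0.
pose A := 4 * (C0 + 1) / kap + sq N.
have C00 := C0_ge0; have C1 : 0 < C0 + 1 by lra.
have sN := sq_gt0 R N.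
have A1 : 4 * (C0 + 1) / kap <= A by rewrite lerDl ltW.
have A2 : sq N <= A by rewrite lerDr; nn.
have A0 : 0 < A by rewrite (lt_le_trans sN).
exists A, (kap / 8); split=> //; first by pos.
move=> p b v W v0v /andP[b0 b1] O n x x0 bn.
have P := walk_ds W; have vv : 0 <= v by rewrite (le_trans (ltW v0_gt0)).
have x1 : 1 <= e x + 1 by lra.
elim/ltn_ind: n bn => n IH bn.
have sn := sq_gt0 R n.
have [nN|Nn] := ltnP n N.
  rewrite (le_trans (stay_le1 n x P))// ler_pdivlMr// mul1r.
  have snN : sq n <= sq N by rewrite ler_sqrt ?ltr0Sn// ler_nat ltnW.
  by rewrite (le_trans snN)// (le_trans A2)// ler_peMr// ltW.
have sum_le : \sum_(i < n) stay p i x <= A * (e x + 1) * (2 * sq n).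
  apply: (@le_trans _ _ (\sum_(i < n) (A * (e x + 1)) * (sq i)^-1)).
    apply: ler_sum => i _; apply: IH => //.
    apply: le_trans bn; rewrite ler_wpM2l// ler_sqrt ?ltr0Sn// ler_nat.
    exact: ltnW (ltn_ord i).
  by rewrite -mulr_sumr ler_wpM2l ?sum_inv_sq// mulr_ge0; lra.
have H1 : (kap * sq n * stay p n x <= e x + b + C0 + b * \sum_(i < n) stay p i x).
  rewrite -lee_fin; apply: le_trans (stay_moment n W vv b0 C0_ge0 O x0).
  apply: (@le_trans _ _ (itg nu (fun z => q p n x z * (chi z * e z)))); last first.
    have k0 t := kern_ge0 P Kc n x t; have mk := kern_row P Kc n x.
    have c0 := chi_ge0.
    apply: le_itg => [||t|t]; [by mfun|by mfun| |].
      by rewrite chi_pos mulr_ge0// le_max lexx orbT.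
    by rewrite ler_wpM2l// ler_wpM2l// lerDl.
  apply: le_trans (stay_association n x W); rewrite mulrC EFinM.
  apply: lee_wpmul2l; first by rewrite lee_fin stay_ge0.
  apply: le_trans (sp _ _ _ n x W v0v Nn) _.
  have k0 t := kern_ge0 P K1 n x t; have mk := kern_row P K1 n x.
  have md : measurable_fun setT (dev e b n x) by exact: (measurable_dev S).
  apply: le_itg => [||t|t].
  - by apply: measurable_funM => //; exact: measurable_maxr.
  - by apply: measurable_funM => //; exact: measurable_maxr.
  - by rewrite mulr_ge0// le_max lexx orbT.
  rewrite ler_wpM2l// ge_max !le_max lexx orbT andbT; apply/orP; left.
  by have := mulr_ge0 (ler0n R n.+1) b0; rewrite /dev; lra.
rewrite ler_pdivlMr//.
have H2 : b * \sum_(i < n) stay p i x <= kap / 4 * (A * (e x + 1)).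
  apply: le_trans (ler_wpM2l b0 sum_le) _.
  have -> : b * (A * (e x + 1) * (2 * sq n)) = (b * sq n) * (2 * (A * (e x + 1))) by ring.
  have -> : kap / 4 * (A * (e x + 1)) = kap / 8 * (2 * (A * (e x + 1))) by field.
  by rewrite ler_wpM2r//; nn; lra.
have H3 : e x + b + C0 <= kap / 4 * (A * (e x + 1)).
  have : C0 + 1 <= kap / 4 * A.
    have -> : C0 + 1 = kap / 4 * (4 * (C0 + 1) / kap) by field; rewrite gt_eqF.
    by rewrite ler_wpM2l// divr_ge0// ltW.
  by move=> h; nra.
have H4 : kap * (stay p n x * sq n) <= kap * (A * (e x + 1)).
  have : 0 <= kap * (A * (e x + 1)) by nn; lra.
  by nra.
by move: H4; rewrite ler_pM2l.
Qed.
End Uniform.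
End Free.

(** * Upper bound on the killed kernel *)

Lemma ler_of_sqr (R : realType) (a b : R) : 0 <= b -> a ^+ 2 <= b ^+ 2 -> a <= b.
Proof.
move=> b0 H; have [a0|/ltW a0] := leP 0 a; last exact: le_trans b0.
by rewrite -ler_sqr.
Qed.

Lemma split_three n : (3 <= n)%N -> exists m l : nat,
  [/\ (m + (l + m).+1).+1 = n, (n.+1 <= 6 * m.+1)%N & (n.+1 <= 6 * l.+1)%N].
Proof.
move=> n3; exists ((n - 2) %/ 3)%N, (n - 2 - 2 * ((n - 2) %/ 3))%N.
have := divn_eq (n - 2) 3; have : ((n - 2) %% 3 < 3)%N by rewrite ltn_mod.
move: ((n - 2) %/ 3)%N ((n - 2) %% 3)%N => u w; split; lia.
Qed.

Section Upper.
Context d (T : measurableType d) (R : realType).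
Variable nu : {sigma_finite_measure set T -> \bar R}.
Variables (e : T -> R) (add : T -> T -> T) (opp : T -> T).
Hypothesis S : state_space nu e add opp.
Let em := emb_meas S.
Let K1 := no_killing T R.
Local Notation walk := (walk nu e add).
Local Notation k p := (kern nu p (fun=> 1)).
Local Notation sq := (sq R).
Local Notation chi := (chi e).
Local Notation q p := (kern nu p chi).
Local Notation stay := (stay nu e).
Local Notation overshoot := (overshoot nu e).
Let Kc := chi_killing S.

Section Split.
Variables (p : T -> T -> R) (b v v0 : R).
Hypotheses (W : walk p b v) (v0_gt0 : 0 < v0) (v0v : v0 <= v).
Let P := walk_ds W.

(** The second part of the path is bounded by the supremum of the free kernel. *)
Lemma kern_two_parts m l x y :
  q p (m + l).+1 x y <= stay p m x * (supc v0 / sq l).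
Proof.
have q0 i s t : 0 <= q p i s t by exact: kern_ge0.
have mq := kern_row P Kc m x; have mq' := kern_col P Kc l y.
have c0 := chi_ge0 e; have cm := measurable_chi S.
have F0 : 0 <= supc v0 / sq l by rewrite divr_ge0 ?sq_ge0// ltW// supc_gt0.
rewrite -lee_fin mulrC EFinM -(stayE S)// (kern_CK P Kc) -itgZ//; try (by mfun); try (by nn).
apply: le_itg => [||t|t]; [by mfun|by mfun|by nn|].
rewrite mulrC ler_wpM2r ?mulr_ge0//.
by rewrite (le_trans (kern_le_free P Kc _ _ _))// (kern_sup S v0_gt0 _ _ _ W v0v).
Qed.

(** The last third is read backwards, as a piece of the reversed walk from y. *)
Lemma kern_three_parts m l x y :
  q p (m + (l + m).+1).+1 x y <= stay p m x * (supc v0 / sq l) * stay (rev p) m y.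
Proof.
have q0 i s t : 0 <= q p i s t by exact: kern_ge0.
have Pr := ds_rev P.
have mq := kern_row P Kc m x.
have c0 := chi_ge0 e; have cm := measurable_chi S.
have F0 : 0 <= supc v0 / sq l by rewrite divr_ge0 ?sq_ge0// ltW// supc_gt0.
have inner t : q p (l + m).+1 t y <= supc v0 / sq l * stay (rev p) m y.
  have mq1 := kern_row P Kc l t; have mq2 := kern_row Pr Kc m y.
  have q1 := kern_ge0 Pr Kc m y.
  rewrite -lee_fin EFinM -(stayE S)// (kern_CK P Kc) -itgZ//; try (by mfun); try (by nn).
  apply: le_itg => [||z|z]; [|by mfun|by nn|].
    by have mq' := kern_col P Kc m y; mfun.
  rewrite (kern_rev _ _ _ P Kc) -mulrA [chi z * _]mulrC ler_wpM2r ?mulr_ge0//.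
  by rewrite (le_trans (kern_le_free P Kc _ _ _))// (kern_sup S v0_gt0 _ _ _ W v0v).
have G0 : 0 <= supc v0 / sq l * stay (rev p) m y by rewrite mulr_ge0 ?(stay_ge0 S).
rewrite -mulrA mulrC -lee_fin (EFinM (_ * _)) -(stayE S)// (kern_CK P Kc) -itgZ//; try (by mfun); try (by nn).
apply: le_itg => [||t|t]; [|by mfun|by nn|].
  by have mq' := kern_col P Kc (l + m).+1 y; mfun.
by rewrite mulrC ler_wpM2r ?mulr_ge0.
Qed.
End Split.

(** By Holley's inequality q_n / p_n increases with the end point, and it is the same
    for the walk and its tilt. *)
Lemma tilted_ratio p lam M D n x y y' : doubly_stochastic nu p -> tp2 e p ->
  doubly_stochastic nu (tilt e lam M p) -> 0 < M ->
  0 < k (tilt e lam M p) n x y' -> e y <= e y' ->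
  q (tilt e lam M p) n x y' <= D * k (tilt e lam M p) n x y' ->
  q p n x y <= D * k p n x y.
Proof.
move=> P TP Pt M0 kpos yy' ratio.
rewrite (kern_tilt P K1 M0 Pt) (kern_tilt P Kc M0 Pt) [leRHS]mulrA in ratio.
rewrite (kern_tilt P K1 M0 Pt) in kpos.
have f0 : 0 < expR (lam * (e y' - e x)) / M ^+ n.+1 by pos.
rewrite (ler_pM2r f0) in ratio; rewrite pmulr_lgt0// in kpos.
have H := kern_holley P TP Kc (chi_mono (e := e)) n x x y y'.
rewrite /mx /mn lexx yy' in H.
rewrite -(ler_pM2r kpos) (le_trans H)//.
have k0 := kern_ge0 P K1 n x y.
by apply: (le_trans (ler_wpM2r k0 ratio)); rewrite mulrAC.
Qed.

Section Family.
Variables lam0 c1 c2 v0 v1 C0 : R.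

(** Constants valid for all tilts with parameter in [0, lam0]: the drift is comparable
    to the parameter, the variance stays in a compact interval of positive numbers and
    the overshoot is bounded. *)
Record tilted_family (p : T -> T -> R) : Prop := TiltedFamily {
  fam_base : exists2 v, v0 <= v <= v1 & walk p 0 v;
  fam_overshoot : overshoot C0 p;
  fam_tilt : forall lam, 0 <= lam <= lam0 -> exists M b v,
    [/\ 1 <= M, c1 * lam <= b <= c2 * lam, v0 <= v <= v1,
        walk (tilt e lam M p) b v & overshoot C0 (tilt e lam M p)] }.

Hypotheses (lam0_gt0 : 0 < lam0) (c1_gt0 : 0 < c1) (c12 : c1 <= c2)
  (v0_gt0 : 0 < v0) (v01 : v0 <= v1) (C0_ge0 : 0 <= C0).

Lemma sq_frac (j n : nat) (r : R) : 0 <= r -> (n.+1%:R <= r ^+ 2 * j.+1%:R) -> sq n <= r * sq j.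
Proof.
move=> r0 H; rewrite -ler_sqr ?nnegrE ?mulr_ge0 ?sq_ge0//.
by rewrite exprMn !sqr_sq.
Qed.

(** Each third of the path has length comparable to n, and p_n(x, y) >= c / sqrt n as
    both ends are within a sqrt n of 0. *)
Lemma kern_upper_central : exists a C : R, exists N, [/\ 0 < a, 0 < C &
  forall p, tilted_family p -> tilted_family (rev p) -> forall x y n,
  0 <= e x -> e x <= e y -> e y <= a * sq n -> (N <= n)%N ->
  q p n x y <= C * ((e x + 1) * (e y + 1) / n.+1%:R) * k p n x y].
Proof.
have [A [eps [A0 eps0 HA]]] := stay_upper S v0_gt0 C0_ge0.
have [a [c [N [a0 c0 Hc]]]] := center_bound S v0_gt0 v01.
have F0 : 0 < supc v0 := supc_gt0 v0_gt0.
exists a, (27 * A ^+ 2 * supc v0 / c), (maxn N 3); split=> //; first by pos.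
move=> p Fp Fr x y n x0 xy ya; rewrite geq_max => /andP[Nn n3].
have [v /andP[v0v vv1] W] := fam_base Fp.
have [v' /andP[v0v' vv1'] W'] := fam_base Fr.
have y0 : 0 <= e y by lra.
have [m [l [nE mn ln]]] := split_three n3.
have frac j : (n.+1 <= 6 * j.+1)%N -> sq n / 3 <= sq j.
  move=> h; rewrite ler_pdivrMr// mulrC; apply: sq_frac => //.
  by rewrite -natrX -natrM ler_nat (leq_trans h)// leq_mul2r orbT.
have sn := sq_gt0 R n; have sm := sq_gt0 R m; have sl := sq_gt0 R l.
have fm := frac m mn; have fl := frac l ln.
have st1 : stay p m x <= 3 * A * (e x + 1) / sq n.
  apply: le_trans (HA p 0 v W v0v _ (fam_overshoot Fp) m x x0 _) _.
  - by rewrite lexx ler01.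
  - by rewrite mul0r ltW.
  rewrite ler_pdivrMr// mulrAC ler_pdivlMr//.
  have : 0 <= A * (e x + 1) by nn; lra.
  nra.
have st2 : stay (rev p) m y <= 3 * A * (e y + 1) / sq n.
  apply: le_trans (HA _ 0 v' W' v0v' _ (fam_overshoot Fr) m y y0 _) _.
  - by rewrite lexx ler01.
  - by rewrite mul0r ltW.
  rewrite ler_pdivrMr// mulrAC ler_pdivlMr//.
  have : 0 <= A * (e y + 1) by nn; lra.
  nra.
have st3 : supc v0 / sq l <= 3 * supc v0 / sq n.
  rewrite ler_pdivrMr// mulrAC ler_pdivlMr//; nra.
have kl : c / sq n <= k p n x y.
  apply: (Hc p 0 v n x y W) => //; first by rewrite v0v.
  rewrite /dev mulr0 subr0 ger0_norm; lra.
have P := walk_ds W; have Pr := walk_ds W'.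
have := kern_three_parts W v0_gt0 v0v m l x y; rewrite nE => /le_trans; apply.
apply: (@le_trans _ _ (3 * A * (e x + 1) / sq n * (3 * supc v0 / sq n) * (3 * A * (e y + 1) / sq n))).
  apply: ler_pM => //.
  - by rewrite !mulr_ge0 ?(stay_ge0 S) ?invr_ge0 ?sq_ge0// ltW.
  - exact: (stay_ge0 S).
  - apply: ler_pM => //; first exact: (stay_ge0 S).
    by rewrite divr_ge0 ?sq_ge0// ltW.
have -> : 3 * A * (e x + 1) / sq n * (3 * supc v0 / sq n) * (3 * A * (e y + 1) / sq n) =
  27 * A ^+ 2 * supc v0 / c * ((e x + 1) * (e y + 1) / n.+1%:R) * (c / sq n).
  by rewrite -(sqr_sq R n); field; rewrite !gt_eqF.
apply: ler_wpM2l => //.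
by nn; lra.
Qed.

Lemma initial_block (r : R) n : 2 <= r -> 2 * r <= n.+1%:R -> exists m l : nat,
  [/\ (m + l).+1 = n, m.+1%:R <= r, r <= 2 * m.+1%:R & (n.+1 <= 4 * l.+1)%N].
Proof.
move=> r2 rn; have r0 : 0 <= r by lra.
have := truncn_le r; have := truncnS_gt r; set t := Num.truncn r => tr rt.
have {}rt : t%:R <= r by move: rt; rewrite r0.
have t1 : (1 < t)%N.
  by rewrite -(ltr_nat R); move: tr; rewrite -natr1; lra.
have tn : (2 * t <= n.+1)%N by rewrite -(ler_nat R) natrM; lra.
have [m [l [E1 E2 E3]]] : exists m l : nat, [/\ (m + l).+1 = n, m.+1 = t & (n.+1 <= 4 * l.+1)%N].
  by exists t.-1, (n - t)%N; clear -t1 tn; split; lia.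
exists m, l; rewrite E2; split=> //.
have t1R : (1 : R) <= t%:R by rewrite ler1n ltnW.
by move: tr; rewrite -natr1; lra.
Qed.

(** Tilt by lam = 2 (y / n) / c1: the drift b is at least 2 y / n, so that the mean end
    point x + b n, rounded to y', exceeds y. At y' the free tilted kernel has order
    1 / sqrt n. For the killed one, use [stay_upper] during the first m steps, with
    m of order 1 / b^2 as its range requires; this gives (x + 1) / sqrt m, of order
    (x + 1) b. So the ratio at y' is at most C (x + 1) y / n, and it is smaller
    at y. *)
Lemma kern_upper_steep (a : R) : 0 < a -> exists del C : R, exists N, [/\ 0 < del, 0 < C &
  forall p, tilted_family p -> forall x y n,
  0 <= e x -> e x <= e y -> a * sq n <= e y <= del * n.+1%:R -> (N <= n)%N ->
  q p n x y <= C * ((e x + 1) * (e y + 1) / n.+1%:R) * k p n x y].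
Proof.
move=> a0.
have l0 := lam0_gt0; have c1p := c1_gt0; have c12' := c12.
have c2p : 0 < c2 by lra.
have [A [eps [A0 eps0 HA]]] := stay_upper S v0_gt0 C0_ge0.
have [a' [c [N [a'0 c0 Hc]]]] := center_bound S v0_gt0 v01.
have F0 : 0 < supc v0 := supc_gt0 v0_gt0.
pose eps1 := Num.min eps a.
have e10 : 0 < eps1 by rewrite /eps1 lt_min eps0 a0.
have e1e : eps1 <= eps by rewrite ge_min lexx.
have e1a : eps1 <= a by rewrite ge_min lexx orbT.
(* The three terms ensure lam <= lam0, b <= 1 and 2 b <= eps1. *)
pose del := Num.min (c1 * lam0 / 2) (Num.min (c1 / (2 * c2)) (c1 * eps1 / (4 * c2))).
have del0 : 0 < del by rewrite /del !lt_min; apply/and3P; split; pos.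
have [N1 hN1] := sq_large (Num.max a^-1 a'^-1).
exists del, (8 * A * c2 * supc v0 / (c1 * eps1 * c)), (maxn N N1); split=> //; first by pos.
move=> p Fp x y n x0 xy /andP[ay yd]; rewrite geq_max => /andP[Nn N1n].
have y0 : 0 <= e y by lra.
have sn := sq_gt0 R n.
have := hN1 n N1n; rewrite ge_max => /andP[as1 as2].
have {}as1 : 1 <= a * sq n by rewrite -ler_pdivrMl// mulr1.
have {}as2 : 1 <= a' * sq n by rewrite -ler_pdivrMl// mulr1.
have y1 : 1 <= e y by lra.
have [N' N'E] : exists N' : R, N' = n.+1%:R by exists n.+1%:R.
have N'0 : 0 < N' by rewrite N'E ltr0n.
rewrite -N'E in yd *.
have d1 : del <= c1 * lam0 / 2 by rewrite !ge_min lexx.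
have d2 : del <= c1 / (2 * c2) by rewrite !ge_min lexx orbT.
have d3 : del <= c1 * eps1 / (4 * c2) by rewrite !ge_min lexx !orbT.
have yN d' : del <= d' -> e y / N' <= d'.
  by move=> dd; rewrite ler_pdivrMr// (le_trans yd)// ler_wpM2r// ltW.
have [lam lamD] : exists lam, lam = 2 * (e y / N') / c1 by exists (2 * (e y / N') / c1).
have yN0 : 0 < e y / N' by rewrite divr_gt0// ; lra.
have lam_0 : 0 < lam by rewrite lamD; pos.
have lamE : lam * c1 = 2 * (e y / N') by rewrite lamD; field; rewrite !gt_eqF.
have lam_1 : lam <= lam0.
  by rewrite lamD ler_pdivrMr//; have := yN _ d1; lra.
have [|M [b [v [M1 /andP[b1 b2] /andP[v0v vv1] W O]]]] := fam_tilt Fp (lam := lam).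
  by rewrite lam_1 ltW.
have b0 : 0 < b by apply: lt_le_trans b1; rewrite mulr_gt0.
have by2 : 2 * e y <= b * N'.
  by rewrite -ler_pdivrMr// -mulrA -lamE mulrC.
have blam : b <= 2 * c2 / c1 * (e y / N').
  by rewrite (le_trans b2)// le_eqVlt; apply/orP; left; apply/eqP; rewrite lamD; field; rewrite !gt_eqF.
have ble1 : b <= 1.
  have := yN _ d2; rewrite ler_pdivlMr ?mulr_gt0// => h.
  rewrite (le_trans blam)// mulrAC ler_pdivrMr//; lra.
have ble2 : 2 * b <= eps1.
  have := yN _ d3; rewrite ler_pdivlMr ?mulr_gt0// => h.
  have : b * c1 <= 2 * c2 * (e y / N').
    by rewrite -ler_pdivlMr// (le_trans blam)// mulrAC.
  by move=> h'; rewrite -(ler_pM2r c1p); lra.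
(* r is the number of steps up to which the drift b is dominated by fluctuations. *)
have [r rE] : exists r, r = (eps1 / b) ^+ 2 by exists ((eps1 / b) ^+ 2).
have r2 : 2 <= r.
  have : 2 <= eps1 / b by rewrite ler_pdivlMr//.
  rewrite rE expr2 => h; have := ler_pM (ler0n R 2) (ler0n R 2) h h; lra.
have rN : 2 * r <= N'.
  have h1 : 2 * a * sq n <= b * N' by lra.
  have h2 : N' = sq n ^+ 2 by rewrite sqr_sq.
  have h3 : 2 * a <= b * sq n.
    by rewrite -(ler_pM2r sn) -[leRHS]mulrA -expr2 -h2.
  have h4 : 2 * (eps1 / b) <= sq n.
    by rewrite mulrA ler_pdivrMr// [leRHS]mulrC; lra.
  rewrite h2 rE; have h5 : 0 <= eps1 / b by nn.
  have := ler_pM (mulr_ge0 (ler0n R 2) h5) (mulr_ge0 (ler0n R 2) h5) h4 h4.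
  have := sqr_ge0 (eps1 / b); rewrite !expr2; lra.
rewrite N'E in rN; have [m [l [nE mr rm ln]]] := initial_block r2 rN.
have sm := sq_gt0 R m; have sl := sq_gt0 R l.
have eb0 : 0 <= eps1 / b by nn.
have bm : b * sq m <= eps1.
  have : sq m <= eps1 / b.
    by rewrite -ler_sqr ?nnegrE ?sq_ge0// sqr_sq -rE.
  by rewrite ler_pdivlMr// mulrC.
have bm2 : eps1 <= 2 * b * sq m.
  have : eps1 / b <= 2 * sq m.
    apply: ler_of_sqr; first by rewrite mulr_ge0 ?sq_ge0.
    rewrite -rE (exprMn 2) sqr_sq.
    by rewrite (le_trans rm)// ler_wpM2r// -natrX ler_nat.
  by rewrite ler_pdivrMr// mulrAC.
have sln : sq n <= 2 * sq l.
  by apply: sq_frac => //; rewrite -natrX -natrM ler_nat.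
have [y' /andP[y'1 y'2]] := emb_floor S (e x + b * N').
have yy' : e y <= e y' by lra.
have [v' _ W0] := fam_base Fp; have P := walk_ds W0.
have M0 : 0 < M := lt_le_trans ltr01 M1.
have x1 : 0 < e x + 1 by rewrite ltr_wpDl.
have klo : c / sq n <= k (tilt e lam M p) n x y'.
  apply: (Hc _ b v n x y' W) => //; first by rewrite v0v.
  by rewrite /dev -N'E ler_norml; apply/andP; split; lra.
have qup : q (tilt e lam M p) n x y' <= A * (e x + 1) / sq m * (supc v0 / sq l).
  rewrite -nE (le_trans (kern_two_parts W v0_gt0 v0v m l x y'))//.
  rewrite ler_wpM2r ?divr_ge0 ?sq_ge0 ?(ltW F0)//.
  apply: (HA _ b v W v0v _ O) => //; [by rewrite ble1 ltW|exact: le_trans bm e1e].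
have {}qup : q (tilt e lam M p) n x y' <= 8 * A * c2 * supc v0 / (c1 * eps1) * (e x + 1) * (e y / N') / sq n.
  apply: (le_trans qup).
  apply: (@le_trans _ _ (A * (e x + 1) * (2 * b / eps1) * (supc v0 * 2 / sq n))).
    apply: ler_pM; [by nn|by nn| |].
      apply: ler_wpM2l; first by nn.
      by rewrite -[(sq m)^-1]mul1r ler_pdivrMr// mulrAC ler_pdivlMr// mul1r.
    rewrite -mulrA; apply: ler_wpM2l; first exact: ltW.
    by rewrite -[(sq l)^-1]mul1r ler_pdivrMr// mulrAC ler_pdivlMr// mul1r.
  have -> : 8 * A * c2 * supc v0 / (c1 * eps1) * (e x + 1) * (e y / N') / sq n =
    A * (e x + 1) * (2 * (2 * c2 / c1 * (e y / N')) / eps1) * (supc v0 * 2 / sq n).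
    by field; rewrite !gt_eqF.
  apply: ler_wpM2r; first by nn.
  apply: ler_wpM2l; first by nn.
  by rewrite ler_wpM2r ?invr_ge0 ?(ltW e10)// ler_wpM2l.
have K00 : 0 <= 8 * A * c2 * supc v0 / (c1 * eps1 * c) by apply: ltW; pos.
have kpos : 0 < k (tilt e lam M p) n x y' by apply: lt_le_trans klo; pos.
have ratio : q (tilt e lam M p) n x y' <=
    8 * A * c2 * supc v0 / (c1 * eps1 * c) * ((e x + 1) * (e y / N')) * k (tilt e lam M p) n x y'.
  apply: (le_trans qup).
  have -> : 8 * A * c2 * supc v0 / (c1 * eps1) * (e x + 1) * (e y / N') / sq n =
    8 * A * c2 * supc v0 / (c1 * eps1 * c) * ((e x + 1) * (e y / N')) * (c / sq n).
    by field; rewrite !gt_eqF.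
  apply: ler_wpM2l klo; apply: mulr_ge0; first exact: K00.
  exact: ltW (mulr_gt0 x1 yN0).
apply: le_trans (tilted_ratio P (walk_tp2 W0) (walk_ds W) M0 kpos yy' ratio) _.
have k0 := kern_ge0 P K1 n x y.
apply: ler_wpM2r => //; apply: ler_wpM2l => //.
rewrite -[leRHS]mulrA; apply: ler_wpM2l; first exact: ltW.
by apply: ler_wpM2r; [rewrite invr_ge0 ltW|rewrite lerDl].
Qed.

(** If y >= del n or n is bounded, the right-hand side is at least p_n(x, y). *)
Lemma kern_upper_ordered : exists C : R, 0 < C /\
  forall p, tilted_family p -> tilted_family (rev p) -> forall x y n,
  0 <= e x -> e x <= e y ->
  q p n x y <= C * ((e x + 1) * (e y + 1) / n.+1%:R) * k p n x y.
Proof.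
have [a [C1 [N1 [a0 C10 H1]]]] := kern_upper_central.
have [del [C2 [N2 [del0 C20 H2]]]] := kern_upper_steep a0.
exists (C1 + C2 + (maxn N1 N2).+1%:R + del^-1); split; first by pos.
move=> p Fp Fr x y n x0 xy.
have [v' _ W0] := fam_base Fp; have P := walk_ds W0.
have k0 := kern_ge0 P K1 n x y.
have t0 : 0 <= (e x + 1) * (e y + 1) / n.+1%:R by nn; lra.
have i0 : 0 <= del^-1 by nn.
have N0 : (0 : R) <= (maxn N1 N2).+1%:R by nn.
have trivial_case (D : R) : 1 <= D * ((e x + 1) * (e y + 1) / n.+1%:R) ->
    D <= C1 + C2 + (maxn N1 N2).+1%:R + del^-1 ->
    q p n x y <= (C1 + C2 + (maxn N1 N2).+1%:R + del^-1) * ((e x + 1) * (e y + 1) / n.+1%:R) * k p n x y.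
  move=> D1 DC; rewrite (le_trans (kern_le_free P Kc _ _ _))// ler_peMl//.
  by rewrite (le_trans D1)// ler_wpM2r.
have use_case (D : R) : q p n x y <= D * ((e x + 1) * (e y + 1) / n.+1%:R) * k p n x y ->
    D <= C1 + C2 + (maxn N1 N2).+1%:R + del^-1 ->
    q p n x y <= (C1 + C2 + (maxn N1 N2).+1%:R + del^-1) * ((e x + 1) * (e y + 1) / n.+1%:R) * k p n x y.
  by move=> D1 DC; rewrite (le_trans D1)// ler_wpM2r// ler_wpM2r.
have xy1 : 1 <= (e x + 1) * (e y + 1) by nra.
have [nN|] := ltnP n (maxn N1 N2).
  apply: (trivial_case (maxn N1 N2).+1%:R); last by lra.
  rewrite mulrA ler_pdivlMr// mul1r.
  apply: (@le_trans _ _ ((maxn N1 N2).+1%:R * 1)); last by rewrite ler_wpM2l.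
  by rewrite mulr1 ler_nat ltnW.
rewrite geq_max => /andP[nN1 nN2].
have [ya|ya] := leP (e y) (a * sq n); first by apply: (use_case C1); [exact: H1|lra].
have [yd|yd] := leP (e y) (del * n.+1%:R).
  by apply: (use_case C2); [apply: H2 => //; rewrite yd ltW|lra].
apply: (trivial_case del^-1); last by lra.
rewrite mulrA ler_pdivlMr// mul1r mulrC ler_pdivlMr//.
by rewrite mulrC; nra.
Qed.

(** The case y <= x follows by time reversal. *)
Theorem kern_upper : exists C : R, 0 < C /\
  forall p, tilted_family p -> tilted_family (rev p) -> forall x y n,
  0 <= e x -> 0 <= e y ->
  q p n x y <= C * ((e x + 1) * (e y + 1) / n.+1%:R) * k p n x y.
Proof.
have [C [C0' H]] := kern_upper_ordered; exists C; split=> // p Fp Fr x y n x0 y0.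
have [xy|/ltW yx] := leP (e x) (e y); first exact: H.
have [v' _ W0] := fam_base Fp; have P := walk_ds W0.
rewrite -(kern_rev n x y P Kc) -(kern_rev n x y P K1) [(e x + 1) * _]mulrC.
by apply: H.
Qed.
End Family.
End Upper.

(** * Survival under a positive drift *)

Lemma expRN_upper (R : realType) (t : R) : 0 <= t <= 1 -> expR (- t) <= 1 - t / 2.
Proof.
move=> /andP[t0 t1]; rewrite expRN.
have h : 1 + t <= expR t by exact: expR_ge1Dx.
have p0 : 0 < expR t := expR_gt0 t.
rewrite -[_^-1]mul1r ler_pdivrMr//; nra.
Qed.

Section Lower.
Context d (T : measurableType d) (R : realType).
Variable nu : {sigma_finite_measure set T -> \bar R}.
Variables (e : T -> R) (add : T -> T -> T) (opp : T -> T).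
Hypothesis S : state_space nu e add opp.
Let em := emb_meas S.
Let K1 := no_killing T R.
Local Notation walk := (walk nu e add).
Local Notation k p := (kern nu p (fun=> 1)).
Local Notation sq := (sq R).
Local Notation chi := (chi e).
Local Notation q p := (kern nu p chi).
Local Notation stay := (stay nu e).
Let Kc := chi_killing S.

(** With the normalisation M >= 1, the tilted walk satisfies
    E[exp(-lam X_1)] = exp(-lam x) / M, so exp(-lam X) is a supermartingale that is at
    least 1 when the walk leaves the half line. *)
Lemma stay_exp p lam M n x : 0 <= lam -> 1 <= M -> doubly_stochastic nu p ->
  doubly_stochastic nu (tilt e lam M p) ->
  1 <= stay (tilt e lam M p) n x + expR (- (lam * e x)).
Proof.
move=> l0 M1 P Pt; set pt := tilt e lam M p.
have M0 : 0 < M := lt_le_trans ltr01 M1.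
have pt0 := ds_ge0 Pt : forall x y, 0 <= pt x y; have ptm := ds_meas Pt : measurable2 pt.
have p0 := ds_ge0 P; have pm := ds_meas P.
have c0 := chi_ge0 e; have cm := measurable_chi S.
have mexp : measurable_fun setT (fun t => expR (- (lam * e t))).
  apply: measurableT_comp => //; apply: measurableT_comp => //; by mfun.
have E z : itg nu (fun t => pt z t * expR (- (lam * e t))) = (expR (- (lam * e z)) / M)%:E.
  rewrite -[RHS]mule1 -(ds_row P z) -itgZ//; [|by mfun|by nn].
  apply: eq_itg => t; rewrite /pt /tilt.
  have -> : lam * (e t - e z) = - (lam * e z) + lam * e t by ring.
  rewrite expRD [expR (- (lam * e t))]expRN; field.
  by rewrite !gt_eqF// expR_gt0.
have up z : expR (- (lam * e z)) / M <= expR (- (lam * e z)).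
  by rewrite ler_pdivrMr// ler_peMr// expR_ge0.
have base t : 1 <= chi t + expR (- (lam * e t)).
  have [t0|t0] := leP 0 (e t); first by rewrite (chi1 t0) lerDl expR_ge0.
  by rewrite (chi0 t0) add0r -expR0 ler_expR; nra.
elim: n x => [|n IH] x.
  rewrite -lee_fin EFinD -(stayE S 0 x Pt) -[X in (X <= _)%E](ds_row Pt x).
  apply: (@le_trans _ _ (itg nu (fun z => pt x z * chi z)%R + itg nu (fun t => pt x t * expR (- (lam * e t)))%R)%E).
    rewrite -itgD//; try (by mfun); try (by nn).
    apply: le_itg => [||t|t]; [by mfun|by mfun|exact: pt0|].
    by rewrite -mulrDr ler_peMr.
  by rewrite leeD// E lee_fin.
rewrite -lee_fin EFinD -(stayE S n.+1 x Pt) -[X in (X <= _)%E](ds_row Pt x).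
rewrite -{1}[n]add0n (kern_CK_itg Pt Kc 0 n)//.
have ms : measurable_fun setT (fun t => itg nu (fun z => q pt n t z * chi z)).
  have mk := measurable_kern Pt Kc n; apply: measurable_itg; first by mfun.
  by move=> s t; rewrite mulr_ge0 ?(kern_ge0 Pt Kc).
have mst : measurable_fun setT (stay pt n).
  by apply: measurableT_comp => //.
have s0 t : 0 <= stay pt n t by exact: (stay_ge0 S).
apply: (@le_trans _ _ (itg nu (fun z => pt x z * (chi z * stay pt n z))%R + itg nu (fun t => pt x t * expR (- (lam * e t)))%R)%E).
  rewrite -itgD//; try (by mfun); try (by nn).
  apply: le_itg => [||t|t]; [by mfun|by mfun|exact: pt0|].
  rewrite -mulrDr ler_peMr//; have [t0|t0] := leP 0 (e t).
    by rewrite (chi1 t0) mul1r; exact: IH.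
  by have := base t; rewrite (chi0 t0) mul0r.
apply: leeD; last by rewrite E lee_fin.
rewrite le_eqVlt; apply/orP; left; apply/eqP; apply: eq_integral => t _.
by rewrite (stayE S n t Pt) -EFinM mulrA.
Qed.

(** The mean end point is at most y1 / 2, hence end points z > y1 satisfy
    z <= 2 dev(z) and their contribution is controlled by the variance, even with the
    weight z + 1 that the upper bound provides. *)
Lemma killed_tail p b v v1 n x y1 (D : R) : walk p b v -> 0 <= v <= v1 -> 1 <= y1 -> 0 <= e x -> 0 <= D ->
  2 * (e x + n.+1%:R * b) <= y1 ->
  (forall z, 0 <= e z -> q p n x z <= D * ((e z + 1) / n.+1%:R) * k p n x z) ->
  (itg nu (fun z => q p n x z * chi z * (1 - ind R (fun z => e z <= y1) z)%R)%R <= (8 * D * v1 / y1)%:E)%E.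
Proof.
move=> W /andP[v0 vv1] y1_1 x0 D0 yb H; have P := walk_ds W.
have N0 : (0 : R) < n.+1%:R by rewrite ltr0n.
have y10 : 0 < y1 := lt_le_trans ltr01 y1_1.
pose g z := 8 * D / (y1 * n.+1%:R) * (k p n x z * dev e b n x z ^+ 2).
have k0 z : 0 <= k p n x z by exact: kern_ge0.
have q0 z : 0 <= q p n x z by exact: kern_ge0.
have mk := kern_row P K1 n x; have mq := kern_row P Kc n x.
have md : measurable_fun setT (dev e b n x) by exact: (measurable_dev S).
have mi : measurable_fun setT (ind R (fun z => e z <= y1)) by apply: measurable_ind; mbool.
have c0 := chi_ge0 e; have cm := measurable_chi S.
have D8 : 0 <= 8 * D / (y1 * n.+1%:R) by nn.
apply: (@le_trans _ _ (itg nu g)); last first.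
  rewrite itgZ//; [|by mfun|by nn]; rewrite (itg_dev2 S W v0) -EFinM lee_fin.
  have -> : 8 * D / (y1 * n.+1%:R) * (n.+1%:R * v) = 8 * D / y1 * v.
    by field; rewrite !gt_eqF.
  rewrite [leRHS]mulrAC ler_wpM2l//; by nn.
apply: le_itg => [||z|z]; [by mfun|by rewrite /g; mfun| |].
  by rewrite !mulr_ge0// subr_ge0 ind_le1.
rewrite /g /ind; have [z1|z1] := leP (e z) y1.
  by rewrite subrr mulr0; nn.
have z0 : 0 <= e z by rewrite ltW// (lt_trans y10).
rewrite subr0 mulr1 (chi1 z0) mulr1; apply: (le_trans (H z z0)).
rewrite [leRHS]mulrCA [leLHS]mulrC ler_wpM2l//.
have -> : 8 * D / (y1 * n.+1%:R) * dev e b n x z ^+ 2 =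
  D * ((8 * dev e b n x z ^+ 2 / y1) / n.+1%:R) by field; rewrite !gt_eqF.
apply: ler_wpM2l => //; apply: ler_wpM2r; first by rewrite invr_ge0 ltW.
rewrite ler_pdivlMr//.
have d1 : e z <= 2 * dev e b n x z by rewrite /dev; lra.
have z2 : e z + 1 <= 2 * e z by lra.
have : (2 * e z) * y1 <= (4 * dev e b n x z) * (2 * dev e b n x z).
  by apply: ler_pM; [lra|exact: ltW|lra|lra].
rewrite expr2 => h; apply: (@le_trans _ _ ((2 * e z) * y1)); first by rewrite ler_wpM2r// ltW.
by lra.
Qed.

(** Survival has probability at least 1 - exp(-lam x1), of which [killed_tail] removes
    the part ending above y1. The remaining end points lie below y, and Holley's
    inequality transfers their total mass from x1 to the ratio q / p at (x, y). *)
Lemma lower_core p lam M b v v1 (D : R) n x x1 y y1 :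
  doubly_stochastic nu p -> walk (tilt e lam M p) b v -> 0 <= lam -> 1 <= M ->
  0 <= v <= v1 -> 1 <= y1 -> 0 <= e x1 -> 0 <= D ->
  e x1 <= e x -> y1 <= e y -> 2 * (e x1 + n.+1%:R * b) <= y1 ->
  (forall z, 0 <= e z -> q p n x1 z <= D * ((e z + 1) / n.+1%:R) * k p n x1 z) ->
  (1 - expR (- (lam * e x1)) - 8 * D * v1 / y1) * k p n x y <= q p n x y.
Proof.
move=> P W l0 M1 vv1 y1_1 x10 D0 x1x y1y yb H; have Pt := walk_ds W.
have M0 : 0 < M := lt_le_trans ltr01 M1.
set pt := tilt e lam M p in W Pt *.
have kt z z' : k pt n z z' = _ := kern_tilt P K1 M0 Pt n z z'.
have qt z z' : q pt n z z' = _ := kern_tilt P Kc M0 Pt n z z'.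
have H' z : 0 <= e z -> q pt n x1 z <= D * ((e z + 1) / n.+1%:R) * k pt n x1 z.
  move=> z0; rewrite kt qt [leRHS]mulrA ler_wpM2r ?H// .
  by rewrite divr_ge0 ?expR_ge0// exprn_ge0// ltW.
have tail := killed_tail W vv1 y1_1 x10 D0 yb H'.
have q0 z z' : 0 <= q pt n z z' by exact: kern_ge0.
have k0 z z' : 0 <= k pt n z z' by exact: kern_ge0.
have mq := kern_row Pt Kc n x1; have mk := kern_row Pt K1 n x1.
have c0 := chi_ge0 e; have cm := measurable_chi S.
pose i := ind R (fun z => e z <= y1).
have mi : measurable_fun setT i by apply: measurable_ind; mbool.
have i0 z : 0 <= i z by exact: ind_ge0.
have i1 z : 0 <= 1 - i z by rewrite subr_ge0 ind_le1.
have head : (itg nu (fun z => q pt n x1 z * chi z * i z)%R * (k pt n x y)%:E <= (q pt n x y)%:E)%E.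
  rewrite muleC -itgZ//; [|by mfun|by nn].
  rewrite -[leRHS]mule1 -(kern_mass Pt n x1) -itgZ//.
  apply: le_itg => [||z|z]; [by mfun|by mfun|by nn|].
  have [z1|z1] := leP (e z) y1; last first.
    by rewrite /i /ind (lt_geF z1) !mulr0; nn.
  have HH := kern_holley Pt (walk_tp2 W) Kc (chi_mono (e := e)) n x1 x z y.
  rewrite /mx /mn x1x (le_trans z1 y1y) in HH.
  apply: le_trans HH; rewrite mulrC -[leRHS]mulr1 [leLHS](_ : _ = q pt n x1 z * k pt n x y * (chi z * i z)); last by ring.
  apply: ler_wpM2l; first by nn.
  by rewrite mulr_ile1// ind_le1.
have st := stay_exp n x1 l0 M1 P Pt; rewrite -/pt in st.
have stS := stayE S n x1 Pt.
have [hd hdE] : exists r, itg nu (fun z => q pt n x1 z * chi z * i z) = r%:E.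
  exists (ritg nu (fun z => q pt n x1 z * chi z * i z)); apply: (itg_le_fin (c := stay pt n x1) _ _).1.
    by nn.
  rewrite -stS; apply: le_itg => [||z|z]; [by mfun|by mfun|by nn|].
  by rewrite ler_piMr ?ind_le1//; nn.
have split_stay : ((stay pt n x1)%:E <= hd%:E + (8 * D * v1 / y1)%:E)%E.
  rewrite -stS -hdE.
  apply: (@le_trans _ _ (itg nu (fun z => q pt n x1 z * chi z * i z)%R + itg nu (fun z => q pt n x1 z * chi z * (1 - i z))%R)%E).
    rewrite -itgD//; try (by mfun); try (by nn).
    by apply: le_itg => [||z|z]; [by mfun|by mfun|by nn|]; rewrite -mulrDr addrC subrK mulr1.
  by rewrite leeD2l.
rewrite hdE -EFinM lee_fin in head; rewrite -EFinD lee_fin in split_stay.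
have F : (1 - expR (- (lam * e x1)) - 8 * D * v1 / y1) * k pt n x y <= q pt n x y.
  by apply: le_trans head; rewrite ler_wpM2r//; lra.
rewrite kt qt [leLHS]mulrA in F.
by rewrite -(ler_pM2r (_ : 0 < expR (lam * (e y - e x)) / M ^+ n.+1)) => //; pos.
Qed.
End Lower.

(** * Lower bound for a distant end point *)

(** The choices of y1 and x1 in [lower_steep] truncate x and y where the minimum in
    the bound saturates, so that x1 y1 / N is still of order min(1, x y / N). *)
Lemma steep_arith (R : realType) (c2 eta N X Y X1 y1 m : R) :
  0 < c2 -> 0 < eta -> 0 < N -> 1 <= X -> 0 < Y -> 0 < y1 ->
  8 * N <= y1 ^+ 2 -> y1 = Num.min Y (eta * N) ->
  m = Num.min (y1 / 4) (4 * c2 * N / y1) -> Num.min X (m / 2) <= X1 ->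
  Num.min 1 (Num.min eta (2 * c2)) / (16 * c2) * Num.min 1 (X * Y / N) <= X1 * y1 / (16 * c2 * N).
Proof.
move=> c20 eta0 N0 X1_ Y0 y10 y1N y1E mE X1E.
set c := Num.min 1 _.
have c_1 : c <= 1 by rewrite ge_min lexx.
have c_e : c <= eta by rewrite !ge_min lexx orbT.
have c_c : c <= 2 * c2 by rewrite !ge_min lexx !orbT.
have c0 : 0 < c by rewrite !lt_min ltr01 eta0 mulr_gt0.
set t := Num.min 1 (X * Y / N).
have t1 : t <= 1 by rewrite ge_min lexx.
have tXY : t <= X * Y / N by rewrite ge_min lexx orbT.
have t0 : 0 <= t by rewrite le_min ler01 !mulr_ge0 ?invr_ge0 ?ltW// (lt_le_trans ltr01).
suff : c * t * N <= X1 * y1.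
  move=> h; have -> : c / (16 * c2) * t = (c * t * N) / (16 * c2 * N) by field; rewrite !gt_eqF.
  by rewrite ler_wpM2r// invr_ge0 !mulr_ge0// ltW.
have ctc : c * t <= c by rewrite ler_piMr// ltW.
have X1y : Num.min X (m / 2) * y1 <= X1 * y1 by rewrite ler_wpM2r// ltW.
apply: le_trans X1y.
have [_|_] := leP X (m / 2).
  have [E|E] := leP Y (eta * N).
    have -> : y1 = Y by rewrite y1E min_l.
    apply: (@le_trans _ _ (t * N)); first by rewrite ler_wpM2r ?(ltW N0)// ler_piMl.
    by rewrite -ler_pdivlMr.
  have -> : y1 = eta * N by rewrite y1E min_r// ltW.
  rewrite mulrA ler_wpM2r ?(ltW N0)//; apply: (le_trans ctc); apply: (le_trans c_e).
  by rewrite ler_peMl// ltW.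
have [E|E] := leP (y1 / 4) (4 * c2 * N / y1).
  have -> : m = y1 / 4 by rewrite mE min_l.
  have : c * t * N <= 1 * N by rewrite ler_wpM2r ?(ltW N0)// (le_trans ctc).
  by rewrite expr2 in y1N; lra.
have -> : m = 4 * c2 * N / y1 by rewrite mE min_r// ltW.
have -> : 4 * c2 * N / y1 / 2 * y1 = 2 * c2 * N by field; rewrite gt_eqF.
by rewrite ler_wpM2r ?(ltW N0)// (le_trans ctc).
Qed.

Section Lower2.
Context d (T : measurableType d) (R : realType).
Variable nu : {sigma_finite_measure set T -> \bar R}.
Variables (e : T -> R) (add : T -> T -> T) (opp : T -> T).
Hypothesis S : state_space nu e add opp.
Let em := emb_meas S.
Let K1 := no_killing T R.
Local Notation walk := (walk nu e add).
Local Notation k p := (kern nu p (fun=> 1)).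
Local Notation sq := (sq R).
Local Notation chi := (chi e).
Local Notation q p := (kern nu p chi).
Let Kc := chi_killing S.

(** Rounding m to a state costs at most 1, hence at most half of m. *)
Lemma start_below (x : T) (m : R) : 1 <= e x -> 2 <= m ->
  exists x1, [/\ 1 <= e x1, e x1 <= e x, e x1 <= m & Num.min (e x) (m / 2) <= e x1].
Proof.
move=> x1 m2; have [xm|mx] := leP (e x) m.
  by exists x; split=> //; rewrite ge_min lexx.
have [t /andP[t1 t2]] := emb_floor S m.
exists t; split=> //; [lra|lra|].
rewrite ge_min; apply/orP; right; lra.
Qed.

Variables lam0 c1 c2 v0 v1 C0 : R.
Local Notation fam := (tilted_family nu e add lam0 c1 c2 v0 v1 C0).
Hypotheses (lam0_gt0 : 0 < lam0) (lam0_le : lam0 <= 1 / 2) (c1_gt0 : 0 < c1) (c12 : c1 <= c2)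
  (v0_gt0 : 0 < v0) (v01 : v0 <= v1) (C0_ge0 : 0 <= C0).

(** Apply [lower_core] with lam = y1 / (4 c2 n), for which the drift over n steps is at
    most y1 / 4, where y1 is y truncated at eta n so that lam <= lam0; x1 is x truncated so
    that x1 <= y1 / 4 and lam x1 <= 1. The survival probability is then at least
    lam x1 / 2, of order x1 y1 / n, while the part removed has order x1 / y1; it is
    smaller if y1^2 >= B n, which is ensured by the choice of K and N. *)
Lemma lower_steep : exists K c : R, exists N, [/\ 1 <= K, 0 < c &
  forall p, fam p -> fam (rev p) -> forall x y n, 1 <= e x -> K * sq n <= e y -> (N <= n)%N ->
  c * Num.min 1 (e x * e y / n.+1%:R) * k p n x y <= q p n x y].
Proof.
have l0 := lam0_gt0; have c1p := c1_gt0; have c12' := c12; have l1 := lam0_le.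
have c2p : 0 < c2 by lra.
have v1p : 0 < v1 := lt_le_trans v0_gt0 v01.
have [Cu [Cu0 HU]] := kern_upper S lam0_gt0 c1_gt0 c12 v0_gt0 v01 C0_ge0.
have [eta etaE] : exists eta, eta = 4 * c2 * lam0 by exists (4 * c2 * lam0).
have eta0 : 0 < eta by rewrite etaE; pos.
have [B BE] : exists B, B = 16 * (16 * c2 * Cu * v1) by exists (16 * (16 * c2 * Cu * v1)).
have B0 : 0 < B by rewrite BE; pos.
have [N hN] := sq_large ((B + 8) / eta).
(* B absorbs the error term; 8 gives y1 >= 8 and y1^2 >= 8 N'. *)
exists (B + 8), (Num.min 1 (Num.min eta (2 * c2)) / (16 * c2)), N; split=> //; first by lra.
  by apply: divr_gt0; [rewrite !lt_min ltr01 eta0 mulr_gt0|pos].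
move=> p Fp Fr x y n x1 yK Nn.
have sn := sq_gt0 R n; have sn1 := sq_ge1 R n.
have [N' N'E] : exists N' : R, N' = n.+1%:R by exists n.+1%:R.
have N'0 : 0 < N' by rewrite N'E ltr0n.
have sE : sq n ^+ 2 = N' by rewrite N'E sqr_sq.
have [y1 y1E] : exists y1, y1 = Num.min (e y) (eta * N') by exists (Num.min (e y) (eta * N')).
have y1y : y1 <= e y by rewrite y1E ge_min lexx.
have y1eta : y1 <= eta * N' by rewrite y1E ge_min lexx orbT.
have y1K : (B + 8) * sq n <= y1.
  rewrite y1E le_min yK/= -sE expr2 mulrA ler_wpM2r ?(ltW sn)//.
  by rewrite mulrC -ler_pdivrMr// hN.
have y18 : 8 <= y1.
  apply: le_trans y1K; rewrite -[leLHS]mulr1; apply: ler_pM => //; lra.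
have y10 : 0 < y1 by lra.
have y1sq : (B + 8) ^+ 2 * N' <= y1 ^+ 2.
  rewrite -sE -exprMn ler_pXn2r ?nnegrE ?(ltW y10)//.
  by rewrite mulr_ge0 ?(ltW sn)//; lra.
have y1B : B * N' <= y1 ^+ 2.
  apply: le_trans y1sq; rewrite ler_wpM2r ?(ltW N'0)//; nra.
have y1N8 : 8 * N' <= y1 ^+ 2.
  apply: le_trans y1sq; rewrite ler_wpM2r ?(ltW N'0)//; nra.
have [m mE] : exists m, m = Num.min (y1 / 4) (4 * c2 * N' / y1) by exists (Num.min (y1 / 4) (4 * c2 * N' / y1)).
have m2 : 2 <= m.
  rewrite mE le_min; apply/andP; split; first by lra.
  rewrite ler_pdivlMr//; have : 2 * y1 <= 2 * (eta * N') by lra.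
  rewrite etaE => h; apply: (le_trans h).
  have -> : 2 * (4 * c2 * lam0 * N') = (4 * c2 * N') * (2 * lam0) by ring.
  rewrite ler_piMr//; [by nn|by lra].
have [x1' [x11 x1x x1m x1X]] := start_below x1 m2.
have x1y4 : e x1' <= y1 / 4 by apply: (le_trans x1m); rewrite mE ge_min lexx.
have x1y : e x1' * y1 <= 4 * c2 * N'.
  by rewrite -ler_pdivlMr// (le_trans x1m)// mE ge_min lexx orbT.
have [lam lamE] : exists lam, lam = y1 / (4 * c2 * N') by exists (y1 / (4 * c2 * N')).
have lam_0 : 0 < lam by rewrite lamE; pos.
have lam_l : lam <= lam0.
  by rewrite lamE ler_pdivrMr ?mulr_gt0//; rewrite etaE in y1eta; lra.
have [|M [b [v [M1 /andP[b1 b2] /andP[v0v vv1] W O]]]] := fam_tilt Fp (lam := lam).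
  by rewrite lam_l ltW.
have [v' _ W0] := fam_base Fp; have P := walk_ds W0.
have bN : N' * b <= y1 / 4.
  rewrite mulrC -ler_pdivlMr// (le_trans b2)// le_eqVlt; apply/orP; left; apply/eqP.
  by rewrite lamE; field; rewrite !gt_eqF.
have vv : 0 <= v <= v1 by rewrite vv1 (le_trans (ltW v0_gt0)).
have x10 : 0 <= e x1' by lra.
have y11 : 1 <= y1 by lra.
have D0 : 0 <= Cu * (e x1' + 1) by apply: mulr_ge0; [exact: ltW|lra].
have core := lower_core (x := x) (y := y) S P W (ltW lam_0) M1 vv (y1 := y1) (x1 := x1') (D := Cu * (e x1' + 1)) (n := n).
have {}core := core y11 x10 D0 x1x y1y.
have {}core : (1 - expR (- (lam * e x1')) - 8 * (Cu * (e x1' + 1)) * v1 / y1) * k p n x y <= q p n x y.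
  apply: core; first by rewrite -N'E; lra.
  move=> z z0; apply: (le_trans (HU p Fp Fr x1' z n x10 z0)).
  by rewrite !mulrA.
have k0 := kern_ge0 P K1 n x y.
apply: le_trans core; apply: ler_wpM2r => //.
have ar := @steep_arith _ c2 eta N' (e x) (e y) (e x1') y1 m c2p eta0 N'0 x1 (lt_le_trans y10 y1y) y10 y1N8 y1E mE x1X.
rewrite -N'E; apply: (le_trans ar).
have main : lam * e x1' / 2 <= 1 - expR (- (lam * e x1')).
  have : 0 <= lam * e x1' <= 1.
    rewrite mulr_ge0 ?(ltW lam_0)//= lamE mulrAC ler_pdivrMr ?mul1r 1?mulrC//.
    by rewrite mulrC; pos.
  by move/expRN_upper; lra.
have main2 : lam * e x1' / 2 = 2 * (e x1' * y1 / (16 * c2 * N')).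
  by rewrite lamE; field; rewrite !gt_eqF.
suff err : 8 * (Cu * (e x1' + 1)) * v1 / y1 <= e x1' * y1 / (16 * c2 * N') by lra.
rewrite ler_pdivrMr// [leRHS]mulrAC ler_pdivlMr ?mulr_gt0//.
have -> : e x1' * y1 * y1 = e x1' * y1 ^+ 2 by rewrite expr2 mulrA.
apply: le_trans (ler_wpM2l x10 y1B).
have -> : 8 * (Cu * (e x1' + 1)) * v1 * (16 * c2 * N') = (8 * (16 * c2 * Cu * v1 * N')) * (e x1' + 1) by ring.
have -> : e x1' * (B * N') = (8 * (16 * c2 * Cu * v1 * N')) * (2 * e x1') by rewrite BE; ring.
by apply: ler_wpM2l; [nn|lra].
Qed.
End Lower2.

(** * Position at an intermediate time *)

Section Mid.
Context d (T : measurableType d) (R : realType).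
Variable nu : {sigma_finite_measure set T -> \bar R}.
Variables (e : T -> R) (add : T -> T -> T) (opp : T -> T).
Hypothesis S : state_space nu e add opp.
Let em := emb_meas S.
Let K1 := no_killing T R.
Local Notation walk := (walk nu e add).
Local Notation k p := (kern nu p (fun=> 1)).
Local Notation sq := (sq R).
Local Notation chi := (chi e).
Local Notation q p := (kern nu p chi).
Let Kc := chi_killing S.
Variable o : T.
Hypothesis o0 : e o = 0.

Lemma itg_window (f : T -> R) s (L c : R) : measurable_fun setT f -> (forall t, 0 <= f t) ->
  0 <= L -> 0 <= c -> (forall t, e s <= e t <= e s + L -> c <= f t) -> ((c * L)%:E <= itg nu f)%E.
Proof.
move=> mf f0 L0 c0 H.
have mW : measurable_fun setT (fun t => e s <= e t <= e s + L) by mbool.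
apply: (@le_trans _ _ (itg nu (fun t => c * ind R (fun t => e s <= e t <= e s + L) t))).
  rewrite itgZ//; try exact: measurable_ind; try exact: ind_ge0.
  by rewrite itg_ind// (EFinM c); apply: lee_wpmul2l; [rewrite lee_fin|exact: (window_ge S s L0)].
have mi := measurable_ind (R := R) mW.
apply: le_itg => [||t|t]; [by mfun|exact: mf|by rewrite mulr_ge0 ?ind_ge0|].
by rewrite /ind; case Wt : (_ <= _ <= _); rewrite ?mulr1 ?mulr0// H.
Qed.

(** The position of the bridge at an intermediate time increases stochastically with
    its end points; here the bridge from x to y is compared with the one from 0 to 0. *)
Lemma midpoint_mono p j m x y (h : R) : doubly_stochastic nu p -> tp2 e p ->
  0 <= e x -> 0 <= e y ->
  ((k p (j + m).+1 x y)%:E * itg nu (fun t => ind R (fun t => h <= e t) t * (k p j o t * k p m t o))%R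
   <= itg nu (fun t => ind R (fun t => h <= e t) t * (k p j x t * k p m t y))%R * (k p (j + m).+1 o o)%:E)%E.
Proof.
move=> P TP x0 y0.
have k0 i s t : 0 <= k p i s t by exact: kern_ge0.
have mi : measurable_fun setT (ind R (fun t => h <= e t)) by apply: measurable_ind; mbool.
have i0 t : 0 <= ind R (fun t => h <= e t) t by exact: ind_ge0.
have mr i s := kern_row P K1 i s; have mc i s := kern_col P K1 i s.
have mrx := mr j x; have mro := mr j o; have mcy := mc m y; have mco := mc m o.
rewrite muleC !(kern_CK P K1).
apply: (@four_functions _ _ _ nu e); try (by mfun); try (by nn).
move=> s t; rewrite !mulr1.
have xo : mx e o x = x by rewrite /mx o0 x0.
have xo' : mn e o x = o by rewrite /mn o0 x0.
have yo : mx e o y = y by rewrite /mx o0 y0.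
have yo' : mn e o y = o by rewrite /mn o0 y0.
have H1 := kern_holley P TP K1 (fun _ _ _ => lexx _) j o x s t.
have H2 := kern_holley P TP K1 (fun _ _ _ => lexx _) m s t o y.
rewrite xo xo' in H1; rewrite yo yo' in H2.
set a := ind _ _ _; set b := ind _ _ (mx e s t).
have ab : a <= b.
  rewrite /a /b /ind emb_mx; have [hs|_] := leP h (e s); last exact: ler0n.
  by rewrite le_max hs.
have -> : a * (k p j o s * k p m s o) * (k p j x t * k p m t y) =
  a * ((k p j o s * k p j x t) * (k p m s o * k p m t y)) by ring.
have -> : b * (k p j x (mx e s t) * k p m (mx e s t) y) * (k p j o (mn e s t) * k p m (mn e s t) o) =
  b * ((k p j x (mx e s t) * k p j o (mn e s t)) * (k p m (mx e s t) y * k p m (mn e s t) o)) by ring.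
apply: ler_pM; [exact: i0|by nn|exact: ab|].
by apply: ler_pM => //; nn.
Qed.

(** The return probability p_n(0, 0) is at most [supc] / sqrt n, so a lower bound of
    order 1 / sqrt n on the numerator for the bridge from 0 to 0 suffices. *)
Lemma midpoint_lower p v v0 j m x y (h c : R) : 0 < v0 -> v0 <= v -> walk p 0 v ->
  0 <= e x -> 0 <= e y -> 0 <= c ->
  ((c / sq (j + m).+1)%:E <= itg nu (fun t => ind R (fun t => h <= e t) t * (k p j o t * k p m t o))%R)%E ->
  ((c / supc v0 * k p (j + m).+1 x y)%:E <= itg nu (fun t => ind R (fun t => h <= e t) t * (k p j x t * k p m t y))%R)%E.
Proof.
move=> v00 v0v W x0 y0 c0 H; have P := walk_ds W.
have F0 := supc_gt0 v00; set n := (j + m).+1 in H *.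
have sn := sq_gt0 R n.
have k0 i s t : 0 <= k p i s t by exact: kern_ge0.
have := midpoint_mono j m h P (walk_tp2 W) x0 y0; rewrite -/n.
set I := itg nu _ => M.
set J := itg nu _ in M *.
have J0 : (0 <= J)%E by apply: itg_ge0 => t; rewrite !mulr_ge0 ?ind_ge0.
have up : ((k p n x y)%:E * (c / sq n)%:E <= J * (supc v0 / sq n)%:E)%E.
  apply: (@le_trans _ _ ((k p n x y)%:E * I)%E); first by apply: lee_wpmul2l; [rewrite lee_fin|exact: H].
  apply: (le_trans M); apply: lee_wpmul2l => //.
  by rewrite lee_fin (kern_sup S v00 _ _ _ W v0v).
have : J = +oo%E \/ exists r, J = r%:E.
  by case: (J) J0 => [r _|_|//]; [right; exists r|left].
case=> [->|[r JE]]; first by rewrite leey.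
rewrite JE -!EFinM lee_fin in up; rewrite JE lee_fin.
move: up; rewrite (mulrA (k p n x y)) (mulrA r) ler_pM2r ?invr_gt0// => up.
by rewrite mulrAC ler_pdivrMr// mulrC.
Qed.

Section Positivity.
Variables (p : T -> T -> R) (v v0 : R).
Hypotheses (W : walk p 0 v) (v0_gt0 : 0 < v0) (v0v : v0 <= v).
Let P := walk_ds W.

(** Otherwise, as the mean is 0, the increments would vanish and so would the
    variance. *)
Lemma abs_moment_pos : itg nu (fun t => p o t * Num.max (e t) 0) = 0%E -> False.
Proof.
move=> pos0.
have vv : 0 <= v := le_trans (ltW v0_gt0) v0v.
have p0 := ds_ge0 P; have pm := ds_meas P.
have devE t : dev e 0 0 o t = e t by rewrite /dev o0 mulr0 !subr0.
have mpos : measurable_fun setT (fun z => Num.max (e z) 0) by exact: measurable_maxr.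
have mneg : measurable_fun setT (fun z => Num.max (- e z) 0).
  by apply: measurable_maxr => //; exact: measurableT_comp.
have neg0 : itg nu (fun t => p o t * Num.max (- e t) 0) = 0%E.
  rewrite -pos0; have := itg_dev_pos_neg S W vv 0 o => /esym.
  have -> : (fun z => k p 0 o z * Num.max (- dev e 0 0 o z) 0) = (fun t => p o t * Num.max (- e t) 0).
    by apply/funext => t; rewrite devE.
  have -> // : (fun z => k p 0 o z * Num.max (dev e 0 0 o z) 0) = (fun t => p o t * Num.max (e t) 0).
  by apply/funext => t; rewrite devE.
have pos1 t : 0 <= Num.max (e t) 0 by rewrite le_max lexx orbT.
have neg1 t : 0 <= Num.max (- e t) 0 by rewrite le_max lexx orbT.
have sq0 : itg nu (fun t => p o t * e t ^+ 2) = 0%E.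
  apply: (@itg_eq0_support _ _ _ nu (fun t => p o t * Num.max (e t) 0 + p o t * Num.max (- e t) 0));
    try (by mfun); try (by nn).
    move=> t; rewrite -mulrDr => /eqP; rewrite mulf_eq0 => /predU1P[->|/eqP h]; first by rewrite mul0r.
    have -> : e t = 0; last by rewrite expr0n mulr0.
    have h1 : e t <= Num.max (e t) 0 by rewrite le_max lexx.
    have h2 : - e t <= Num.max (- e t) 0 by rewrite le_max lexx.
    by have := pos1 t; have := neg1 t; lra.
  by rewrite itgD ?pos0 ?neg0 ?adde0//; try (by mfun); try (by nn).
have : itg nu (fun t => p o t * e t ^+ 2) = v%:E.
  have := itg_dev2 S W vv 0 o; rewrite mul1r => <-.
  by apply: eq_itg => t; rewrite devE.
by rewrite sq0 => -[v00]; have := v0_gt0; have := v0v; lra.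
Qed.
End Positivity.
End Mid.

(** * Positivity at small times and far from the diagonal *)

Section Final.
Context d (T : measurableType d) (R : realType).
Variable nu : {sigma_finite_measure set T -> \bar R}.
Variables (e : T -> R) (add : T -> T -> T) (opp : T -> T).
Hypothesis S : state_space nu e add opp.
Let em := emb_meas S.
Let K1 := no_killing T R.
Local Notation walk := (walk nu e add).
Local Notation k p := (kern nu p (fun=> 1)).
Local Notation sq := (sq R).
Local Notation chi := (chi e).
Local Notation q p := (kern nu p chi).
Let Kc := chi_killing S.

Variable o : T.
Hypothesis o0 : e o = 0.

Lemma addo t : add o t = t.
Proof. by apply: (emb_inj S); rewrite (embD S) o0 add0r. Qed.

Section SmallTimes.
Variables (p : T -> T -> R) (v v0 : R).
Hypotheses (W : walk p 0 v) (v0_gt0 : 0 < v0) (v0v : v0 <= v).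
Let P := walk_ds W.

Lemma positive_jumps : exists s t, [/\ e s < 0, 0 < e t, 0 < p o s & 0 < p o t].
Proof.
have vv : 0 <= v := le_trans (ltW v0_gt0) v0v.
have p0 := ds_ge0 P.
have NP := abs_moment_pos S o0 W v0_gt0 v0v.
have devE t : dev e 0 0 o t = e t by rewrite /dev o0 mulr0 !subr0.
have [t t0 pt] : exists2 t, 0 < e t & 0 < p o t.
  apply: contrapT => H; apply: NP; rewrite -(itg0 nu); apply: eq_itg => t.
  have [h|h] := leP (e t) 0; first by rewrite mulr0.
  have -> : p o t = 0; last by rewrite mul0r.
  apply/eqP; rewrite eq_le p0 andbT leNgt; apply/negP => pt; apply: H; by exists t.
have [s s0 ps] : exists2 s, e s < 0 & 0 < p o s.
  apply: contrapT => H; apply: NP; rewrite -(itg0 nu).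
  have := itg_dev_pos_neg S W vv 0 o.
  have -> : (fun z => k p 0 o z * Num.max (dev e 0 0 o z) 0) = (fun t => p o t * Num.max (e t) 0).
    by apply/funext => z; rewrite devE.
  move=> ->; apply: eq_itg => z; rewrite devE /=.
  have [h|h] := leP (- e z) 0; first by rewrite mulr0.
  have -> : p o z = 0; last by rewrite mul0r.
  apply/eqP; rewrite eq_le p0 andbT leNgt; apply/negP => pz; apply: H; exists z => //.
  by rewrite -oppr_gt0.
by exists s, t.
Qed.

(** Some jumps of both signs have positive density, and log-concavity fills the
    interval between them. *)
Lemma local_positivity : exists h m : R, [/\ 0 < h, 0 < m &
  forall s t, `|e t - e s| <= h -> m <= p s t].
Proof.
have [a [b [a0 b0 pa pb]]] := positive_jumps.
have F0 := supc_gt0 v0_gt0.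
exists (Num.min (e b) (- e a)), (p o a * p o b / supc v0); split.
- by rewrite lt_min b0 oppr_gt0.
- by pos.
move=> s t; rewrite le_min => /andP[tb ta].
move: tb ta; rewrite !ler_norml => /andP[tb1 tb2] /andP[ta1 ta2].
pose u := add t (opp s); have eu : e u = e t - e s by rewrite /u (embD S) (embN S).
have -> : p s t = p o u.
  rewrite -(walk_shift W s o u) addo; congr p; apply: (emb_inj S).
  by rewrite (embD S) eu; ring.
pose h := add u (opp a); have eh : e h = e u - e a by rewrite /h (embD S) (embN S).
have ah : add a h = u by apply: (emb_inj S); rewrite (embD S) eh; ring.
pose w := add b (opp h); have ew : e w = e b - e h by rewrite /w (embD S) (embN S).
have wh : add w h = b by apply: (emb_inj S); rewrite (embD S) ew; ring.
have := walk_log_concave S 0 o W (s0 := a) (s := w) (h := h).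
rewrite wh ah /= => /(_ _) H.
have {}H : p o b * p o a <= p o u * p o w.
  by apply: H; apply: mulr_ge0; rewrite ?ew ?eh ?eu; lra.
have wF : p o w <= supc v0.
  have := kern_sup S v0_gt0 0 o w W v0v; rewrite /= => h1; apply: (le_trans h1).
  by rewrite ler_pdivrMr ?sq_gt0// ler_peMr ?sq_ge1// ltW.
rewrite ler_pdivrMr// mulrC (le_trans H)// ler_wpM2l//; exact: (ds_ge0 P).
Qed.

(** Keep the whole path in the window [0, h] of [local_positivity]. *)
Lemma killed_return n : exists2 c : R, 0 < c & c <= q p n o o.
Proof.
have [h [m [h0 m0 H]]] := local_positivity.
have p0 := ds_ge0 P; have pm := ds_meas P.
have c0 := chi_ge0 e; have cm := measurable_chi S.
suff [c cp Hc] : exists2 c : R, 0 < c & forall s, 0 <= e s <= h -> c <= q p n s o.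
  by exists c => //; apply: Hc; rewrite o0 lexx ltW.
elim: n => [|n [c cp Hc]].
  exists m => // s /andP[s0 sh]; apply: H; rewrite o0 sub0r normrN ger0_norm//.
exists (m * c * h); first by pos.
move=> s /andP[s0 sh]; rewrite -lee_fin (kernSE P Kc).
have mk := kern_col P Kc n o; have q0 t := kern_ge0 P Kc n t o.
apply: (itg_window S (s := o)); [by mfun|by nn|exact: ltW|by nn|].
move=> t; rewrite o0 add0r => /andP[t0 th].
rewrite (chi1 t0) mulr1; apply: ler_pM; [exact: ltW|exact: ltW| |].
  by apply: H; rewrite ler_norml; apply/andP; split; lra.
by apply: Hc; rewrite t0.
Qed.

(** By monotonicity the ratio q / p is smallest at (0, 0). *)
Lemma small_time n : exists2 c : R, 0 < c &
  forall x y, 0 <= e x -> 0 <= e y -> c * k p n x y <= q p n x y.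
Proof.
have [c c0 Hc] := killed_return n.
have F0 := supc_gt0 v0_gt0; have sn := sq_gt0 R n.
exists (c / (supc v0 / sq n)); first by pos.
move=> x y x0 y0.
have := kern_holley P (walk_tp2 W) Kc (chi_mono (e := e)) n o x o y.
rewrite /mx /mn o0 x0 y0 => H.
have k0 s t : 0 <= k p n s t by exact: kern_ge0.
have q0 : 0 <= q p n x y by exact: kern_ge0.
rewrite mulrAC (ler_pdivrMr _ _ (divr_gt0 F0 sn)).
apply: (@le_trans _ _ (q p n o o * k p n x y)); first by rewrite ler_wpM2r.
by apply: (le_trans H); rewrite ler_wpM2l// (kern_sup S v0_gt0 _ _ _ W v0v).
Qed.

Lemma small_times N : exists2 c : R, 0 < c & forall n, (n <= N)%N ->
  forall x y, 0 <= e x -> 0 <= e y -> c * k p n x y <= q p n x y.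
Proof.
elim: N => [|N [c c0 IH]].
  by have [c c0 H] := small_time 0; exists c => // n; rewrite leqn0 => /eqP ->.
have [c' c'0 H] := small_time N.+1.
exists (Num.min c c'); first by rewrite lt_min c0 c'0.
move=> n; rewrite leq_eqVlt => /predU1P[->|nN] x y x0 y0.
  apply: le_trans (H x y x0 y0); rewrite ler_wpM2r ?(kern_ge0 P K1)//.
  by rewrite ge_min lexx orbT.
apply: le_trans (IH n nN x y x0 y0); rewrite ler_wpM2r ?(kern_ge0 P K1)//.
by rewrite ge_min lexx.
Qed.
End SmallTimes.

Variables lam0 c1 c2 v0 v1 C0 : R.
Local Notation fam := (tilted_family nu e add lam0 c1 c2 v0 v1 C0).
Hypotheses (lam0_gt0 : 0 < lam0) (lam0_le : lam0 <= 1 / 2) (c1_gt0 : 0 < c1) (c12 : c1 <= c2)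
  (v0_gt0 : 0 < v0) (v01 : v0 <= v1) (C0_ge0 : 0 <= C0).

(** Tilt by B / sqrt n, so that the mean after n steps lies beyond K sqrt n. The tilted
    density at the mean is at least c / sqrt n, and removing the tilt costs a constant
    factor. Log-concavity extends the bound to all points between 0 and this mean. *)
Lemma far_bound (K : R) : 0 < K -> exists c : R, exists N, 0 < c /\
  forall p, fam p -> forall n t, (N <= n)%N -> 0 <= e t <= K * sq n -> c / sq n <= k p n o t.
Proof.
move=> K0.
have c1p := c1_gt0; have c12' := c12; have F0 := supc_gt0 v0_gt0.
have [a [c [N [a0 c0 Hc]]]] := center_bound S v0_gt0 v01.
have [B BE] : exists B, B = (K + 1) / c1 by exists ((K + 1) / c1).
have B0 : 0 < B by rewrite BE; apply: divr_gt0; lra.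
have [N1 hN1] := sq_large (Num.max (B / lam0) a^-1).
exists (c ^+ 2 * expR (- (c2 * B ^+ 2)) / supc v0), (maxn N N1); split; first by pos.
move=> p Fp n t; rewrite geq_max => /andP[Nn N1n] /andP[t0 tK].
have := hN1 n N1n; rewrite ge_max => /andP[sB sa].
have sn := sq_gt0 R n; have sn1 := sq_ge1 R n.
have {}sa : 1 <= a * sq n by rewrite -ler_pdivrMl// mulr1.
have [v /andP[v0v vv1] W] := fam_base Fp; have P := walk_ds W.
have k0 s u : 0 <= k p n s u by exact: kern_ge0.
have koo : c / sq n <= k p n o o.
  apply: (Hc p 0 v n o o W) => //; first by rewrite v0v.
  by rewrite /dev mulr0 !subr0 subrr normr0 mulr_ge0 ?(ltW a0) ?(ltW sn).
have [lam lamE] : exists lam, lam = B / sq n by exists (B / sq n).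
have lam_0 : 0 < lam by rewrite lamE divr_gt0.
have lam_1 : lam <= lam0.
  by rewrite lamE ler_pdivrMr// mulrC -ler_pdivrMr.
have [|M [b [w [M1 /andP[b1 b2] /andP[v0w wv1] Wl _]]]] := fam_tilt Fp (lam := lam).
  by rewrite lam_1 ltW.
have M0 : 0 < M := lt_le_trans ltr01 M1.
have [N' N'E] : exists N' : R, N' = n.+1%:R by exists n.+1%:R.
have sE : sq n * sq n = N' by rewrite -expr2 sqr_sq.
have N'0 : 0 < N' by rewrite -sE mulr_gt0.
have bN1 : (K + 1) * sq n <= N' * b.
  have -> : (K + 1) * sq n = N' * (c1 * lam).
    by rewrite lamE BE -sE; field; rewrite !gt_eqF.
  by rewrite ler_wpM2l// ltW.
have bN2 : lam * (N' * b) <= c2 * B ^+ 2.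
  have -> : c2 * B ^+ 2 = lam * (N' * (c2 * lam)).
    by rewrite lamE -sE; field; rewrite gt_eqF.
  by rewrite ler_wpM2l ?(ltW lam_0)// ler_wpM2l// ltW.
have [z /andP[z1 z2]] := emb_floor S (N' * b).
have zK : K * sq n <= e z by lra.
have kz : c / sq n * expR (- (c2 * B ^+ 2)) <= k p n o z.
  have := Hc _ b w n o z Wl; rewrite v0w wv1 /dev o0 subr0 -N'E => /(_ isT Nn) h.
  have {}h : c / sq n <= k (tilt e lam M p) n o z.
    by apply: h; rewrite ler_norml; apply/andP; split; lra.
  rewrite (kern_tilt P K1 M0 (walk_ds Wl)) o0 subr0 in h.
  have hM : 1 <= M ^+ n.+1 by apply: exprn_ege1.
  have hM0 : 0 < M ^+ n.+1 by apply: exprn_gt0.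
  have : c / sq n <= k p n o z * expR (c2 * B ^+ 2).
    apply: (le_trans h); rewrite ler_wpM2l//.
    apply: (@le_trans _ _ (expR (lam * e z))).
      by rewrite ler_pdivrMr// ler_peMr// expR_ge0.
    rewrite ler_expR; apply: le_trans bN2; rewrite ler_wpM2l//; exact: ltW.
  by move=> h2; rewrite expRN (ler_pdivrMr _ _ (expR_gt0 _)).
pose u := add z (opp t); have eu : e u = e z - e t by rewrite /u (embD S) (embN S).
have ut : add u t = z by apply: (emb_inj S); rewrite (embD S) eu; ring.
have := walk_log_concave S n o W (s0 := o) (s := u) (h := t).
rewrite ut addo => /(_ _) H.
have {}H : k p n o z * k p n o o <= k p n o t * k p n o u.
  by apply: H; rewrite o0 eu; apply: mulr_ge0; lra.
have uF := kern_sup S v0_gt0 n o u W v0v.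
have lo : (c / sq n * expR (- (c2 * B ^+ 2))) * (c / sq n) <= k p n o t * (supc v0 / sq n).
  apply: (@le_trans _ _ (k p n o z * k p n o o)).
    apply: ler_pM kz koo; last by nn.
    by apply: mulr_ge0; [nn|exact: expR_ge0].
  by apply: (le_trans H); rewrite ler_wpM2l.
have Fs : 0 < supc v0 / sq n := divr_gt0 F0 sn.
move: lo; rewrite -(ler_pdivrMr _ _ Fs); apply: le_trans.
rewrite le_eqVlt; apply/orP; left; apply/eqP; field.
by rewrite !gt_eqF.
Qed.
End Final.

(** * Lower bound on the killed kernel *)

Lemma le_sq (R : realType) m n : (m <= n)%N -> sq R m <= sq R n.
Proof. by move=> mn; rewrite ler_sqrt ?ltr0Sn// ler_nat. Qed.

Lemma min1_mono (R : realType) (a b : R) : a <= b -> Num.min 1 a <= Num.min 1 b.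
Proof. by move=> ab; rewrite le_min !ge_min lexx ab orbT. Qed.

Lemma min1_ge0 (R : realType) (a : R) : 0 <= a -> 0 <= Num.min 1 a.
Proof. by move=> a0; rewrite le_min ler01. Qed.

Section FinalLower.
Context d (T : measurableType d) (R : realType).
Variable nu : {sigma_finite_measure set T -> \bar R}.
Variables (e : T -> R) (add : T -> T -> T) (opp : T -> T).
Hypothesis S : state_space nu e add opp.
Let em := emb_meas S.
Let K1 := no_killing T R.
Local Notation walk := (walk nu e add).
Local Notation k p := (kern nu p (fun=> 1)).
Local Notation sq := (sq R).
Local Notation chi := (chi e).
Local Notation q p := (kern nu p chi).
Let Kc := chi_killing S.
Variable o : T.
Hypothesis o0 : e o = 0.

Variables lam0 c1 c2 v0 v1 C0 : R.
Local Notation fam := (tilted_family nu e add lam0 c1 c2 v0 v1 C0).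
Hypotheses (lam0_gt0 : 0 < lam0) (lam0_le : lam0 <= 1 / 2) (c1_gt0 : 0 < c1) (c12 : c1 <= c2)
  (v0_gt0 : 0 < v0) (v01 : v0 <= v1) (C0_ge0 : 0 <= C0).

Lemma numerator_window p j m (s : T) (h L c c' : R) : doubly_stochastic nu p ->
  0 <= L -> 0 <= c -> 0 <= c' -> h <= e s ->
  (forall t, e s <= e t <= e s + L -> c <= k p j o t /\ c' <= k (rev p) m o t) ->
  ((c * c' * L)%:E <= itg nu (fun t => ind R (fun t => h <= e t) t * (k p j o t * k p m t o))%R)%E.
Proof.
move=> P L0 c0 c'0 hs H.
have k0 i a b : 0 <= k p i a b by exact: kern_ge0.
have mr := kern_row P K1 j o; have mc := kern_col P K1 m o.
have mi : measurable_fun setT (ind R (fun t => h <= e t)) by apply: measurable_ind; mbool.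
apply: (itg_window S (s := s)) => //.
- by mfun.
- by move=> t; rewrite !mulr_ge0 ?ind_ge0.
- by rewrite mulr_ge0.
move=> t /[dup] /H [h1 h2] /andP[t1 t2].
rewrite /ind (le_trans hs t1) mul1r; apply: ler_pM => //.
by rewrite -(kern_rev _ _ _ P K1).
Qed.

(** Over a window of length sqrt n above K sqrt n, both factors have order 1 / sqrt n
    by [far_bound]. *)
Lemma middle_numerator (K : R) : 0 < K -> exists c : R, exists N, 0 < c /\
  forall p, fam p -> fam (rev p) -> forall j m, (N <= j)%N -> (N <= m)%N ->
  ((j + m).+2 <= 4 * j.+1)%N -> ((j + m).+2 <= 4 * m.+1)%N ->
  ((c / sq (j + m).+1)%:E <=
   itg nu (fun t => ind R (fun t => K * sq (j + m).+1 <= e t) t * (k p j o t * k p m t o))%R)%E.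
Proof.
move=> K0; have K'0 : 0 < 2 * (K + 2) by lra.
have [c [N [c0 H]]] := far_bound S o0 C0 lam0_gt0 c1_gt0 c12 v0_gt0 v01 K'0.
exists (c * c), N; split; first by pos.
move=> p Fp Fr j m Nj Nm jn mn; set n := (j + m).+1.
have sn := sq_gt0 R n; have sn1 := sq_ge1 R n.
have [v _ W] := fam_base Fp; have P := walk_ds W.
have [s /andP[s1 s2]] := emb_floor S (K * sq n + 1).
have frac i : (n.+1 <= 4 * i.+1)%N -> sq n <= 2 * sq i.
  by move=> h; apply: sq_frac => //; rewrite -natrX -natrM ler_nat.
have cs : 0 <= c / sq n by nn.
have part i : (i <= n)%N -> c / sq n <= c / sq i.
  by move=> h; rewrite ler_wpM2l ?(ltW c0)// lef_pV2 ?posrE ?sq_gt0// le_sq.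
have jn' : (j <= n)%N by rewrite /n -addnS leq_addr.
have mn' : (m <= n)%N by rewrite /n -addSn leq_addl.
have -> : c * c / sq n = c / sq n * (c / sq n) * sq n by field; rewrite gt_eqF.
apply: (numerator_window (s := s)) => //; [exact: ltW|lra|].
move=> t /andP[t1 t2].
have Ks : 0 < K * sq n by pos.
have t0 : 0 <= e t by lra.
have tK : e t <= (K + 2) * sq n by rewrite mulrDl; lra.
have far i : (n.+1 <= 4 * i.+1)%N -> e t <= 2 * (K + 2) * sq i.
  move=> /frac h; apply: (le_trans tK).
  by rewrite -[2 * _]mulrC -mulrA ler_wpM2l//; lra.
split.
- by apply: le_trans (H p Fp j t Nj _); [exact: part|rewrite t0 far].
- by apply: le_trans (H _ Fr m t Nm _); [exact: part|rewrite t0 far].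
Qed.

(** After a fixed number j of steps the walk from 0 is within the range of
    [center_bound] of a window above 1, and so is the remaining path. *)
Lemma start_numerator : exists j, exists c : R, exists N, 0 < c /\
  forall p, fam p -> fam (rev p) -> forall m, (N <= m)%N ->
  ((c / sq (j + m).+1)%:E <=
   itg nu (fun t => ind R (fun t => 1 <= e t) t * (k p j o t * k p m t o))%R)%E.
Proof.
have [a [c [N [a0 c0 Hc]]]] := center_bound S v0_gt0 v01.
have [N1 hN1] := sq_large (3 / a).
pose j := maxn N N1; have sj := sq_gt0 R j.
exists j, (c / sq j * c), j; split; first by pos.
move=> p Fp Fr m jm; set n := (j + m).+1.
have sn := sq_gt0 R n; have sm := sq_gt0 R m.
have [v /andP[v0v vv1] W] := fam_base Fp; have P := walk_ds W.
have [v' /andP[v0v' vv1'] W'] := fam_base Fr.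
have [s /andP[s1 s2]] := emb_floor S 2.
have Nj : (N <= j)%N by rewrite leq_maxl.
have big i : (j <= i)%N -> 3 <= a * sq i.
  move=> ji; rewrite -ler_pdivrMl// mulrC; apply: hN1.
  by rewrite (leq_trans _ ji)// leq_maxr.
have cj : 0 <= c / sq j by nn.
have cn : 0 <= c / sq n by nn.
have -> : c / sq j * c / sq n = c / sq j * (c / sq n) * 1 by rewrite mulr1 mulrA.
apply: (numerator_window (s := s)) => //; first by lra.
move=> t /andP[t1 t2].
have tb : `|e t| <= 3 by rewrite ler_norml; apply/andP; split; lra.
split.
- apply: (Hc p 0 v j o t W) => //; first by rewrite v0v.
  by rewrite /dev o0 mulr0 !subr0 (le_trans tb)// big.
- apply: (@le_trans _ _ (c / sq m)).
    by rewrite ler_wpM2l ?(ltW c0)// lef_pV2 ?posrE ?sq_gt0//; apply: le_sq; rewrite /n -addSn leq_addl.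
  apply: (Hc _ 0 v' m o t W') => //; [by rewrite v0v'|exact: leq_trans Nj jm|].
  by rewrite /dev o0 mulr0 !subr0 (le_trans tb)// big.
Qed.

(** Restrict the killed path to pass above h at the time of the cut. *)
Lemma killed_midpoint p j m x y (h A B c0 : R) : doubly_stochastic nu p -> 0 <= h -> 0 <= A -> 0 <= B ->
  (forall t, h <= e t -> A * k p j x t <= q p j x t) ->
  (forall t, h <= e t -> B * k p m t y <= q p m t y) ->
  (c0%:E <= itg nu (fun t => ind R (fun t => h <= e t) t * (k p j x t * k p m t y))%R)%E ->
  A * B * c0 <= q p (j + m).+1 x y.
Proof.
move=> P h0 A0 B0 HA HB H.
have k0 i a b : 0 <= k p i a b by exact: kern_ge0.
have q0 i a b : 0 <= q p i a b by exact: kern_ge0.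
have mr := kern_row P K1 j x; have mc := kern_col P K1 m y.
have mqr := kern_row P Kc j x; have mqc := kern_col P Kc m y.
have mi : measurable_fun setT (ind R (fun t => h <= e t)) by apply: measurable_ind; mbool.
have i0 t : 0 <= ind R (fun t => h <= e t) t by exact: ind_ge0.
have c0' := chi_ge0 e; have cm := measurable_chi S.
have AB : 0 <= A * B by rewrite mulr_ge0.
rewrite -lee_fin (kern_CK P Kc) EFinM.
apply: (@le_trans _ _ ((A * B)%:E * itg nu (fun t => ind R (fun t => h <= e t) t * (k p j x t * k p m t y))%R)%E).
  by apply: lee_wpmul2l => //; rewrite lee_fin.
rewrite -itgZ//; try (by mfun); try (by nn).
apply: le_itg => [||t|t]; [by mfun|by mfun|by nn|].
rewrite /ind; have [ht|_] := leP h (e t); last by rewrite mul0r mulr0; nn.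
rewrite mul1r (chi1 (le_trans h0 ht)) mulr1.
have -> : A * B * (k p j x t * k p m t y) = (A * k p j x t) * (B * k p m t y) by ring.
by apply: ler_pM; [nn|nn|exact: HA|exact: HB].
Qed.

(** Extends [lower_steep] to starting points below 1: with a probability bounded below
    the bridge is above 1 after j steps, and the first j steps survive by
    [small_time]. *)
Lemma lower_any_start p : fam p -> fam (rev p) -> exists K c : R, exists N, [/\ 1 <= K, 0 < c &
  forall x y n, 0 <= e x -> K * sq n <= e y -> (N <= n)%N ->
  c * Num.min 1 (e x * e y / n.+1%:R) * k p n x y <= q p n x y].
Proof.
move=> Fp Fr; have F0 := supc_gt0 v0_gt0.
have [K [cs [Ns [K_1 cs0 Hs]]]] := lower_steep S lam0_gt0 lam0_le c1_gt0 c12 v0_gt0 v01 C0_ge0.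
have [j [cn [Nn [cn0 Hn]]]] := start_numerator.
have [v /andP[v0v vv1] W] := fam_base Fp; have P := walk_ds W.
have [cj cj0 Hj] := small_time S o0 W v0_gt0 v0v j.
pose c' := cj * cs * (cn / supc v0).
have c'0 : 0 < c' by rewrite /c'; pos.
exists K, (Num.min cs c'), (j + (maxn Ns Nn)).+1; split=> //; first by rewrite lt_min cs0 c'0.
move=> x y n x0 yK Nn'.
have k0 : 0 <= k p n x y by apply: kern_ge0.
have sn := sq_gt0 R n.
have y0 : 0 <= e y by apply: le_trans yK; apply: mulr_ge0; lra.
have xy0 : 0 <= e x * e y / n.+1%:R by nn.
have mx0 := min1_ge0 xy0.
have [x1|x1] := leP 1 (e x).
  apply: le_trans (Hs p Fp Fr x y n x1 yK _); last by move: Nn'; clear; lia.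
  by rewrite ler_wpM2r// ler_wpM2r// ge_min lexx.
have [m nE] : exists m, n = (j + m).+1 by exists (n - j.+1)%N; move: Nn'; clear; lia.
have Nm : (maxn Ns Nn <= m)%N by move: Nn' nE; clear; lia.
have mn : (m < n)%N by move: nE; clear; lia.
move: Nm; rewrite geq_max => /andP[Nsm Nnm].
have num := midpoint_lower S o0 v0_gt0 v0v W x0 y0 (ltW cn0) (Hn p Fp Fr m Nnm).
rewrite -nE in num.
have yn0 : 0 <= e y / n.+1%:R by nn.
have B0 : 0 <= cs * Num.min 1 (e y / n.+1%:R) by rewrite mulr_ge0 ?min1_ge0// ltW.
have := @killed_midpoint p j m x y 1 cj (cs * Num.min 1 (e y / n.+1%:R)) _ P ler01 (ltW cj0) B0 _ _ num.
rewrite -nE => main; apply: le_trans (main _ _).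
- have -> : cj * (cs * Num.min 1 (e y / n.+1%:R)) * (cn / supc v0 * k p n x y) =
    c' * Num.min 1 (e y / n.+1%:R) * k p n x y by rewrite /c'; ring.
  rewrite ler_wpM2r//; apply: ler_pM => //.
  + by rewrite le_min ltW// ltW.
  + by rewrite ge_min lexx orbT.
  + apply: min1_mono; rewrite -mulrA ler_piMl// ltW//.
- by move=> t t1; apply: Hj; rewrite ?(le_trans ler01 t1).
move=> t t1; apply: le_trans (Hs p Fp Fr t y m t1 _ Nsm).
- rewrite ler_wpM2r ?(kern_ge0 P K1)// ler_wpM2l ?(ltW cs0)//.
  apply: min1_mono; apply: (@le_trans _ _ (1 * e y / m.+1%:R)); last first.
    by rewrite ler_wpM2r ?invr_ge0 ?ler0n// ler_wpM2r.
  by rewrite mul1r ler_wpM2l// lef_pV2 ?posrE ?ltr0Sn// ler_nat (leq_trans mn).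
- apply: le_trans yK; rewrite ler_wpM2l ?(le_trans ler01 K_1)//.
  by apply: le_sq; exact: ltnW.
Qed.

Lemma split_two n : (1 <= n)%N -> exists j m : nat,
  [/\ (j + m).+1 = n, (n.+1 <= 4 * j.+1)%N, (n.+1 <= 4 * m.+1)%N & (n <= 2 * j + 2)%N /\ (n <= 2 * m + 2)%N].
Proof.
move=> n1; exists ((n - 1)./2)%N, (n - 1 - (n - 1)./2)%N.
have := odd_double_half (n - 1); have : (odd (n - 1) <= 1)%N by case: odd.
rewrite -muln2; move: (n - 1)./2 (nat_of_bool (odd (n - 1))) => u w.
by split; [lia|lia|lia|split; lia].
Qed.

(** If x or y exceeds K sqrt n, [lower_any_start] applies to the walk or its reversal.
    Otherwise the two halves, cut at a height above K sqrt n, contribute x / sqrt n and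
    y / sqrt n. *)
Theorem kern_lower p : fam p -> fam (rev p) -> exists2 c : R, 0 < c &
  forall x y n, 0 <= e x -> 0 <= e y ->
  c * Num.min 1 (e x * e y / n.+1%:R) * k p n x y <= q p n x y.
Proof.
move=> Fp Fr; have F0 := supc_gt0 v0_gt0.
have [Ka [ca [Na [Ka1 ca0 Ha]]]] := lower_any_start Fp Fr.
have [Kb [cb [Nb [Kb1 cb0 Hb]]]] := lower_any_start Fr Fp.
have [v /andP[v0v vv1] W] := fam_base Fp; have P := walk_ds W.
pose K := Num.max Ka Kb.
have KaK : Ka <= K by rewrite le_max lexx.
have KbK : Kb <= K by rewrite le_max lexx orbT.
have K_1 : 1 <= K by apply: le_trans KaK.
have K0 : 0 < K := lt_le_trans ltr01 K_1.
have [cm [Nm [cm0 Hm]]] := middle_numerator K0.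
pose N1 := maxn Na (maxn Nb Nm).
have [cs cs0 Hs] := small_times S o0 W v0_gt0 v0v (2 * N1 + 2).
(* K^2 comes from z / (K sqrt n) <= min(1, z / sqrt n), for z = x and z = y. *)
pose cmid := ca * cb * (cm / supc v0) / K ^+ 2.
have cmid0 : 0 < cmid by rewrite /cmid; pos.
have [c [c0 [cca ccb ccs ccm]]] : exists c : R, 0 < c /\ [/\ c <= ca, c <= cb, c <= cs & c <= cmid].
  exists (Num.min (Num.min ca cb) (Num.min cs cmid)); rewrite !lt_min ca0 cb0 cs0 cmid0; split=> //.
  by split; rewrite !ge_min lexx ?orbT.
exists c => // x y n x0 y0.
have k0 : 0 <= k p n x y by apply: kern_ge0.
have xy0 : 0 <= e x * e y / n.+1%:R by nn.
have mx0 := min1_ge0 xy0.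
have mx1 : Num.min 1 (e x * e y / n.+1%:R) <= 1 by rewrite ge_min lexx.
have use (c' : R) : c <= c' -> c' * Num.min 1 (e x * e y / n.+1%:R) * k p n x y <= q p n x y ->
    c * Num.min 1 (e x * e y / n.+1%:R) * k p n x y <= q p n x y.
  by move=> cc'; apply: le_trans; rewrite ler_wpM2r// ler_wpM2r.
have [nN|Nn] := leqP n (2 * N1 + 2).
  apply: (use cs) => //; apply: le_trans (Hs n nN x y x0 y0).
  by rewrite ler_wpM2r// ler_piMr// ltW.
have sn := sq_gt0 R n.
have N1n : (N1 <= n)%N by move: Nn; clear; lia.
have NaN1 : (Na <= N1)%N by rewrite leq_maxl.
have NbN1 : (Nb <= N1)%N by rewrite /N1 !leq_max leqnn !orbT.
have NmN1 : (Nm <= N1)%N by rewrite /N1 !leq_max leqnn !orbT.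
have [yK|yK] := leP (K * sq n) (e y).
  apply: (use ca) => //; apply: Ha => //; last exact: leq_trans NaN1 N1n.
  by apply: le_trans yK; rewrite ler_wpM2r// ltW.
have [xK|xK] := leP (K * sq n) (e x).
  apply: (use cb) => //; rewrite -(kern_rev _ _ _ P K1) -(kern_rev _ _ _ P Kc) [e x * _]mulrC.
  apply: Hb => //; last exact: leq_trans NbN1 N1n.
  by apply: le_trans xK; rewrite ler_wpM2r// ltW.
have [j [m [nE jn mn [nj nm]]]] := split_two (leq_ltn_trans (leq0n _) Nn).
have N1j : (N1 <= j)%N by move: Nn nj; clear; lia.
have N1m : (N1 <= m)%N by move: Nn nm; clear; lia.
have num : ((cm / sq (j + m).+1)%:E <= itg nu (fun t => ind R (fun t => (K * sq (j + m).+1 <= e t)%R) t * (k p j o t * k p m t o))%R)%E.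
  by apply: Hm => //; rewrite ?nE//; apply: leq_trans NmN1 _.
have {}num := midpoint_lower S o0 v0_gt0 v0v W x0 y0 (ltW cm0) num.
rewrite nE in num.
have Ks0 : 0 <= K * sq n by nn.
have ratio z i t : 0 <= z -> (i <= n)%N -> K * sq n <= e t -> z / sq n <= z * e t / i.+1%:R.
  move=> z0 ni tK; rewrite -mulrA ler_wpM2l// ler_pdivlMr ?ltr0Sn//.
  rewrite -[_^-1]mul1r mulrAC ler_pdivrMr// mul1r.
  apply: (@le_trans _ _ (sq n * sq n)); first by rewrite -expr2 sqr_sq ler_nat.
  by rewrite ler_wpM2r ?(ltW sn)// (le_trans _ tK)// ler_peMl// ltW.
have xs0 : 0 <= e x / sq n by nn.
have ys0 : 0 <= e y / sq n by nn.
have A0 : 0 <= ca * Num.min 1 (e x / sq n) by rewrite mulr_ge0 ?min1_ge0// ltW.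
have B0 : 0 <= cb * Num.min 1 (e y / sq n) by rewrite mulr_ge0 ?min1_ge0// ltW.
have jn' : (j <= n)%N by rewrite -nE -addnS leq_addr.
have mn' : (m <= n)%N by rewrite -nE -addSn leq_addl.
have HA t : K * sq n <= e t -> ca * Num.min 1 (e x / sq n) * k p j x t <= q p j x t.
  move=> tK; apply: le_trans (Ha x t j x0 _ _); [| |exact: leq_trans NaN1 N1j].
  - by rewrite ler_wpM2r ?(kern_ge0 P K1)// ler_wpM2l ?(ltW ca0)//; apply: min1_mono; exact: ratio.
  - by apply: le_trans tK; apply: ler_pM => //; [exact: le_trans ler01 Ka1|exact: sq_ge0|exact: le_sq].
have HB t : K * sq n <= e t -> cb * Num.min 1 (e y / sq n) * k p m t y <= q p m t y.
  move=> tK; rewrite -(kern_rev _ _ _ P K1) -(kern_rev _ _ _ P Kc).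
  apply: le_trans (Hb y t m y0 _ _); [| |exact: leq_trans NbN1 N1m].
  - rewrite ler_wpM2r ?(kern_ge0 (ds_rev P) K1)// ler_wpM2l ?(ltW cb0)//; apply: min1_mono; exact: ratio.
  - by apply: le_trans tK; apply: ler_pM => //; [exact: le_trans ler01 Kb1|exact: sq_ge0|exact: le_sq].
have main := killed_midpoint P Ks0 A0 B0 HA HB num; rewrite nE in main.
apply: (use cmid) => //; apply: le_trans main.
have frac z : 0 <= z -> z < K * sq n -> z / (K * sq n) <= Num.min 1 (z / sq n).
  move=> z0 zK; have Ksn : 0 < K * sq n by apply: mulr_gt0.
  rewrite le_min ler_pdivrMr// mul1r (ltW zK)/=; apply: ler_wpM2l => //.
  by rewrite lef_pV2 ?posrE// ler_peMl// ltW.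
apply: (@le_trans _ _ (ca * (e x / (K * sq n)) * (cb * (e y / (K * sq n))) * (cm / supc v0 * k p n x y))).
  have -> : ca * (e x / (K * sq n)) * (cb * (e y / (K * sq n))) * (cm / supc v0 * k p n x y) =
    cmid * (e x * e y / n.+1%:R) * k p n x y.
    by rewrite /cmid -(sqr_sq R n); field; rewrite !gt_eqF.
  rewrite ler_wpM2r//; apply: ler_pM => //; first exact: ltW.
  by rewrite ge_min lexx orbT.
apply: ler_wpM2r; first by nn.
apply: ler_pM; [by nn|by nn| |].
- by rewrite ler_wpM2l ?(ltW ca0)// frac.
- by rewrite ler_wpM2l ?(ltW cb0)// frac.
Qed.
End FinalLower.

(** * Walks from the moments of their increments *)

Section Increments.
Context d (T : measurableType d) (R : realType).
Variable nu : {sigma_finite_measure set T -> \bar R}.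
Variables (e : T -> R) (add : T -> T -> T) (opp : T -> T).
Hypothesis S : state_space nu e add opp.
Let em := emb_meas S.
Variable o : T.
Hypothesis o0 : e o = 0.
Local Notation walk := (walk nu e add).

Let addo t : add o t = t.
Proof. by apply: (emb_inj S); rewrite (embD S) o0 add0r. Qed.

Let addNo t : add (opp t) t = o.
Proof. by apply: (emb_inj S); rewrite (embD S) (embN S) o0 addNr. Qed.

Lemma increment_base p x (g : R -> R) : measurable2 p -> (forall x y, 0 <= p x y) ->
  (forall h x y, p (add x h) (add y h) = p x y) ->
  measurable_fun setT g -> (forall r, 0 <= g r) ->
  itg nu (fun y => p x y * g (e y - e x)) = itg nu (fun t => p o t * g (e t)).
Proof.
move=> pm p0 sh mg g0; rewrite -(itg_shift S x).
- apply: eq_itg => t; rewrite -{1}(addo x) sh (embD S); congr (_ * g _); ring.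
- apply: measurable_funM; first exact: measurable2_row.
  by apply: (measurableT_comp mg); mfun.
- by move=> t; rewrite mulr_ge0.
Qed.

Lemma increment_rev p (g : R -> R) : measurable2 p -> (forall x y, 0 <= p x y) ->
  (forall h x y, p (add x h) (add y h) = p x y) ->
  measurable_fun setT g -> (forall r, 0 <= g r) ->
  itg nu (fun t => rev p o t * g (e t)) = itg nu (fun t => p o t * g (- e t)).
Proof.
move=> pm p0 sh mg g0; rewrite -(itg_opp S).
- by apply: eq_itg => t; rewrite /rev -(sh t) addNo addo (embN S).
- apply: measurable_funM; first exact: (measurable2_col o pm).
  exact: (measurableT_comp mg em).
- by move=> t; apply: mulr_ge0; [exact: p0|exact: g0].
Qed.

(** The second moment about -s in terms of the positive and negative parts of the mean.
    The two signs of s are treated separately, in order to add only nonnegative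
    integrands on either side. *)
Lemma square_expansion (f : T -> R) A1 A2 Q s : measurable_fun setT f -> (forall t, 0 <= f t) ->
  itg nu f = 1%E -> itg nu (fun t => f t * Num.max (e t) 0) = A1%:E ->
  itg nu (fun t => f t * Num.max (- e t) 0) = A2%:E ->
  itg nu (fun t => f t * e t ^+ 2) = Q%:E ->
  itg nu (fun t => f t * (e t + s) ^+ 2) = (Q + s ^+ 2 + 2 * s * (A1 - A2))%:E.
Proof.
move=> mf f0 f1 E1 E2 EQ.
have mpos : measurable_fun setT (fun z => Num.max (e z) 0) by exact: measurable_maxr.
have mneg : measurable_fun setT (fun z => Num.max (- e z) 0).
  by apply: measurable_maxr => //; exact: measurableT_comp.
have pos0 z : 0 <= Num.max (e z) 0 by rewrite le_max lexx orbT.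
have neg0 z : 0 <= Num.max (- e z) 0 by rewrite le_max lexx orbT.
have maxE z : e z = Num.max (e z) 0 - Num.max (- e z) 0.
  by have [h|h] := leP 0 (e z); [rewrite max_r ?oppr_le0//|rewrite max_l ?oppr_ge0 1?ltW//]; lra.
have key (u1 u2 : T -> R) (B1 B2 r : R) : measurable_fun setT u1 -> measurable_fun setT u2 ->
    (forall t, 0 <= u1 t) -> (forall t, 0 <= u2 t) -> 0 <= r ->
    itg nu (fun t => f t * u1 t) = B1%:E -> itg nu (fun t => f t * u2 t) = B2%:E ->
    (forall t, (e t + s) ^+ 2 + 2 * r * u2 t = e t ^+ 2 + 2 * r * u1 t + s ^+ 2) ->
    itg nu (fun t => f t * (e t + s) ^+ 2) = (Q + s ^+ 2 + 2 * r * (B1 - B2))%:E.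
  move=> mu1 mu2 u10 u20 r0 F1 F2 H.
  have : itg nu (fun t => f t * (e t + s) ^+ 2 + 2 * r * (f t * u2 t)) =
      itg nu (fun t => f t * e t ^+ 2 + 2 * r * (f t * u1 t) + s ^+ 2 * f t).
    by apply: eq_itg => t; have := congr1 (fun x => f t * x) (H t); lra.
  rewrite !itgD//; try (by mfun); try (by nn).
  rewrite !itgZ//; try (by mfun); try (by nn).
  rewrite EQ F1 F2 f1 mule1 -!EFinM -!EFinD => h.
  have : itg nu (fun t => f t * (e t + s) ^+ 2) != +oo%E.
    by apply/eqP => h'; rewrite h' in h.
  have : (0 <= itg nu (fun t => f t * (e t + s) ^+ 2)%R)%E by apply: itg_ge0; nn.
  case: (itg nu (fun t => f t * (e t + s) ^+ 2)) h => // x.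
  by rewrite -EFinD => -[h] _ _; congr EFin; lra.
have [s0|s0] := leP 0 s.
  apply: (key (fun z => Num.max (e z) 0) (fun z => Num.max (- e z) 0) _ _ s) => // t.
  by have := maxE t; set a := Num.max _ _; set b := Num.max _ _ => ->; ring.
have -> : 2 * s * (A1 - A2) = 2 * (- s) * (A2 - A1) by ring.
apply: (key (fun z => Num.max (- e z) 0) (fun z => Num.max (e z) 0)) => //; first by lra.
move=> t.
by have := maxE t; set a := Num.max _ _; set b := Num.max _ _ => ->; ring.
Qed.

(** The first moment of a translation invariant kernel and its centred second moment
    give the second moment about every point; boundedness comes from [sup_bound]. *)
Lemma walk_of_moments p A1 A2 Q : measurable2 p -> (forall x y, 0 <= p x y) ->
  (forall h x y, p (add x h) (add y h) = p x y) -> tp2 e p ->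
  itg nu (p o) = 1%E -> itg nu (fun t => p o t * Num.max (e t) 0) = A1%:E ->
  itg nu (fun t => p o t * Num.max (- e t) 0) = A2%:E ->
  itg nu (fun t => p o t * e t ^+ 2) = Q%:E -> 0 < Q - (A1 - A2) ^+ 2 ->
  walk p (A1 - A2) (Q - (A1 - A2) ^+ 2).
Proof.
move=> pm p0 sh TP m1 E1 E2 EQ V0.
have rowE x c : itg nu (fun y => p x y * (e y - e x - (A1 - A2) + c) ^+ 2) =
    (Q - (A1 - A2) ^+ 2 + c ^+ 2)%:E.
  have mo : measurable_fun setT (p o) by exact: measurable2_row.
  have -> : (Q - (A1 - A2) ^+ 2 + c ^+ 2)%:E =
      (Q + (c - (A1 - A2)) ^+ 2 + 2 * (c - (A1 - A2)) * (A1 - A2))%:E by congr EFin; ring.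
  rewrite -(square_expansion (c - (A1 - A2)) mo (p0 o) m1 E1 E2 EQ).
  rewrite -(increment_base x (g := fun r => (r + (c - (A1 - A2))) ^+ 2) pm p0 sh); last 2 first.
  - by mfun.
  - by move=> r; exact: sqr_ge0.
  by apply: eq_itg => y; congr (_ * _ ^+ 2); ring.
have mass x : itg nu (p x) = 1%E.
  rewrite -m1; have := increment_base x (g := fun=> 1) pm p0 sh (measurable_cst _) (fun=> ler01).
  by under eq_itg do rewrite mulr1; under [RHS]eq_itg do rewrite mulr1.
have mass' y : itg nu (p^~ y) = 1%E.
  have shr h u w : rev p (add u h) (add w h) = rev p u w by exact: sh.
  have rm : measurable2 (rev p) by exact: (measurable2_swap pm).
  rewrite -[LHS]/(itg nu (rev p y)).
  have := increment_base y (g := fun=> 1) rm (fun u w => p0 w u) shr (measurable_cst _) (fun=> ler01).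
  under eq_itg do rewrite mulr1; move=> ->.
  rewrite (increment_rev (g := fun=> 1) pm p0 sh)//.
  by under eq_itg do rewrite mulr1.
have sup x y : p x y ^+ 2 * (Q - (A1 - A2) ^+ 2) <= 320.
  apply: (sup_bound S (m := e x + (A1 - A2)) (f := p x)) => //.
  - exact: measurable2_row.
  - by move=> c; rewrite -(rowE x); apply: eq_itg => z; congr (_ * _ ^+ 2); ring.
  - exact: (tp2_log_concave S x TP sh).
split=> //; split=> //.
(* A real whose square is at most D is at most D + 1. *)
exists (320 / (Q - (A1 - A2) ^+ 2) + 1) => x y.
have : p x y ^+ 2 <= 320 / (Q - (A1 - A2) ^+ 2) by rewrite ler_pdivlMr.
by have := sqr_ge0 (p x y - 1); have := sqr_ge0 (p x y); rewrite !expr2; lra.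
Qed.

(** The mean is zero in the sense that the positive and the negative part have the same
    integral. *)
Record increments (p : T -> T -> R) (t0 : R) : Prop := Incr {
  inc_ge0 : forall x y, 0 <= p x y;
  inc_meas : measurable2 p;
  inc_shift : forall h x y, p (add x h) (add y h) = p x y;
  inc_tp2 : tp2 e p;
  inc_mass : itg nu (p o) = 1%E;
  inc_mean : itg nu (fun t => p o t * Num.max (e t) 0) = itg nu (fun t => p o t * Num.max (- e t) 0);
  inc_var : itg nu (fun t => p o t * e t ^+ 2) <> 0%E;
  inc_mgf : forall s, `|s| < t0 -> (itg nu (fun t => p o t * expR (s * e t))%R < +oo)%E }.

Lemma measurable_maxr0 : measurable_fun setT (fun r : R => Num.max r 0).
Proof. exact: measurable_maxr. Qed.

Lemma measurable_maxrN0 : measurable_fun setT (fun r : R => Num.max (- r) 0).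
Proof. by apply: measurable_maxr => //; exact: measurableT_comp. Qed.

Lemma max0_ge0 (r : R) : 0 <= Num.max r 0.
Proof. by rewrite le_max lexx orbT. Qed.

Lemma increments_rev p t0 : increments p t0 -> increments (rev p) t0.
Proof.
move=> [p0 pm sh TP m1 mean var mgf].
have R1 (g : R -> R) (mg : measurable_fun setT g) (g0 : forall r, 0 <= g r) := increment_rev pm p0 sh mg g0.
split.
- by move=> x y; exact: p0.
- exact: (measurable2_swap pm).
- by move=> h x y; exact: sh.
- by move=> x x' y y'; rewrite /rev; exact: TP.
- have := R1 (fun=> 1) (measurable_cst _) (fun=> ler01).
  by under eq_itg do rewrite mulr1; under [RHS]eq_itg do rewrite mulr1; rewrite m1.
- rewrite (R1 _ measurable_maxr0 max0_ge0) (R1 _ measurable_maxrN0 (fun r => max0_ge0 (- r))) -mean.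
  by apply: eq_itg => t; rewrite opprK.
- rewrite (R1 (fun r => r ^+ 2)); [|by mfun|exact: sqr_ge0].
  by under eq_itg do rewrite sqrrN.
- move=> s st; rewrite (R1 (fun r => expR (s * r))); last 2 first.
  + by apply: measurableT_comp => //; mfun.
  + by move=> r; exact: expR_ge0.
  have := mgf (- s); rewrite normrN => /(_ st).
  by under eq_itg do rewrite mulNr -mulrN.
Qed.
End Increments.

(** * Tilts of an increment distribution *)

Section Pointwise.
Variable R : realType.
Implicit Types r b l : R.
Local Notation pp r := (Num.max r 0).

Lemma pp_pos r : 0 <= r -> pp r = r /\ pp (- r) = 0.
Proof. by move=> h; rewrite max_l// max_r// oppr_le0. Qed.
Lemma pp_neg r : r <= 0 -> pp r = 0 /\ pp (- r) = - r.
Proof. by move=> h; rewrite max_r// max_l// oppr_ge0. Qed.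

Definition negind r : R := if r < 0 then 1 else 0.

(** Twice the hyperbolic cosine of 2 l0 r: it dominates exp(2 l0 |r|) and its integral
    is a sum of two values of the moment generating function. *)
Definition cosh2 (l0 : R) r := expR (2 * l0 * r) + expR (- (2 * l0) * r).

Lemma expR_norm_le (l0 : R) r : 0 <= l0 -> expR (2 * (l0 * `|r|)) <= cosh2 l0 r.
Proof.
move=> h0; rewrite /cosh2; have [h|h] := leP 0 r.
  by rewrite ger0_norm// mulrA lerDl expR_ge0.
rewrite ltr0_norm//; have -> : 2 * (l0 * - r) = - (2 * l0) * r by ring.
by rewrite lerDr expR_ge0.
Qed.

Lemma expR_sq_lower (y : R) : 0 <= y -> 1 + y ^+ 2 / 4 <= expR y.
Proof.
move=> y0; have := @expR_ge1Dx _ (y / 2); have -> : expR y = expR (y / 2) * expR (y / 2).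
  by rewrite -expRD; congr expR; field.
move=> h; have : (1 + y / 2) * (1 + y / 2) <= expR (y / 2) * expR (y / 2).
  by apply: ler_pM => //; lra.
by rewrite expr2; nra.
Qed.

Lemma tilt_dominated l (l0 : R) r : 0 <= l <= l0 -> expR (l * r) <= expR (l0 * `|r|).
Proof.
move=> /andP[h1 h2]; rewrite ler_expR.
have := ler_norm r; have := normr_ge0 r => a0 ar.
apply: (@le_trans _ _ (l * `|r|)); first by rewrite ler_wpM2l.
by rewrite ler_wpM2r.
Qed.

(** The quadratic factor is absorbed by doubling the exponential rate. *)
Lemma weight_dominated (l0 : R) r : 0 < l0 -> (1 + r ^+ 2) * expR (l0 * `|r|) <= (1 + 4 / l0 ^+ 2) * cosh2 l0 r.
Proof.
move=> h0; have y0 : 0 <= l0 * `|r| by rewrite mulr_ge0// ltW.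
have c1 : 1 <= 1 + 4 / l0 ^+ 2 by rewrite lerDl divr_ge0// exprn_ge0// ltW.
apply: le_trans (ler_wpM2l (le_trans ler01 c1) (expR_norm_le r (ltW h0))).
have -> : expR (2 * (l0 * `|r|)) = expR (l0 * `|r|) * expR (l0 * `|r|).
  by rewrite -expRD; congr expR; ring.
rewrite mulrA ler_wpM2r ?expR_ge0//.
have h := expR_sq_lower y0.
have h1 : 1 <= expR (l0 * `|r|) by rewrite -[X in X <= _]expR0 ler_expR.
rewrite mulrDl mul1r; apply: lerD => //.
have -> : r ^+ 2 = 4 / l0 ^+ 2 * ((l0 * `|r|) ^+ 2 / 4).
  by rewrite exprMn real_normK ?num_real//; field; rewrite gt_eqF.
by rewrite ler_wpM2l ?divr_ge0 ?exprn_ge0 ?ltW// ; lra.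
Qed.

(** Together with [tilt_neg_part], it shows that a tilt by l raises the mean of a
    centred variable by at least l times the second moment of its positive part. *)
Lemma tilt_pos_part l r : 0 <= l -> pp r + l * pp r ^+ 2 <= pp r * expR (l * r).
Proof.
move=> h0; have /orP[h|h] := le_total 0 r.
  have [-> _] := pp_pos h; have := @expR_ge1Dx _ (l * r) => h1.
  have : r * (1 + l * r) <= r * expR (l * r) by rewrite ler_wpM2l.
  by rewrite expr2; lra.
by have [-> _] := pp_neg h; rewrite expr0n mulr0 mul0r addr0.
Qed.

Lemma tilt_neg_part l r : 0 <= l -> pp (- r) * expR (l * r) <= pp (- r).
Proof.
move=> h0; have /orP[h|h] := le_total 0 r.
  by have [_ ->] := pp_pos h; rewrite mul0r.
have [_ ->] := pp_neg h; rewrite ler_piMr ?oppr_ge0// -[X in _ <= X]expR0 ler_expR.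
by rewrite mulr_ge0_le0.
Qed.

(** Integrated, it bounds the mean of the tilt by a multiple of l. The negative parts
    are moved to the other side to keep both sides nonnegative. *)
Lemma tilt_mean_upper l (l0 : R) r : 0 <= l <= l0 ->
  pp r * expR (l * r) + pp (- r) <=
  pp (- r) * expR (l * r) + pp r + l * (r ^+ 2 * expR (l0 * `|r|)).
Proof.
move=> ll0; have [l0' l1] := andP ll0; have D := tilt_dominated r ll0.
have E0 := expR_ge0 (l * r).
have ND : 1 - l * r <= expR (- (l * r)) by have := @expR_ge1Dx _ (- (l * r)).
have NE : expR (- (l * r)) * expR (l * r) = 1 by rewrite -expRD addNr expR0.
have /orP[h|h] := le_total 0 r.
  have [-> ->] := pp_pos h; rewrite addr0 mul0r add0r.
  have lr0 : 0 <= l * r by rewrite mulr_ge0.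
  have : (1 - l * r) * expR (l * r) <= 1 by rewrite -[leRHS]NE ler_wpM2r.
  have : (l * r) * expR (l * r) <= (l * r) * expR (l0 * `|r|) by rewrite ler_wpM2l.
  move=> a1 a2; have : r * (expR (l * r)) <= r * (1 + (l * r) * expR (l0 * `|r|)).
    by rewrite ler_wpM2l//; lra.
  by rewrite expr2; lra.
have [-> ->] := pp_neg h; rewrite mul0r add0r addr0.
have r20 : 0 <= - r by lra.
have e1 : 1 <= expR (l0 * `|r|).
  by rewrite -[X in X <= _]expR0 ler_expR mulr_ge0// (le_trans l0').
have : 1 + l * r <= expR (l * r) by exact: expR_ge1Dx.
move=> a1; have a2 : (- r) * (1 + l * r) <= (- r) * expR (l * r) by rewrite ler_wpM2l.
have a3 : l * (r ^+ 2 * 1) <= l * (r ^+ 2 * expR (l0 * `|r|)).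
  by rewrite ler_wpM2l// ler_wpM2l// sqr_ge0.
by move: a3; rewrite expr2; lra.
Qed.

(** Integrated over a centred variable, it shows that the mass M of the tilt is at
    least 1. *)
Lemma tilt_mass_lower l r : 1 + l * pp r <= expR (l * r) + l * pp (- r).
Proof.
have := @expR_ge1Dx _ (l * r); have /orP[h|h] := le_total 0 r.
  by have [-> ->] := pp_pos h; lra.
by have [-> ->] := pp_neg h; lra.
Qed.

(** With a nonnegative mean b, jumps below 0 contribute at least their square to the
    variance. *)
Lemma tilt_var_lower l (l0 : R) b r : 0 <= l <= l0 -> 0 <= b ->
  pp (- r) ^+ 2 * expR (l0 * r) <= (r - b) ^+ 2 * expR (l * r).
Proof.
move=> /andP[h1 h2] b0; have /orP[h|h] := le_total 0 r.
  by have [_ ->] := pp_pos h; rewrite expr0n mul0r mulr_ge0 ?sqr_ge0 ?expR_ge0.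
have [_ ->] := pp_neg h; apply: ler_pM; rewrite ?sqr_ge0 ?expR_ge0//.
  by rewrite sqrrN !expr2; nra.
by rewrite ler_expR; nra.
Qed.
End Pointwise.

Section Family.
Context d (T : measurableType d) (R : realType).
Variable nu : {sigma_finite_measure set T -> \bar R}.
Variables (e : T -> R) (add : T -> T -> T) (opp : T -> T).
Hypothesis S : state_space nu e add opp.
Let em := emb_meas S.
Variable o : T.
Hypothesis o0 : e o = 0.
Local Notation walk := (walk nu e add).
Local Notation increments := (increments nu e add o).
Local Notation fam := (tilted_family nu e add).
Local Notation pp r := (Num.max r 0).

Variables (p : T -> T -> R) (t0 l0 : R).
Hypotheses (I : increments p t0) (l0_gt0 : 0 < l0) (l0t0 : 2 * l0 < t0).
Let p0 := inc_ge0 I.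
Let pm := inc_meas I.
Let mpo : measurable_fun setT (p o) := measurable2_row o pm.
Definition mom (u : R -> R) : \bar R := itg nu (fun t => p o t * u (e t)).

Lemma measurable_mom (u : R -> R) : measurable_fun setT u ->
  measurable_fun setT (fun t => p o t * u (e t)).
Proof. by move=> mu; apply: measurable_funM => //; exact: (measurableT_comp mu em). Qed.

Lemma le_mom (u w : R -> R) : measurable_fun setT u -> measurable_fun setT w ->
  (forall r, 0 <= u r) -> (forall r, u r <= w r) -> (mom u <= mom w)%E.
Proof.
move=> mu mw u0 uw; apply: le_itg; [exact: measurable_mom|exact: measurable_mom| |] => t.
  by rewrite mulr_ge0.
by rewrite ler_wpM2l.
Qed.

Lemma momD (u w : R -> R) : measurable_fun setT u -> measurable_fun setT w ->
  (forall r, 0 <= u r) -> (forall r, 0 <= w r) -> mom (fun r => u r + w r) = (mom u + mom w)%E.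
Proof.
move=> mu mw u0 w0; rewrite /mom -itgD//; try exact: measurable_mom; try by nn.
by apply: eq_itg => t; rewrite mulrDr.
Qed.

Lemma momZ c (u : R -> R) : measurable_fun setT u -> (forall r, 0 <= u r) -> 0 <= c ->
  mom (fun r => c * u r) = (c%:E * mom u)%E.
Proof.
move=> mu u0 c0; rewrite /mom -itgZ//; [|exact: measurable_mom|by nn].
by apply: eq_itg => t; ring.
Qed.

Lemma measurable_expRM (c : R) : measurable_fun setT (fun r : R => expR (c * r)).
Proof. by apply: measurableT_comp => //; mfun. Qed.

Lemma measurable_cosh2 : measurable_fun setT (cosh2 l0).
Proof. by apply: measurable_funD; exact: measurable_expRM. Qed.

Lemma measurable_expR_norm (c : R) : measurable_fun setT (fun r : R => expR (c * `|r|)).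
Proof.
by apply: measurableT_comp => //; apply: measurable_funM.
Qed.

Lemma mom_fin (u : R -> R) C : measurable_fun setT u -> (forall r, 0 <= u r) ->
  (forall r, u r <= C * cosh2 l0 r) -> 0 <= C -> exists B, mom u = B%:E.
Proof.
move=> mu u0 uC C0.
have ch0 r : 0 <= cosh2 l0 r by rewrite addr_ge0 ?expR_ge0.
have mc := measurable_cosh2.
have fin s : `|s| < t0 -> exists B, mom (fun r => expR (s * r)) = B%:E.
  move=> st; exists (ritg nu (fun t => p o t * expR (s * e t))).
  by apply: itg_fin; [nn|exact: (inc_mgf I)].
have [B1 E1] : exists B, mom (fun r => expR (2 * l0 * r)) = B%:E.
  by apply: fin; rewrite ger0_norm// mulr_ge0// ltW.
have [B2 E2] : exists B, mom (fun r => expR (- (2 * l0) * r)) = B%:E.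
  by apply: fin; rewrite normrN ger0_norm// mulr_ge0// ltW.
exists (ritg nu (fun t => p o t * u (e t))).
apply: (itg_le_fin (c := C * (B1 + B2)) _ _).1; first by nn.
apply: (le_trans (le_mom mu (_ : measurable_fun setT (fun r => C * cosh2 l0 r)) u0 uC)); first by mfun.
rewrite momZ// /cosh2 momD; [|exact: measurable_expRM|exact: measurable_expRM| |]; try (by move=> r; exact: expR_ge0).
by rewrite E1 E2 -EFinD -EFinM.
Qed.

Let mpp : measurable_fun setT (fun r : R => pp r). Proof. exact: measurable_maxr0. Qed.
Let mpn : measurable_fun setT (fun r : R => pp (- r)). Proof. exact: measurable_maxrN0. Qed.
Let pp0 (r : R) : 0 <= pp r := max0_ge0 r.
Let e0 (r : R) : 0 <= expR r := expR_ge0 r.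

Lemma mom_zero (u w : R -> R) : measurable_fun setT u -> measurable_fun setT w ->
  (forall r, 0 <= u r) -> (forall r, 0 <= w r) -> (forall r, u r = 0 -> w r = 0) ->
  mom u = 0%E -> mom w = 0%E.
Proof.
move=> mu mw u0 w0 uw; apply: itg_eq0_support; try exact: measurable_mom; try by nn.
move=> t /eqP; rewrite mulf_eq0 => /orP[/eqP ->|/eqP /uw ->]; by rewrite ?mul0r ?mulr0.
Qed.

(** A centred variable that is not almost surely 0 takes both signs with positive
    probability. *)
Lemma mom_pos_gt0 (u : R -> R) : measurable_fun setT u -> (forall r, 0 <= u r) ->
  ((forall r, u r = 0 -> pp r = 0) \/ (forall r, u r = 0 -> pp (- r) = 0)) -> (0 < mom u)%E.
Proof.
move=> mu u0 H; rewrite lt_def; apply/andP; split; last by apply: itg_ge0; nn.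
apply/eqP => Mu; apply: (inc_var I).
have both : mom (fun r => pp r) = 0%E /\ mom (fun r => pp (- r)) = 0%E.
  have mean : mom (fun r => pp r) = mom (fun r => pp (- r)) := inc_mean I.
  case: H => H.
    have E := mom_zero mu mpp u0 pp0 H Mu; by rewrite -mean.
  have E := mom_zero mu mpn u0 (fun r => pp0 (- r)) H Mu; by rewrite mean.
have mD : measurable_fun setT (fun r : R => pp r + pp (- r)) by apply: measurable_funD.
have : mom (fun r => pp r + pp (- r)) = 0%E.
  by rewrite momD// both.1 both.2 adde0.
apply: (mom_zero (w := fun r => r ^+ 2) mD); [by mfun|by nn|by move=> r; exact: sqr_ge0|].
move=> r; have /orP[h|h] := le_total 0 r.
  by have [-> ->] := pp_pos h; rewrite addr0 => ->; rewrite expr0n.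
by have [-> ->] := pp_neg h; rewrite add0r => /eqP; rewrite oppr_eq0 => /eqP ->; rewrite expr0n.
Qed.

Let C := 1 + 4 / l0 ^+ 2.
Let C0 : 0 <= C. Proof. by rewrite addr_ge0// divr_ge0// exprn_ge0// ltW. Qed.

Lemma expR_norm_ge1 (r : R) : 1 <= expR (l0 * `|r|).
Proof. by rewrite -[X in X <= _]expR0 ler_expR mulr_ge0// ltW. Qed.

Lemma mom_fin_quad (u : R -> R) : measurable_fun setT u -> (forall r, 0 <= u r) ->
  (forall r, u r <= (1 + r ^+ 2) * expR (l0 * `|r|)) -> exists B, mom u = B%:E.
Proof.
move=> mu u0 uq; apply: (mom_fin mu u0 _ C0) => r.
exact: le_trans (uq r) (weight_dominated r l0_gt0).
Qed.

Lemma pp_le_quad (r : R) : pp r <= 1 + r ^+ 2.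
Proof.
rewrite ge_max addr_ge0 ?sqr_ge0// andbT.
by have := sqr_ge0 (r - 1); have := sqr_ge0 r; rewrite !expr2; lra.
Qed.

Lemma tilt_base (lam M : R) (u : R -> R) :
  itg nu (fun t => tilt e lam M p o t * u (e t)) = itg nu (fun t => M^-1 * (p o t * (expR (lam * e t) * u (e t)))).
Proof. by apply: eq_itg => t; rewrite /tilt o0 subr0; ring. Qed.

Lemma tilt_measurable (lam M : R) : measurable2 (tilt e lam M p).
Proof.
apply: measurable2M => //; apply: measurable_funM => //.
apply: measurableT_comp => //; apply: measurable_funM => //.
by apply: measurable_funB; [exact: measurable2_snd|exact: measurable2_fst].
Qed.

Lemma tilt_shift (lam M : R) h x y : tilt e lam M p (add x h) (add y h) = tilt e lam M p x y.
Proof.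
rewrite /tilt (inc_shift I) !(embD S); congr (_ * (expR (_ * _) / _)); ring.
Qed.

Lemma tilt_tp2 (lam M : R) : 0 < M -> tp2 e (tilt e lam M p).
Proof.
move=> M0 x x' y y'; rewrite /tilt !(emb_mx, emb_mn).
set a := p x y; set b := p x' y'.
have TP := inc_tp2 I x x' y y'; rewrite -/a -/b in TP.
set X := Num.max (e x) (e x'); set x1 := Num.min (e x) (e x').
set Y := Num.max (e y) (e y'); set y1 := Num.min (e y) (e y').
have EX : X + x1 = e x + e x' by rewrite /X /x1 addr_max_min.
have EY : Y + y1 = e y + e y' by rewrite /Y /y1 addr_max_min.
have F : expR (lam * (e y - e x)) / M * (expR (lam * (e y' - e x')) / M) =
    expR (lam * (Y - X)) / M * (expR (lam * (y1 - x1)) / M).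
  rewrite !mulf_div -!expRD; congr (expR _ / _).
  by rewrite -!mulrDr; congr (_ * _); lra.
rewrite mulrACA [leRHS]mulrACA -F ler_wpM2r//.
by rewrite mulr_ge0 ?divr_ge0 ?expR_ge0 ?ltW.
Qed.

(** By total positivity, the mean of an overshoot, given that there is one, is
    largest when the walk jumps from 0 without tilt; there it is m / g. *)
Lemma tilt_overshoot (lam M m g : R) : 0 <= lam -> 0 < M -> 0 <= m -> 0 < g ->
  mom (fun r => pp (- r)) = m%:E -> mom (fun r => negind r) = g%:E ->
  (forall x, itg nu (tilt e lam M p x) = 1%E) ->
  overshoot nu e (m / g) (tilt e lam M p).
Proof.
move=> l_0 M0 m0 g0 Em Eg mass x x0; set pt := tilt e lam M p.
have ptm : measurable2 pt := tilt_measurable lam M.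
have pt0 u w : 0 <= pt u w by rewrite /pt /tilt mulr_ge0 ?divr_ge0 ?expR_ge0// ltW.
have mneg : measurable_fun setT (fun z => pp (- e z)) by exact: (measurableT_comp mpn em).
have cm := measurable_chi S; have c1 t : 0 <= 1 - chi e t by rewrite subr_ge0 ind_le1.
have FF : (itg nu (fun w => pt x w * pp (- e w))%R * itg nu (fun w => p o w * (1 - chi e w))%R <=
    itg nu (fun w => pt x w * (1 - chi e w))%R * itg nu (fun w => p o w * pp (- e w))%R)%E.
  apply: (@four_functions _ _ _ nu e); try (by mfun); try (by nn).
  move=> s t.
  have TP := inc_tp2 I x o s t.
  rewrite (mx_l S) ?o0// in TP; rewrite (mn_r S) ?o0// in TP.
  have [s0|s0] := leP 0 (e s).
    have [_ ->] := pp_pos s0; rewrite mulr0 mul0r; nn.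
  have [t0'|t0'] := leP 0 (e t).
    by rewrite [chi e t](chi1 t0') subrr !mulr0; nn.
  have mx0 : e (mx e s t) < 0 by rewrite emb_mx gt_max s0 t0'.
  rewrite (chi0 t0') (chi0 mx0) !subr0 !mulr1.
  have -> : pt x s * pp (- e s) * p o t =
     (p x s * p o t) * (pp (- e s) * (expR (lam * (e s - e x)) / M)) by rewrite /pt /tilt; ring.
  have -> : pt x (mx e s t) * (p o (mn e s t) * pp (- e (mn e s t))) =
     (p x (mx e s t) * p o (mn e s t)) * (pp (- e (mn e s t)) * (expR (lam * (e (mx e s t) - e x)) / M)).
    by rewrite /pt /tilt; ring.
  apply: ler_pM; [by nn|by rewrite !mulr_ge0 ?expR_ge0// invr_ge0 ltW|exact: TP|].
  apply: ler_pM => //; first by rewrite divr_ge0 ?expR_ge0// ltW.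
    have [_ ->] := pp_neg (ltW s0); have mn0 : e (mn e s t) <= 0 by rewrite emb_mn ge_min (ltW s0).
    by have [_ ->] := pp_neg mn0; rewrite lerN2 emb_mn ge_min lexx.
  rewrite ler_wpM2r ?invr_ge0 ?(ltW M0)// ler_expR ler_wpM2l// lerD2r emb_mx.
  by rewrite le_max lexx.
have [Y YE] : exists Y, itg nu (fun w => pt x w * (1 - chi e w)) = Y%:E.
  exists (ritg nu (fun w => pt x w * (1 - chi e w))); apply: (itg_le_fin (c := 1) _ _).1; first by nn.
  have mx1 := measurable2_row x ptm.
  rewrite -[1%:E](mass x); apply: le_itg => [||t|t]; [by mfun|by mfun|by nn|].
  by rewrite ler_piMr// gerBl ind_ge0.
have E1 : itg nu (fun w => p o w * (1 - chi e w)) = g%:E.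
  rewrite -Eg; apply: eq_itg => t; congr (_ * _); rewrite /negind.
  by case: ltP => h; [rewrite (chi0 h) subr0|rewrite (chi1 h) subrr].
have E2 : itg nu (fun w => p o w * pp (- e w)) = m%:E by rewrite -Em.
rewrite YE E1 E2 -EFinM in FF; rewrite YE -EFinM.
have X0 : (0 <= itg nu (fun w => pt x w * pp (- e w))%R)%E by apply: itg_ge0; nn.
case: (itg nu (fun w => pt x w * pp (- e w))) X0 FF => [X _|_|//].
- by rewrite -EFinM !lee_fin mulrAC ler_pdivlMr// [m * Y]mulrC.
- by rewrite gt0_mulye// leye_eq.
Qed.

(** All constants are moments of the increment under the weight exp(l0 |r|), which
    dominates every tilt in the range. The drift divided by lam lies between s / M1
    and Q1, where s is the second moment of the positive part. *)
Lemma family_exists : exists c1 c2 v0 v1 C0' : R,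
  [/\ 0 < c1, c1 <= c2, 0 < v0, v0 <= v1 & 0 <= C0'] /\ fam l0 c1 c2 v0 v1 C0' p.
Proof.
have q0 (r : R) : 0 <= 1 + r ^+ 2 by rewrite addr_ge0// sqr_ge0.
have q1 (r : R) : 1 <= 1 + r ^+ 2 by rewrite lerDl sqr_ge0.
have mE0 := measurable_expR_norm l0.
have mE := measurable_expRM.
have [M1 EM1] : exists B, mom (fun r => expR (l0 * `|r|)) = B%:E.
  by apply: mom_fin_quad => // r; rewrite ler_peMl.
have [Q1 EQ1] : exists B, mom (fun r => r ^+ 2 * expR (l0 * `|r|)) = B%:E.
  apply: mom_fin_quad; [by mfun|by nn|] => r.
  by rewrite ler_wpM2r// lerDr.
have [m Em] : exists B, mom (fun r => pp r) = B%:E.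
  apply: mom_fin_quad => // r; apply: (le_trans (pp_le_quad r)).
  by rewrite ler_peMr// expR_norm_ge1.
have Em' : mom (fun r => pp (- r)) = m%:E by rewrite -Em; exact/esym/(inc_mean I).
have [s Es] : exists B, mom (fun r => pp r ^+ 2) = B%:E.
  apply: mom_fin_quad => [|r|r]; [by mfun|exact: sqr_ge0|].
  apply: (@le_trans _ _ (1 + r ^+ 2)); last by rewrite ler_peMr// expR_norm_ge1.
  have /orP[h|h] := le_total 0 r; [have [-> _] := pp_pos h|have [-> _] := pp_neg h].
    by rewrite lerDr.
  by rewrite expr0n.
have s_gt0 : 0 < s.
  rewrite -lte_fin -Es; apply: mom_pos_gt0; [by mfun|by nn|left=> r /eqP].
  by rewrite sqrf_eq0 => /eqP.
have [w Ew] : exists B, mom (fun r => pp (- r) ^+ 2 * expR (l0 * r)) = B%:E.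
  apply: mom_fin_quad => [|r|r]; [by mfun|by nn|].
  apply: ler_pM => //; first exact: sqr_ge0.
    have /orP[h|h] := le_total 0 r; [have [_ ->] := pp_pos h|have [_ ->] := pp_neg h].
      by rewrite expr0n.
    by rewrite sqrrN lerDr.
  by apply: tilt_dominated; rewrite lexx ltW.
have w_gt0 : 0 < w.
  rewrite -lte_fin -Ew; apply: mom_pos_gt0; [by mfun|by nn|right=> r /eqP].
  by rewrite mulf_eq0 sqrf_eq0 (gt_eqF (expR_gt0 _)) orbF => /eqP.
have M1_ge1 : 1 <= M1.
  rewrite -lee_fin -EM1 -[X in (X <= _)%E](inc_mass I).
  have -> : itg nu (p o) = mom (fun=> 1) by apply: eq_itg => t; rewrite mulr1.
  by apply: le_mom => // r; exact: expR_norm_ge1.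
have M1_gt0 : 0 < M1 := lt_le_trans ltr01 M1_ge1.
have mni : measurable_fun setT (@negind R) by apply: measurable_fun_ifT => //; exact: measurable_fun_ltr.
have ni0 (r : R) : 0 <= negind r by rewrite /negind; case: ifP.
have ni1 (r : R) : negind r <= 1 by rewrite /negind; case: ifP.
have [g Eg] : exists B, mom (fun r => negind r) = B%:E.
  apply: mom_fin_quad => [|r|r]; [exact: mni|exact: ni0|].
  apply: (@le_trans _ _ (1 * 1)); first by rewrite mulr1; exact: ni1.
  by apply: ler_pM => //; exact: expR_norm_ge1.
have g_gt0 : 0 < g.
  rewrite -lte_fin -Eg; apply: mom_pos_gt0 => [|r|]; [exact: mni|exact: ni0|right=> r].
  rewrite /negind; case: (ltP r 0) => [_ /eqP|h _]; first by rewrite oner_eq0.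
  by have [_ ->] := pp_pos h.
have m0 : 0 <= m by rewrite -lee_fin -Em; apply: itg_ge0; nn.
have Q1_0 : 0 <= Q1 by rewrite -lee_fin -EQ1; apply: itg_ge0; nn.
have tilts (lam : R) : 0 <= lam <= l0 -> exists M b v : R,
    [/\ 1 <= M, s / M1 * lam <= b <= Q1 * lam, w / M1 <= v <= Q1,
      walk (tilt e lam M p) b v & overshoot nu e (m / g) (tilt e lam M p)].
  move=> ll0; have [l_0 l_1] := andP ll0; have dom r := tilt_dominated r ll0.
  have quad (u : R -> R) : measurable_fun setT u -> (forall r, 0 <= u r) -> (forall r, u r <= 1 + r ^+ 2) ->
      exists B, mom (fun r => expR (lam * r) * u r) = B%:E.
    move=> mu u0 u1; apply: mom_fin_quad; [|by nn|].
      by apply: measurable_funM.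
    by move=> r; rewrite mulrC; apply: ler_pM.
  have [M EM] : exists B, mom (fun r => expR (lam * r) * 1) = B%:E by apply: quad.
  have [A1 EA1] : exists B, mom (fun r => expR (lam * r) * pp r) = B%:E by apply: quad => //; exact: pp_le_quad.
  have [A2 EA2] : exists B, mom (fun r => expR (lam * r) * pp (- r)) = B%:E.
    by apply: quad => // r; rewrite -(sqrrN r); exact: pp_le_quad.
  have [Q EQ] : exists B, mom (fun r => expR (lam * r) * r ^+ 2) = B%:E.
    by apply: quad => [|r|r]; [mfun|exact: sqr_ge0|rewrite lerDr].
  have mEl := mE lam.
  have M_1 : 1 <= M.
    have : (mom (fun r => 1 + lam * pp r)%R <= mom (fun r => expR (lam * r) * 1 + lam * pp (- r))%R)%E.
      by apply: le_mom => [|||r]; [mfun|mfun|nn|rewrite mulr1; exact: tilt_mass_lower].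
    rewrite !momD//; try (by mfun); try (by nn).
    rewrite !momZ// EM Em Em' (_ : mom (fun=> 1) = 1%:E).
      by rewrite -!EFinM -!EFinD lee_fin; lra.
    by rewrite -[RHS](inc_mass I); apply: eq_itg => t; rewrite mulr1.
  have M_M1 : M <= M1.
    rewrite -lee_fin -EM -EM1; apply: le_mom => [||r|r]; [by mfun|exact: mE0|by nn|].
    by rewrite mulr1.
  have M_0 : 0 < M := lt_le_trans ltr01 M_1.
  have A1lo : m + lam * s <= A1.
    rewrite -lee_fin EFinD EFinM -Em -Es -EA1 -momZ//; try (by mfun); try (by nn).
    rewrite -momD//; try (by mfun); try (by nn).
    apply: le_mom => [|||r]; [by mfun|by mfun|by nn|].
    by rewrite [leRHS]mulrC; exact: tilt_pos_part.
  have A2up : A2 <= m.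
    rewrite -lee_fin -Em' -EA2; apply: le_mom => [|||r]; [by mfun|by mfun|by nn|].
    by rewrite mulrC; exact: tilt_neg_part.
  have A12 : A1 <= A2 + lam * Q1.
    have : (mom (fun r => expR (lam * r) * pp r + pp (- r))%R <=
        mom (fun r => (expR (lam * r) * pp (- r) + pp r) + lam * (r ^+ 2 * expR (l0 * `|r|)))%R)%E.
      apply: le_mom => [|||r]; [by mfun|by mfun|by nn|].
      by rewrite mulrC [expR _ * pp (- r)]mulrC; exact: tilt_mean_upper.
    rewrite !momD//; try (by mfun); try (by nn).
    rewrite momZ//; try (by mfun); try (by nn).
    by rewrite EA1 EA2 Em Em' EQ1 -EFinM -!EFinD lee_fin; lra.
  have QQ1 : Q <= Q1.
    rewrite -lee_fin -EQ -EQ1; apply: le_mom => [|||r]; [by mfun|by mfun|by nn|].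
    by rewrite mulrC ler_wpM2l// sqr_ge0.
  pose pt := tilt e lam M p.
  have scaled (u : R -> R) B : measurable_fun setT u -> (forall r, 0 <= u r) ->
      mom (fun r => expR (lam * r) * u r) = B%:E -> itg nu (fun t => pt o t * u (e t)) = (M^-1 * B)%:E.
    move=> mu u0 EB; rewrite tilt_base itgZ ?invr_ge0 ?(ltW M_0)//; try (by nn).
      by rewrite EFinM -EB.
    by apply: (@measurable_mom (fun r => expR (lam * r) * u r)); mfun.
  have pt0 u z : 0 <= pt u z by rewrite /pt /tilt mulr_ge0 ?divr_ge0 ?expR_ge0// ltW.
  have mass : itg nu (pt o) = 1%E.
    have := scaled (fun=> 1) M (measurable_cst _) (fun=> ler01) EM.
    by under eq_itg do rewrite mulr1; rewrite mulVf ?gt_eqF.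
  have S1 := scaled _ _ mpp pp0 EA1.
  have S2 := scaled _ _ mpn (fun r => pp0 (- r)) EA2.
  have S3 := scaled (fun r => r ^+ 2) _ (measurable_funX 2 (@measurable_id _ _ _)) (fun r => sqr_ge0 r) EQ.
  have [b bE] : exists b, b = M^-1 * A1 - M^-1 * A2 by exists (M^-1 * A1 - M^-1 * A2).
  have bM : b * M = A1 - A2 by rewrite bE -mulrBr mulrAC mulVf ?mul1r ?gt_eqF.
  have b_lo : s / M1 * lam <= b.
    have ls : lam * s <= b * M by rewrite bM; lra.
    have ls0 : 0 <= lam * s by rewrite mulr_ge0// ltW.
    rewrite mulrAC ler_pdivrMr//.
    have b0 : 0 <= b by rewrite -(pmulr_lge0 _ M_0) (le_trans ls0).
    by rewrite [leLHS]mulrC (le_trans ls)// ler_wpM2l.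
  have b0 : 0 <= b by apply: le_trans b_lo; rewrite mulr_ge0// divr_ge0 ?ltW.
  have b_up : b <= Q1 * lam.
    apply: (@le_trans _ _ (b * M)); first by rewrite ler_peMr.
    by rewrite bM; lra.
  have mpt : measurable_fun setT (pt o) := measurable2_row o (tilt_measurable lam M).
  have varE := square_expansion S (- b) mpt (pt0 o) mass S1 S2 S3; rewrite -bE in varE.
  have V_lo : w / M1 <= M^-1 * Q - b ^+ 2.
    have : (w%:E <= mom (fun r => expR (lam * r) * (r + - b) ^+ 2)%R)%E.
      rewrite -Ew; apply: le_mom => [|||r]; [by mfun|by mfun|by nn|].
      by rewrite [leRHS]mulrC; exact: tilt_var_lower.
    have -> : mom (fun r => expR (lam * r) * (r + - b) ^+ 2) = (M * (M^-1 * Q - b ^+ 2))%:E.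
      rewrite (_ : M^-1 * Q - b ^+ 2 = M^-1 * Q + (- b) ^+ 2 + 2 * - b * b); last by ring.
      rewrite EFinM -varE (tilt_base lam M (fun r => (r + - b) ^+ 2)) -itgZ; last exact: ltW.
      - by apply: eq_itg => t; rewrite [RHS]mulrA divff ?mul1r ?gt_eqF.
      - by apply: measurable_funM => //; apply: (@measurable_mom (fun r => expR (lam * r) * (r + - b) ^+ 2)); mfun.
      - by nn.
    rewrite lee_fin => h; rewrite ler_pdivrMr//.
    have V0 : 0 <= M^-1 * Q - b ^+ 2 by rewrite -(pmulr_rge0 _ M_0) (le_trans (ltW w_gt0)).
    by rewrite (le_trans h)// mulrC ler_wpM2l.
  have V_up : M^-1 * Q - b ^+ 2 <= Q1.
    have Q0 : 0 <= Q by rewrite -lee_fin -EQ; apply: itg_ge0; nn.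
    have : M^-1 * Q <= Q by rewrite ler_piMl// invf_le1.
    by have := sqr_ge0 b; lra.
  have V_gt0 : 0 < M^-1 * Q - b ^+ 2 by apply: lt_le_trans V_lo; rewrite divr_gt0.
  have W := walk_of_moments S o0 (tilt_measurable lam M) pt0 (tilt_shift lam M) (tilt_tp2 lam M_0) mass S1 S2 S3.
  rewrite -bE in W; have {}W := W V_gt0.
  exists M, b, (M^-1 * Q - b ^+ 2); split=> //; [by rewrite b_lo|by rewrite V_lo|].
  by apply: (tilt_overshoot l_0 M_0 m0 g_gt0 Em' Eg); exact: ds_row (walk_ds W).
have l00 : 0 <= l0 <= l0 by rewrite lexx ltW.
have [_ [b [v [_ /andP[b1 b2] /andP[v_1 v_2] _ _]]]] := tilts l0 l00.
exists (s / M1), Q1, (w / M1), Q1, (m / g); split.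
  split; [by pos| |by pos|exact: le_trans v_1 v_2|by nn].
  by rewrite -(ler_pM2r l0_gt0) (le_trans b1).
have z00 : 0 <= (0 : R) <= l0 by rewrite lexx ltW.
have [M0 [b0 [v' [M0_1 /andP[b01 b02] v0' W0 O0]]]] := tilts 0 z00.
have b0E : b0 = 0 by apply/eqP; rewrite eq_le -{1}(mulr0 Q1) b02 -(mulr0 (s / M1)) b01.
have M0E : M0 = 1.
  have := ds_row (walk_ds W0) o.
  have -> : tilt e 0 M0 p o = fun t => M0^-1 * p o t.
    by apply/funext => t; rewrite /tilt mul0r expR0 mul1r mulrC.
  rewrite itgZ ?invr_ge0 ?(le_trans ler01 M0_1)// (inc_mass I) mule1 => -[E].
  by rewrite -[M0]invrK E invr1.
have pE : tilt e 0 M0 p = p.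
  by apply/funext => x; apply/funext => y; rewrite /tilt mul0r expR0 M0E divr1 mulr1.
rewrite pE b0E in W0; rewrite pE in O0.
by split => //; exists v'.
Qed.
End Family.

(** * From kernels to bridges *)

Section Bridge.
Context d (T : measurableType d) (R : realType).
Variable nu : {sigma_finite_measure set T -> \bar R}.
Variables (e : T -> R) (add : T -> T -> T) (opp : T -> T).
Hypothesis S : state_space nu e add opp.
Let em := emb_meas S.
Let K1 := no_killing T R.
Local Notation k p := (kern nu p (fun=> 1)).
Local Notation chi := (chi e).
Local Notation q p := (kern nu p chi).
Let Kc := chi_killing S.
Local Notation fam := (tilted_family nu e add).

(** A walk and its reversal come with different constants; this makes them common. *)
Lemma fam_weaken l0 c1 c2 v0 v1 C0 c1' c2' v0' v1' C0' p : 0 <= l0 ->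
  c1' <= c1 -> c2 <= c2' -> v0' <= v0 -> v1 <= v1' -> C0 <= C0' ->
  (forall x y, 0 <= p x y) ->
  fam l0 c1 c2 v0 v1 C0 p -> fam l0 c1' c2' v0' v1' C0' p.
Proof.
move=> l00 c1c c2c v0v v1v CC p0 [[v /andP[va vb] W] O H].
have weaken p' : (forall x y, 0 <= p' x y) -> overshoot nu e C0 p' -> overshoot nu e C0' p'.
  move=> p'0 O' x x0; apply: (le_trans (O' x x0)); apply: lee_wpmul2r.
    by apply: itg_ge0 => t; rewrite mulr_ge0// subr_ge0 ind_le1.
  by rewrite lee_fin.
split; [exists v => //; apply/andP; split; lra|exact: weaken|].
move=> lam /[dup] ll /andP[lam_0 _]; have [M [b [u [M1 /andP[b1 b2] /andP[u1 u2] W' O']]]] := H lam ll.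
exists M, b, u; split=> //.
- apply/andP; split; [apply: le_trans b1|apply: (le_trans b2)]; by rewrite ler_wpM2r.
- apply/andP; split; lra.
- by apply: weaken => // x y; exact: ds_ge0 (walk_ds W') x y.
Qed.

Variable o : T.
Hypothesis o0 : e o = 0.

Theorem increments_bounds p t0 : 0 < t0 -> increments nu e add o p t0 ->
  exists c C : R, [/\ 0 < c, 0 < C & forall x y n, 0 <= e x -> 0 <= e y ->
    c * Num.min 1 (e x * e y / n.+1%:R) * k p n x y <= q p n x y /\
    q p n x y <= C * ((e x + 1) * (e y + 1) / n.+1%:R) * k p n x y].
Proof.
move=> t00 I; pose l0 := Num.min (1 / 2) (t0 / 4).
have l0_gt0 : 0 < l0 by rewrite lt_min; apply/andP; split; lra.
have l0_half : l0 <= 1 / 2 by rewrite ge_min lexx.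
have l0t0 : 2 * l0 < t0.
  have : l0 <= t0 / 4 by rewrite ge_min lexx orbT.
  lra.
have I' := increments_rev S o0 I.
have [c1 [c2 [v0 [v1 [C0 [[c10 c12 v00 v01 C00] F]]]]]] := family_exists S o0 I l0_gt0 l0t0.
have [c1' [c2' [v0' [v1' [C0' [[c10' c12' v00' v01' C00'] F']]]]]] := family_exists S o0 I' l0_gt0 l0t0.
pose d1 := Num.min c1 c1'; pose d2 := Num.max c2 c2'; pose w0 := Num.min v0 v0'.
pose w1 := Num.max v1 v1'; pose D0 := Num.max C0 C0'.
have d10 : 0 < d1 by rewrite lt_min c10 c10'.
have d1c : d1 <= c1 by rewrite ge_min lexx.
have d1c' : d1 <= c1' by rewrite ge_min lexx orbT.
have d2c : c2 <= d2 by rewrite le_max lexx.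
have d2c' : c2' <= d2 by rewrite le_max lexx orbT.
have w00 : 0 < w0 by rewrite lt_min v00 v00'.
have w0v : w0 <= v0 by rewrite ge_min lexx.
have w0v' : w0 <= v0' by rewrite ge_min lexx orbT.
have w1v : v1 <= w1 by rewrite le_max lexx.
have w1v' : v1' <= w1 by rewrite le_max lexx orbT.
have D0C : C0 <= D0 by rewrite le_max lexx.
have D0C' : C0' <= D0 by rewrite le_max lexx orbT.
have d12 : d1 <= d2 by rewrite (le_trans d1c)// (le_trans c12).
have w01 : w0 <= w1 by rewrite (le_trans w0v)// (le_trans v01).
have D00 : 0 <= D0 by apply: le_trans D0C.
have Fp : fam l0 d1 d2 w0 w1 D0 p.
  by apply: fam_weaken F => //; [exact: ltW|exact: inc_ge0 I].
have Fr : fam l0 d1 d2 w0 w1 D0 (rev p).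
  by apply: fam_weaken F' => //; [exact: ltW|exact: inc_ge0 I'].
have [C [Cp HC]] := kern_upper S l0_gt0 d10 d12 w00 w01 D00.
have [c cp Hc] := kern_lower S o0 l0_gt0 l0_half d10 d12 w00 w01 D00 Fp Fr.
exists c, C; split=> // x y n x0 y0; split; first exact: Hc.
exact: HC.
Qed.

Variable H : R -> \bar R.
Hypothesis H_ninfty : forall z, H z != -oo%E.

(** The convention exp(-oo) = 0 makes this finite although [H] may be infinite. *)
Definition weight x y : R := fine (expeR (- H (e y - e x))).

Lemma weightE x y : (weight x y)%:E = expeR (- H (e y - e x)).
Proof.
rewrite fineK// ge0_fin_numE ?expeR_ge0//.
by rewrite ltey expeR_eqy; case: (H _) (H_ninfty (e y - e x)).
Qed.

Lemma weight_ge0 x y : 0 <= weight x y.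
Proof. by rewrite fine_ge0// expeR_ge0. Qed.

Hypotheses (wm : measurable2 weight) (wtp : tp2 e weight).
Hypothesis mom_H : moment_assumption nu e H.

Let Z := fine (rw_mass nu e H).

Lemma rw_massE : rw_mass nu e H = itg nu (weight o).
Proof. by apply: eq_integral => t _; rewrite weightE o0 subr0. Qed.

Lemma mass_fin : rw_mass nu e H = Z%:E.
Proof.
case: mom_H => /andP[Z0 Zy] _ _ _; rewrite /Z fineK// ge0_fin_numE//; exact: ltW.
Qed.

Lemma mass_gt0 : 0 < Z.
Proof. by case: mom_H => /andP[Z0 _] _ _ _; rewrite -lte_fin -mass_fin. Qed.

Definition step x y : R := weight x y / Z.

Lemma step_ge0 x y : 0 <= step x y.
Proof. by rewrite divr_ge0 ?weight_ge0// ltW// mass_gt0. Qed.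

Lemma measurable_step : measurable2 step.
Proof. by apply: measurable2M => //; exact: measurable_cst. Qed.

Lemma rw_expectationE f : rw_expectation nu e H f = (\int[nu]_t (step o t * f (e t))%:E)%E.
Proof.
apply: eq_integral => t _; rewrite /step EFinM EFinM weightE o0 subr0 -/Z.
by rewrite muleC.
Qed.

(** The hypotheses on the increment distribution, seen as statements on integrals of
    nonnegative functions. *)
Lemma step_increments : exists2 t0, 0 < t0 & increments nu e add o step t0.
Proof.
have Z0 := mass_gt0; have s0 := step_ge0; have ms := measurable2_row o measurable_step.
case: mom_H => _ mean /andP[var0 vary] [t0 t00 mgf].
have mpp := @measurable_maxr0 R; have mpn := @measurable_maxrN0 R.
have mass : itg nu (step o) = 1%E.
  have mw := measurable2_row o wm.
  rewrite (eq_itg nu (g := fun t => Z^-1 * weight o t)); last by move=> t; rewrite mulrC.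
  rewrite itgZ ?invr_ge0 ?(ltW Z0)//; last exact: weight_ge0.
  by rewrite -rw_massE mass_fin -EFinM mulVf ?gt_eqF.
have varE : rw_variance nu e H = itg nu (fun t => step o t * e t ^+ 2).
  by rewrite /rw_variance rw_expectationE mean; apply: eq_itg => t; rewrite subr0.
rewrite varE in var0 vary.
exists t0 => //; split.
- exact: s0.
- exact: measurable_step.
- by move=> h x y; rewrite /step /weight !(embD S); congr (fine (expeR (- H _)) / _); ring.
- move=> x x' y y'; rewrite /step mulrACA [leRHS]mulrACA ler_wpM2r//.
  by rewrite mulr_ge0 ?invr_ge0 ?ltW.
- exact: mass.
- have fin (u : T -> R) : measurable_fun setT u -> (forall t, 0 <= u t) ->
      (forall t, u t <= 1 + e t ^+ 2) -> exists B, itg nu (fun t => step o t * u t) = B%:E.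
    move=> mu u0 u1; exists (ritg nu (fun t => step o t * u t)); apply: itg_fin; first by nn.
    apply: (@le_lt_trans _ _ (itg nu (fun t => step o t + step o t * e t ^+ 2))).
      apply: le_itg => [||t|t]; [by mfun|by mfun|by nn|].
      by rewrite -[X in X + _]mulr1 -mulrDr ler_wpM2l.
    rewrite itgD//; try (by mfun); try (by nn).
    by rewrite mass; apply: lte_add_pinfty => //; rewrite ltry.
  have [B1 E1] : exists B, itg nu (fun t => step o t * Num.max (e t) 0) = B%:E.
    apply: fin => [|t|t]; [exact: (measurableT_comp mpp em)|exact: max0_ge0|exact: pp_le_quad].
  have [B2 E2] : exists B, itg nu (fun t => step o t * Num.max (- e t) 0) = B%:E.
    apply: fin => [|t|t]; [exact: (measurableT_comp mpn em)|exact: max0_ge0|].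
    by rewrite -sqrrN; exact: pp_le_quad.
  have : rw_mean nu e H = (B1%:E - B2%:E)%E.
    rewrite /rw_mean rw_expectationE integralE -E1 -E2; congr (_ - _)%E; apply: eq_integral => t _.
      by rewrite funeposE -EFin_max maxr_pMr// mulr0.
    by rewrite funenegE -EFinN -EFin_max -mulrN maxr_pMr// mulr0.
  rewrite mean -EFinB E1 E2 => -[h]; congr EFin; lra.
- by move=> h; rewrite h ltxx in var0.
- by move=> s st; have := mgf s st; rewrite rw_expectationE.
Qed.

Section IteratedIntegral.
Variables (A : nat -> set (nat -> T)) (c : T -> R).
Hypotheses (Kil : killing c) (Pst : doubly_stochastic nu step).
Hypothesis A1 : forall x y, A 1%N (trajectory x y [::]).
Hypothesis AS : forall n x y t s, (\1_(A n.+2) (trajectory x y (t :: s)) : R) =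
  c t * \1_(A n.+1) (trajectory t y s).

Lemma bridge_weight_cons n x y t s :
  bridge_weight e H n.+2 (trajectory x y (t :: s)) =
  ((weight x t)%:E * bridge_weight e H n.+1 (trajectory t y s))%E.
Proof.
rewrite /bridge_weight big_ord_recl weightE -expeRD oppeD//.
have [Ha Hb] : H (e t - e x) != -oo%E /\ (\sum_(j < n.+1) H (e (trajectory t y s j.+1) -
    e (trajectory t y s j)) != -oo)%E.
  split; first exact: H_ninfty.
  by elim/big_ind: _ => // a b; case: a b => [a||] [b||].
by rewrite /adde_def !negb_and Ha Hb orbT.
Qed.

(** Each step contributes a factor [Z] when the weight is normalised. The coefficient
    [b] carries the factors of the steps already made through the iterated integral. *)
Lemma iter_bridge n x y (b : R) : 0 <= b ->
  iter_integral nu n (fun s => b%:E * (bridge_weight e H n.+1 (trajectory x y s) *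
     (\1_(A n.+1) (trajectory x y s))%:E))%E = (b * (Z ^+ n.+1 * kern nu step c n x y))%:E.
Proof.
have Z0 := mass_gt0.
elim: n x b => [|n IH] x b b0.
  rewrite /= /bridge_weight big_ord1 indicE mem_set// mule1 expr1 /trajectory/= -weightE -EFinM.
  by congr (_ * _)%:E; rewrite /step mulrC divfK ?gt_eqF.
have w0 := weight_ge0; have c0 := kill_ge0 Kil; have cm := kill_meas Kil.
have mk := kern_col Pst Kil n y; have k0 t := kern_ge0 Pst Kil n t y.
transitivity (itg nu (fun t => (b * Z ^+ n.+2) * (step x t * c t * kern nu step c n t y))).
  apply: eq_integral => t _.
  transitivity (iter_integral nu n (fun s => (b * weight x t * c t)%:E *
      (bridge_weight e H n.+1 (trajectory t y s) * (\1_(A n.+1) (trajectory t y s))%:E))%E).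
    congr iter_integral; apply/funext => s; rewrite bridge_weight_cons AS.
    rewrite !EFinM -!muleA; congr (_ * (_ * _))%E; rewrite !muleA; congr (_ * _)%E; exact: muleC.
  rewrite IH; last by rewrite !mulr_ge0.
  congr EFin; rewrite (exprS Z n.+1) /step; field.
  by rewrite gt_eqF.
have ss := step_ge0; have sm := measurable_step.
rewrite itgZ; [|by mfun|by nn|by rewrite mulr_ge0 ?exprn_ge0 ?(ltW Z0)].
by rewrite -(kernSE Pst Kil) -EFinM mulrA.
Qed.
End IteratedIntegral.

Lemma bridge_integral_free (Pst : doubly_stochastic nu step) n x y :
  bridge_integral nu e H n.+1 x y setT = (Z ^+ n.+1 * k step n x y)%:E.
Proof.
have := @iter_bridge (fun=> setT) (fun=> 1) K1 Pst _ _ n x y 1 ler01; rewrite mul1r => <-.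
- by congr iter_integral; apply/funext => s; rewrite mul1e.
- by [].
- by move=> *; rewrite !indicE !mem_set// mulr1.
Qed.

Lemma bridge_integral_killed (Pst : doubly_stochastic nu step) n x y :
  bridge_integral nu e H n.+1 x y (stays_nonneg e n.+1) = (Z ^+ n.+1 * q step n x y)%:E.
Proof.
have := @iter_bridge (stays_nonneg e) chi Kc Pst _ _ n x y 1 ler01; rewrite mul1r => <-.
- by congr iter_integral; apply/funext => s; rewrite mul1e.
- by move=> u w m /= /andP[m1 m0]; have := leq_trans m1 m0.
move=> m u w t s; rewrite !indicE.
have [t0|t0] := leP 0 (e t); last first.
  rewrite (chi0 t0) mul0r memNset// => /(_ 1%N isT) /=.
  by rewrite leNgt t0.
rewrite (chi1 t0) mul1r; congr (nat_of_bool _)%:R.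
apply/idP/idP; rewrite !in_setE /stays_nonneg /= => h.
  by move=> i /andP[i1 im]; have := h i.+1; apply; rewrite /= ltnS.
by case=> [//|[_ //|i]] /andP[_ im]; exact: (h i.+1).
Qed.

(** The powers of [Z] cancel in the quotient, and a bridge that is well defined has
    p_n(x, y) > 0. *)
Theorem bridge_bounds : exists c C : R, [/\ 0 < c, 0 < C & forall x y N,
  0 <= e x -> 0 <= e y -> (0 < N)%N -> bridge_defined nu e H N x y ->
  [/\ c * Num.min 1 (e x * e y / N%:R) <= bridge_prob nu e H N x y (stays_nonneg e N),
      bridge_prob nu e H N x y (stays_nonneg e N) <= 1 &
      bridge_prob nu e H N x y (stays_nonneg e N) <= C * ((e x + 1) * (e y + 1) / N%:R)]].
Proof.
have [t0 t00 I] := step_increments.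
have [c [C [c0 C0 B]]] := increments_bounds t00 I.
have Pst : doubly_stochastic nu step.
  have l0 : 0 < t0 / 4 by lra.
  have l1 : 2 * (t0 / 4) < t0 by lra.
  have [? [? [? [? [? [_ F]]]]]] := family_exists S o0 I l0 l1.
  by have [v _ W] := fam_base F; exact: walk_ds W.
exists c, C; split=> // x y [//|n] x0 y0 _ /andP[Bd _].
have [lo up] := B x y n x0 y0.
rewrite bridge_integral_free// lte_fin in Bd.
have Zn : 0 < Z ^+ n.+1 by rewrite exprn_gt0// mass_gt0.
rewrite (pmulr_rgt0 _ Zn) in Bd.
have -> : bridge_prob nu e H n.+1 x y (stays_nonneg e n.+1) = q step n x y / k step n x y.
  rewrite /bridge_prob bridge_integral_killed// bridge_integral_free//=.
  by rewrite -mulf_div divff ?mul1r ?gt_eqF.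
split.
- by rewrite ler_pdivlMr.
- by rewrite ler_pdivrMr// mul1r; exact: kern_le_free.
- by rewrite ler_pdivrMr.
Qed.
End Bridge.

(** * Consequences of convexity *)

Section Convex.
Context (R : realType) (f : R -> \bar R).
Hypothesis f_convex : convex_ereal f.

(** Spreading two points apart with fixed sum increases the sum of the values of a
    convex function. *)
Lemma convex_between a b u v : f a != -oo%E -> f b != -oo%E ->
  a <= u <= b -> u + v = a + b -> (f u + f v <= f a + f b)%E.
Proof.
move=> fa fb /andP[au ub] uv; have [ab|ba] := ltP a b; last first.
  have ua : u = a by lra.
  have va : v = b by lra.
  by rewrite ua va.
have ba : 0 < b - a by lra.
pose t := (b - u) / (b - a).
have t0 : 0 <= t by rewrite divr_ge0//; lra.
have t1 : t <= 1 by rewrite ler_pdivrMr//; lra.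
have uE : u = t * a + (1 - t) * b by rewrite /t; field; lra.
have vE : v = (1 - t) * a + (1 - (1 - t)) * b.
  have -> : v = a + b - u by lra.
  by rewrite uE; ring.
have hu : (f u <= t%:E * f a + (1 - t)%:E * f b)%E by rewrite uE; apply: f_convex; lra.
have hv : (f v <= (1 - t)%:E * f a + (1 - (1 - t))%:E * f b)%E.
  by rewrite vE; apply: f_convex; lra.
case: (f a) fa hu hv => [r||] // _; last by rewrite addye ?leey.
case: (f b) fb => [s||] // _ hu hv; last by rewrite addey ?leey.
apply: (le_trans (leeD hu hv)); rewrite -!EFinM -!EFinD lee_fin; lra.
Qed.

Lemma convex_sublevel a b u c : f a != -oo%E -> f b != -oo%E -> a <= u <= b ->
  (f a <= c)%E -> (f b <= c)%E -> (f u <= c)%E.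
Proof.
move=> fa fb aub fac fbc.
case: c fac fbc => [c||] fac fbc; last 2 first.
- by rewrite leey.
- by move: fac fa; rewrite leeNy_eq => ->.
have [ab|ba] := ltP a b; last first.
  have -> : u = a by lra.
  exact: fac.
have ba : 0 < b - a by lra.
pose t := (b - u) / (b - a).
have t0 : 0 <= t by rewrite divr_ge0//; lra.
have t1 : t <= 1 by rewrite ler_pdivrMr//; lra.
have uE : u = t * a + (1 - t) * b by rewrite /t; field; lra.
have : (f u <= t%:E * f a + (1 - t)%:E * f b)%E by rewrite uE; apply: f_convex; lra.
move/le_trans; apply.
case: (f a) fa fac => [r||] // _ rc; case: (f b) fb fbc => [s||] // _ sc.
rewrite -!EFinM -!EFinD lee_fin; rewrite lee_fin in rc; rewrite lee_fin in sc.
have : t * r <= t * c by rewrite ler_wpM2l.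
have : (1 - t) * s <= (1 - t) * c by rewrite ler_wpM2l//; lra.
lra.
Qed.
End Convex.

Section Weight.
Context d (T : measurableType d) (R : realType) (e : T -> R) (H f : R -> \bar R).
Hypotheses (H_ninfty : forall z, H z != -oo%E) (f_convex : convex_ereal f).
Hypothesis fH : forall x y, f (e y - e x) = H (e y - e x).

(** The increments y - x and y' - x' have the same sum as the increments between the
    maxima and between the minima, and these are less spread apart. *)
Lemma tp2_weight : tp2 e (weight e H).
Proof.
move=> x x' y y'.
suff h : (f (e (mx e y y') - e (mx e x x')) + f (e (mn e y y') - e (mn e x x'))
          <= f (e y - e x) + f (e y' - e x'))%E.
  rewrite -lee_fin !EFinM !weightE// -!expeRD lee_expeR.
  rewrite !fH in h.
  have add z z' : (- H z + - H z' = - (H z + H z'))%E.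
    by rewrite oppeD// /adde_def !negb_and (H_ninfty z) (H_ninfty z') orbT.
  by rewrite !add leeN2.
have n a b : f (e b - e a) != -oo%E by rewrite fH.
rewrite !emb_mx !emb_mn.
have [xx|xx] := leP (e x) (e x'); have [yy|yy] := leP (e y) (e y').
- by rewrite addeC.
- by rewrite [leRHS]addeC; apply: convex_between => //; [apply/andP; split; lra|ring].
- by apply: convex_between => //; [apply/andP; split; lra|ring].
- by [].
Qed.
End Weight.

(** The superlevel sets of exp(-H) are intervals. *)
Lemma measurable_weight (R : realType) (H : R -> \bar R) :
  (forall z, H z != -oo%E) -> convex_ereal H ->
  measurable2 (weight (@nonlattice_emb R) H).
Proof.
move=> Hn Hc; pose w (z : measurableTypeR R) : R := fine (expeR (- H z)).
have mw : measurable_fun setT w.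
  apply: (measurability (@RGenCInfty.G R)) => [|/= _ [_] [r] -> <-].
    exact: RGenCInfty.measurableE.
  rewrite setTI; apply: is_interval_measurable => a b /=.
  rewrite !in_itv/= !andbT => ra rb u aub; rewrite in_itv/= andbT.
  have [r0|r0] := leP r 0; first by rewrite (le_trans r0)// fine_ge0// expeR_ge0.
  have level z : (r <= w z) = (H z <= (- ln r)%:E)%E.
    have := weightE (fun t : R => t) Hn 0 z; rewrite /weight subr0 => wE.
    by rewrite -lee_fin wE -[in r%:E](lnK r0) -[(expR _)%:E]/(expeR _%:E) lee_expeR leeNr.
  rewrite !level in ra rb *; exact: (convex_sublevel Hc _ _ aub).
have msub : measurable_fun setT (fun z : measurableTypeR R * measurableTypeR R => (z.2 - z.1 : measurableTypeR R)).
  by apply: measurable_funB; [exact: measurable_snd|exact: measurable_fst].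
exact: (measurableT_comp mw msub).
Qed.

Lemma lattice_interpolationE (R : realType) (H : R -> \bar R) (k : int) :
  lattice_interpolation H k%:~R = H k%:~R.
Proof.
by rewrite /lattice_interpolation intrKfloor subrr subr0 mul1e mul0e adde0.
Qed.

(** * The real line *)

Lemma itg_pushforward d (T : measurableType d) (R : realType)
    (nu : {sigma_finite_measure set T -> \bar R}) (phi : T -> T) (f : T -> R) :
  measurable_fun setT phi -> (forall A, measurable A -> nu (phi @^-1` A) = nu A) ->
  measurable_fun setT f -> (forall t, 0 <= f t) ->
  itg nu (fun t => f (phi t)) = itg nu f.
Proof.
move=> mphi inv mf f0; rewrite /itg; transitivity (\int[pushforward nu phi]_t (f t)%:E)%E.
  by rewrite ge0_integral_pushforward//; [exact/measurable_EFinP|move=> t _; rewrite lee_fin].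
apply: (@eq_measure_integral _ _ _ setT nu (pushforward nu phi)) => A mA _; exact: inv.
Qed.

Section RealLine.
Context (R : realType).
Local Notation M := (measurableTypeR R).

Definition radd (s t : M) : M := s + t.
Definition ropp (s : M) : M := - s.

Lemma measurable_radd h : measurable_fun setT (radd^~ h).
Proof. exact: measurable_funD. Qed.

Lemma measurable_ropp : measurable_fun setT ropp.
Proof. exact: measurable_funN. Qed.

Lemma lebesgue_shift h (A : set M) : measurable A ->
  lebesgue_measure (radd^~ h @^-1` A) = lebesgue_measure A.
Proof.
move=> mA; apply/esym.
apply: (@lebesgue_measure_unique R (pushforward lebesgue_measure (radd^~ h))) => //.
  exact: measurable_radd.
move=> m _ [[a b]] _ <- /=; rewrite /pushforward.
have -> : radd^~ h @^-1` `]a, b] = `]a - h, b - h]%classic.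
  by apply/seteqP; split=> t /=; rewrite /radd !in_itv/= => /andP[]; lra.
rewrite !lebesgue_measure_itv/= !lte_fin ltrD2r -!EFinB; congr (if _ then _%:E else _); ring.
Qed.

Lemma lebesgue_window (a L : R) : 0 <= L ->
  lebesgue_measure [set t : M | a <= t <= a + L] = L%:E.
Proof.
move=> L0; have -> : [set t : M | a <= t <= a + L] = `[a, a + L]%classic by [].
rewrite lebesgue_measure_itv/= lte_fin ltrDl.
by case: ltgtP L0 => // [_ _|<-//]; rewrite -EFinB addrC addKr.
Qed.

Lemma real_state_space :
  state_space (@lebesgue_measure R) (@nonlattice_emb R) radd ropp.
Proof.
split=> //.
- exact: measurable_id.
- exact: measurable_radd.
- move=> h f mf f0; apply: itg_pushforward => //; first exact: measurable_radd.
  exact: lebesgue_shift.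
- move=> f mf f0; apply: itg_pushforward => //; first exact: measurable_ropp.
  by move=> A; exact: lebesgue_measureN.
- by move=> s L L0; rewrite -(lebesgue_window s L0).
- move=> s L L0; rewrite -(lebesgue_window (nonlattice_emb s - L) L0) subrK.
  exact: lexx.
- move=> a L L0; apply: (@le_trans _ _ L%:E); last by rewrite lee_fin lerDl.
  by rewrite -(lebesgue_window a L0).
- by move=> r; exists r; rewrite /nonlattice_emb lexx gerBl ler01.
Qed.
End RealLine.

(** * The integers *)

Section Integers.
Context (R : realType).

(** A separate name for the counting measure on the integers, to carry its instance of
    a sigma-finite measure. *)
Definition int_counting : set int -> \bar R := counting.
HB.instance Definition _ := Measure.on int_counting.

Lemma counting_card_eq (A : set int) (B : set int) : (A #= B)%card ->
  int_counting A = int_counting B.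
Proof.
move=> AB; rewrite /int_counting /counting; have [fA|nfA] := pselect (finite_set A).
  have fB : finite_set B by rewrite -(eq_finite_set AB).
  by rewrite !asboolT//; move/(fcard_eq fA fB): AB => ->.
by rewrite !asboolF// -(eq_finite_set AB).
Qed.

Lemma counting_image (f : nat -> int) n : injective f ->
  int_counting (f @` `I_n) = (n%:R)%:E.
Proof.
move=> inj; have fn : (f @` `I_n #= `I_n)%card by apply: inj_card_eq => i j _ _; exact: inj.
have fin : finite_set (f @` `I_n) by rewrite (eq_finite_set fn); exact: finite_II.
by rewrite /int_counting /counting asboolT// (card_fset_set fn).
Qed.

Lemma int_counting_sigma_finite : sigma_finite setT int_counting.
Proof.
exists (fun n => [set i : int | (`|i| <= n)%N]).
  by apply/seteqP; split=> // i _; exists `|i|%N => //=.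
move=> n; split=> //.
apply: (@le_lt_trans _ _ (int_counting ([set Posz i | i in `I_n.+1] `|` [set - Posz i | i in `I_n.+1]))).
  apply: le_measure; rewrite ?inE// => -[i|i] /= h; [left|right].
    by exists i.
  by exists i.+1 => //; rewrite NegzE.
apply: (le_lt_trans (measureU2 int_counting _ _)) => //.
have fin f : injective f -> (int_counting (f @` `I_n.+1) < +oo)%E.
  by move/counting_image => ->; rewrite ltry.
by apply: lte_add_pinfty; apply: fin => i j; [case|move/oppr_inj => []].
Qed.

HB.instance Definition _ :=
  @Measure_isSigmaFinite.Build _ _ _ int_counting int_counting_sigma_finite.

Lemma counting_preimage (phi psi : int -> int) (A : set int) :
  cancel phi psi -> cancel psi phi -> int_counting (phi @^-1` A) = int_counting A.
Proof.
move=> K K'; apply: counting_card_eq.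
have {2}-> : A = phi @` (phi @^-1` A).
  by apply/seteqP; split=> [t At|t [s ? <-]//]; exists (psi t); rewrite /= K'.
by rewrite card_eq_sym; apply: inj_card_eq => i j _ _; exact: (can_inj K).
Qed.

Lemma counting_window_ge (k : int) (L : R) : 0 <= L ->
  (L%:E <= int_counting [set t : int | ((k%:~R : R) <= t%:~R <= k%:~R + L)%R])%E.
Proof.
move=> L0; pose n := Num.trunc L.
have /andP[n1 n2] := truncn_itv L0.
apply: (@le_trans _ _ (int_counting [set k + Posz i | i in `I_n.+1])).
  by rewrite counting_image ?lee_fin ?ltW// => i j /addrI [].
apply: le_measure; rewrite ?inE// => _ [i /= ni <-].
rewrite intrD lerDl lerD2l ler0n/=; apply: le_trans n1.
by rewrite ler_nat.
Qed.

Lemma counting_window_le (a L : R) : 0 <= L ->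
  (int_counting [set t : int | (a <= t%:~R <= a + L)%R] <= (L + 1)%:E)%E.
Proof.
move=> L0; pose n := Num.trunc L; pose k := Num.ceil a.
have /andP[n1 n2] := truncn_itv L0.
have ka : a <= k%:~R := ceil_ge a.
apply: (@le_trans _ _ (int_counting [set k + Posz i | i in `I_n.+1])).
  apply: le_measure; rewrite ?inE// => t /= /andP[ta tL].
  have kt : k <= t by rewrite ceil_le_int.
  have tkE : t = k + `|t - k|%N by rewrite gez0_abs ?subr_ge0// subrKC.
  exists `|t - k|%N => //=; rewrite ltnS truncn_ge_nat//.
  have -> : (`|t - k|%N%:R : R) = t%:~R - k%:~R.
    by rewrite pmulrn gez0_abs ?subr_ge0// rmorphB.
  lra.
rewrite counting_image; last by move=> i j /addrI [].
by rewrite lee_fin -natr1 lerD2r.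
Qed.

Lemma int_state_space :
  state_space (int_counting : {sigma_finite_measure set int -> \bar R})
    (@lattice_emb R) +%R -%R.
Proof.
split=> //.
- exact: intr_inj.
- by move=> s t; exact: intrD.
- by move=> s; exact: mulrNz.
- move=> h f mf f0; apply: (@itg_pushforward _ _ R int_counting (fun t => t + h) f) => // A mA.
  by apply: (@counting_preimage _ (+%R^~ (- h))) => t; rewrite (addrK, subrK).
- move=> f mf f0; apply: (@itg_pushforward _ _ R int_counting (fun t => - t) f) => // A mA.
  by apply: (@counting_preimage _ -%R) => t; rewrite opprK.
- by move=> s L L0; exact: counting_window_ge.
- move=> s L L0; pose A := [set t | (lattice_emb R s - L <= lattice_emb R t <= lattice_emb R s)%R].
  apply: (@le_trans _ _ (int_counting (-%R @^-1` A))).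
    2: by rewrite (@counting_preimage -%R -%R) //; exact: opprK.
  apply: (le_trans (counting_window_ge (- s) L0)).
  apply: le_measure; rewrite ?inE// => t /=; rewrite /A/= /lattice_emb !mulrNz => /andP[]; lra.
- by move=> a L L0; exact: counting_window_le.
- move=> r; exists (Num.floor r); rewrite /lattice_emb floor_le andbT.
  by have := floorD1_gt r; rewrite intrD; lra.
Qed.

(** The product of two discrete countable spaces is discrete. *)
Lemma measurable2_int (k : int -> int -> R) : measurable2 k.
Proof.
move=> _ Y _; rewrite setTI.
have -> : (fun z : int * int => k z.1 z.2) @^-1` Y = \bigcup_i ([set i] `*` (k i @^-1` Y)).
  by apply/seteqP; split=> [[a b] /= h|[a b] [i _ [/= -> ]] //]; exists a.
by apply: countable_bigcupT_measurable => [|i]; [exact: countableP|exact: measurableX].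
Qed.
End Integers.

(** * The two cases of the theorem *)

(** When x and y are bounded below, x + 1 and y + 1 are comparable to x and y, and the
    minimum with 1 is free because p is a probability. *)
Lemma prob_upper (R : realType) (p C D x y n : R) : 0 < C -> 0 < D -> 0 < n ->
  0 <= x -> 0 <= y -> p <= 1 -> p <= C * ((x + 1) * (y + 1) / n) ->
  x + 1 <= D * x -> y + 1 <= D * y -> p <= (C * D ^+ 2 + 1) * Num.min 1 (x * y / n).
Proof.
move=> C0 D0 n0 x0 y0 p1 pC xD yD; have C'0 : 0 <= C * D ^+ 2 by rewrite mulr_ge0 ?sqr_ge0 ?(ltW C0).
have r0 : 0 <= x * y / n by rewrite divr_ge0 ?mulr_ge0 ?(ltW n0).
have [h|h] := leP 1 (x * y / n); first by rewrite mulr1; lra.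
apply: (le_trans pC); apply: (@le_trans _ _ (C * D ^+ 2 * (x * y / n))); last by nra.
have -> : C * D ^+ 2 * (x * y / n) = C * ((D * x) * (D * y) / n) by field; rewrite gt_eqF.
rewrite ler_wpM2l ?(ltW C0)// ler_wpM2r ?invr_ge0 ?(ltW n0)//.
by rewrite ler_pM//; lra.
Qed.

(* In the nonlattice case the constant C of the upper bound depends on a lower
   bound delta on x and y: for N = 1 the probability is 1, so no C can serve for
   all real x, y > 0. In the lattice case x, y > 0 means x, y >= 1. *)
Theorem theorem3p6 (R : realType) (H : R -> \bar R)
    (H_ninfty : forall z, H z != -oo%E) :
  (lattice_convex H -> lattice_moment H ->
    exists c C : R, [/\ 0 < c, 0 < C &
    forall (x y : int) (N : nat),
      0 < x -> 0 < y -> (0 < N)%N -> lattice_bridge_defined H N x y ->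
      c * Num.min 1 (x%:~R * y%:~R / N%:R)
        <= lattice_bridge_prob H N x y (stays_nonneg (@lattice_emb R) N)
        <= C * Num.min 1 (x%:~R * y%:~R / N%:R)])
  /\
  (convex_ereal H -> nonlattice_moment H ->
    exists2 c : R, 0 < c & forall delta : R, 0 < delta ->
    exists2 C : R, 0 < C & forall (x y : R) (N : nat),
      0 < x -> 0 < y -> (0 < N)%N -> nonlattice_bridge_defined H N x y ->
      c * Num.min 1 (x * y / N%:R)
        <= nonlattice_bridge_prob H N x y (stays_nonneg (@nonlattice_emb R) N)
      /\
      (delta <= x -> delta <= y ->
       nonlattice_bridge_prob H N x y (stays_nonneg (@nonlattice_emb R) N)
        <= C * Num.min 1 (x * y / N%:R))).
Proof.
split=> [cvx mom|cvx mom].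
  have HE x y : lattice_interpolation H (lattice_emb R y - lattice_emb R x) =
      H (lattice_emb R y - lattice_emb R x).
    by rewrite /lattice_emb -rmorphB lattice_interpolationE.
  have [c [C [c0 C0 B]]] := bridge_bounds (int_state_space R) (o := 0) erefl H_ninfty
    (measurable2_int _) (tp2_weight H_ninfty cvx HE) mom.
  exists c, (C * 2 ^+ 2 + 1); split=> // [|x y N x0 y0 N0 Bd]; first by nra.
  have x1 : (1 : R) <= x%:~R by rewrite (ler_int _ 1).
  have y1 : (1 : R) <= y%:~R by rewrite (ler_int _ 1).
  have xp : (0 : R) <= x%:~R by lra.
  have yp : (0 : R) <= y%:~R by lra.
  have [lo one up] := B x y N xp yp N0 Bd.
  apply/andP; split; first exact: lo.
  by apply: (prob_upper C0 _ _ xp yp one up); rewrite ?ltr0n//; lra.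
have [c [C [c0 C0 B]]] := bridge_bounds (real_state_space R) (o := 0) erefl H_ninfty
  (measurable_weight H_ninfty cvx) (tp2_weight H_ninfty cvx (fun _ _ => erefl)) mom.
exists c => // delta delta0; pose D := 1 + delta^-1.
have D0 : 0 < D by rewrite ltr_wpDr// invr_ge0 ltW.
exists (C * D ^+ 2 + 1) => [|x y N x0 y0 N0 Bd]; first by nra.
have [lo one up] := B x y N (ltW x0) (ltW y0) N0 Bd.
split=> [|dx dy]; first exact: lo.
have grow z : delta <= z -> z + 1 <= D * z.
  move=> dz; rewrite mulrDl mul1r lerD2l mulrC ler_pdivlMr// mul1r.
  exact: dz.
by apply: (prob_upper C0 D0 _ (ltW x0) (ltW y0) one up); rewrite ?ltr0n//; exact: grow.
Qed.
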